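(* Let $\gamma>0$ be fixed, $\tau=\gamma\epsilon$ and $\alpha_{hex}=\frac{16}{9}$. Let $E_0$ be a fixed origin-symmetric convex Wulff-like hexagon with sides of lengths $L_1^0,\dots,L_6^0$. For all $\epsilon>0$ let $E_0^\epsilon\in\widetilde{\mathcal D}_\epsilon$ be a discrete origin-symmetric convex Wulff-like hexagon whose Wulff-like envelope $\mathcal W(E_0^\epsilon)$ satisfies $\mathrm d_{\mathcal H}(\mathcal W(E_0^\epsilon),E_0)<\epsilon$. For $k\ge1$ let $E_k^\epsilon\in\mathcal D_\epsilon$ be a minimizer of $\mathcal F_{\tau,\epsilon}(\cdot,E_{k-1}^\epsilon)$ on $\mathcal D_\epsilon$, and let $E^\epsilon(t):=\mathcal W\big(E^\epsilon_{\lfloor t/(\gamma\epsilon)\rfloor}\big)$. Assume in addition that one of the following conditions holds: (a) $\min_{1\le i\le6}L_i^0>\alpha_{hex}\gamma$ (total pinning); (b) $L_i^0=L^0<\alpha_{hex}\gamma$ for every $i=1,\dots,6$ (self-similar evolution vanishing in finite time). Then there exists $T>0$ such that $E^\epsilon(t)$ converges (in the Hausdorff topology), locally in time on $[0,T)$, to $E(t)$ as $\epsilon\to0$, where $E(t)$ is the unique origin-symmetric convex Wulff-like hexagon with sides $S_i(t)$ (with exterior unit normal $n_i$) of length $L_i(t)$ whose distances $s_i(t)$ from the origin solve the system of degenerate ordinary differential equations $$\dot s_i(t)=-\frac{\sqrt3}{2}\Big(\frac1\gamma\Big\lfloor\frac{\alpha_{hex}\gamma}{L_i(t)}\Big\rfloor\Big),\qquad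 i=1,\dots,6,$$ for almost every $t\in[0,T)$, with initial condition $L_i(0)=L_i^0$. Accordingly, the law for each side length $L_i(t)$ is $$\dot L_i(t)=\frac1\gamma\Big\lfloor\frac{\alpha_{hex}\gamma}{L_i(t)}\Big\rfloor-\frac1\gamma\Big(\Big\lfloor\frac{\alpha_{hex}\gamma}{L_{i-1}(t)}\Big\rfloor+\Big\lfloor\frac{\alpha_{hex}\gamma}{L_{i+1}(t)}\Big\rfloor\Big),\qquad i=1,\dots,6,$$ for almost every $t\in[0,T)$, with indices taken modulo $6$.
   Context: Lattice. Let $\eta_1=(1,0)$, $\eta_2=(1/2,\sqrt3/2)$, $\eta_3=\eta_1-\eta_2$, and let $\mathbb T=\{a\eta_1+b\eta_2:\ a,b\in\mathbb Z\}$ be the triangular lattice. For $e=(e^1,e^2)\in\mathbb R^2$ put $e^\perp=(-e^2,e^1)$. Let $\mathcal R=\{\pm\eta_1^\perp,\pm\eta_2^\perp,\pm\eta_3^\perp\}$ and let $H=\frac{\sqrt3}{3}\,\mathrm{conv}(\mathcal R)$ (a closed regular hexagon of side length $\sqrt3/3$, the cell of the dual lattice). For $\epsilon>0$ and $i\in\epsilon\mathbb T$ put $H_\epsilon(i)=i+\epsilon H$. Admissible sets. For $\mathcal I\subset\epsilon\mathbb T$ let $E_{\mathcal I}=\bigcup_{i\in\mathcal I}H_\epsilon(i)$, and $\mathcal D_\epsilon=\{E\subseteq\mathbb R^2:\ E=E_{\mathcal I}\text{ for some }\mathcal I\subseteq\epsilon\mathbb T\}$. Perimeter energy. For $E=E_{\mathcal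 I}\in\mathcal D_\epsilon$, $P_\epsilon(E)=\mathcal H^1(\partial E)$; equivalently, $P_\epsilon(E)$ is $\frac{\sqrt3}{3}\epsilon$ times the number of nearest-neighbour pairs ($|i-j|=\epsilon$) of points $i,j\in\epsilon\mathbb T$ with $i\in\mathcal I$, $j\notin\mathcal I$. Norms. $\varphi_{hex}(\nu)=\frac23\sum_{k=1}^3|\langle\nu,\eta_k\rangle|$, with dual norm $\varphi_{hex}^\circ(\xi)=\frac{\sqrt3}{2}\max_{k=1,2,3}|\langle\xi,\eta_k^\perp\rangle|$. Discrete distance. For $F\in\mathcal D_\epsilon$ and $x\in\mathbb R^2$ (defined uniquely up to a Lebesgue-null set), $$d^\epsilon(x,\partial F)=\begin{cases}\inf\{\varphi^\circ_{hex}(i-j):\ i,j\in\epsilon\mathbb T,\ x\in H_\epsilon(i),\ H_\epsilon(j)\subset F\},& x\notin F,\\ \inf\{\varphi^\circ_{hex}(i-j):\ i,j\in\epsilon\mathbb T,\ x\in H_\epsilon(i),\ H_\epsilon(j)\not\subset F\},& x\in F.\end{cases}$$ Energy. For $E,F\in\mathcal D_\epsilon$ and $\tau>0$, $$\mathcal F_{\tau,\epsilon}(E,F)=P_\epsilon(E)+\frac1\tau\int_{E\triangle F}d^\epsilon(x,\partial F)\,dx .$$ Wulff-like sets. Let $n_1,\dots,n_6$ be the six unit vectors in $\mathcal R$ listed in cyclic (angular) order, consecutive ones forming an angle $\pi/3$: $n_1=\eta_1^\perp$, $n_2=\eta_2^\perp$, $n_3=-\eta_3^\perp$, $n_4=-n_1$,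 $n_5=-n_2$, $n_6=-n_3$, indices modulo $6$; they are the exterior unit normals of the Wulff shape $\{\varphi_{hex}^\circ\le1\}$, a regular hexagon. A bounded set $E\subset\mathbb R^2$ is Wulff-like if $\partial E$ is a polygonal closed curve whose consecutive sides $S_1,\dots,S_m$ have exterior unit normals $\nu_1,\dots,\nu_m$ (indices modulo $m$) such that (1) $\nu_i\in\{n_1,\dots,n_6\}$ for every $i$, and (2) if $\nu_i=n_j$ then $\nu_{i+1}\in\{n_{j-1},n_{j+1}\}$. A convex Wulff-like set is automatically a hexagon and is called a convex Wulff-like hexagon; its sides are labelled so that the $i$-th side has exterior normal $n_i$. Discrete hexagons. $E\in\mathcal D_\epsilon$ is a discrete convex Wulff-like hexagon if there is a convex Wulff-like hexagon $K$ with $E=\bigcup\{H_\epsilon(i):\ i\in\epsilon\mathbb T,\ H_\epsilon(i)\subset K\}$; the class of these sets is $\widetilde{\mathcal D}_\epsilon$. For $E\in\widetilde{\mathcal D}_\epsilon$, the Wulff-like envelope $\mathcal W(E)$ is the smallest convex Wulff-like hexagon containing $E$. A set $E$ is origin-symmetric if $E=-E$. Hausdorff distance: $\mathrm d_{\mathcal H}(A,B)=\max\{\sup_{a\in A}\mathrm{dist}(a,B),\ \sup_{b\in B}\mathrm{dist}(b,A)\}$ with the Euclidean distance; limits in the Hausdorff sense are taken to be closed sets. ''Locally in time on $[0,T)$'' means locally uniformly with respect to $t\in[0,T)$. *)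

(* Defs.v *)
From HB Require Import structures.
From mathcomp Require Import all_boot all_order all_algebra.
From mathcomp Require Import all_classical all_reals all_analysis.

Set Implicit Arguments.
Unset Strict Implicit.
Unset Printing Implicit Defensive.

Import Order.TTheory GRing.Theory Num.Theory.
Import numFieldNormedType.Exports.

Local Open Scope classical_set_scope.
Local Open Scope ring_scope.

(* The library norm of R * R is the sup norm; it is used only through the
   topology and boundedness.  Metric notions go through enorm. *)
Notation plane R := (R * R)%type (only parsing).

Section Plane.
Context {R : realType}.
Implicit Types (x y nu : plane R) (A B : set (plane R)).

Definition inner x y : R := x.1 * y.1 + x.2 * y.2.

Definition enorm x : R := Num.sqrt (inner x x).

Definition perp x : plane R := (- x.2, x.1).

Definition edist_set x A : \bar R :=
  ereal_inf [set (enorm (x - y))%:E | y in A].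

Definition hausdorff_dist A B : \bar R :=
  Order.max (ereal_sup [set edist_set x B | x in A])
            (ereal_sup [set edist_set y A | y in B]).

Definition origin_symmetric A : Prop := A = [set - x | x in A].

Definition segment x y : set (plane R) :=
  [set x + t *: (y - x) | t in `[0, 1]%classic].

Definition open_segment x y : set (plane R) :=
  [set x + t *: (y - x) | t in `]0, 1[%classic].

Definition frontier A : set (plane R) := closure A `\` interior A.

End Plane.

Section Lattice.
Context {R : realType}.
Implicit Types (eps tau : R) (i j x : plane R) (E F : set (plane R)).

Definition eta1 : plane R := (1, 0).
Definition eta2 : plane R := (1 / 2, Num.sqrt 3 / 2).
Definition eta3 : plane R := eta1 - eta2.

(* hexn k is n_(k+1): indices are shifted to start at 0. *)
Definition hexn (k : 'I_6) : plane R :=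
  nth 0 [:: perp eta1; perp eta2; - perp eta3;
            - perp eta1; - perp eta2; perp eta3] k.

Definition lattice eps : set (plane R) :=
  [set x | exists a b : int, x = eps *: (a%:~R *: eta1 + b%:~R *: eta2)].

Definition hexagon : set (plane R) :=
  [set x | exists w : 'I_6 -> R,
    [/\ forall k, 0 <= w k, \sum_k w k = 1 &
        x = (Num.sqrt 3 / 3) *: \sum_k w k *: hexn k]].

Definition cell eps i : set (plane R) := [set i + eps *: y | y in hexagon].

Definition cell_union eps (I : set (plane R)) : set (plane R) :=
  \bigcup_(i in I) cell eps i.

Definition admissible eps : set (set (plane R)) :=
  [set E | exists2 I, I `<=` lattice eps & E = cell_union eps I].

(* If E = cell_union eps I with I `<=` lattice eps, then I is recovered as the
   set of the i with cell eps i `<=` E. *)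
Definition boundary_bonds eps E : set (plane R * plane R) :=
  [set ij | [/\ lattice eps ij.1, lattice eps ij.2,
                enorm (ij.1 - ij.2) = eps,
                cell eps ij.1 `<=` E & ~ (cell eps ij.2 `<=` E)]].

(* The ordered pairs count each edge of the frontier of E once and the edges
   have length sqrt 3 / 3 * eps, so this is the 1-dimensional Hausdorff measure
   of the frontier. *)
Definition perimeter eps E : \bar R :=
  ((Num.sqrt 3 / 3 * eps)%:E * counting (boundary_bonds eps E))%E.

Definition phi_hex_dual x : R :=
  Num.sqrt 3 / 2 *
  Num.max `|inner x (perp eta1)|
    (Num.max `|inner x (perp eta2)| `|inner x (perp eta3)|).

(* The infimum over the empty set is +oo, e.g. for F = set0. *)
Definition discrete_dist eps F x : \bar R :=
  if x \in F then
    ereal_inf [set (phi_hex_dual (ij.1 - ij.2))%:E | ij in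
      [set ij : plane R * plane R |
        [/\ lattice eps ij.1, lattice eps ij.2, cell eps ij.1 x &
            ~ (cell eps ij.2 `<=` F)]]]
  else
    ereal_inf [set (phi_hex_dual (ij.1 - ij.2))%:E | ij in
      [set ij : plane R * plane R |
        [/\ lattice eps ij.1, lattice eps ij.2, cell eps ij.1 x &
            cell eps ij.2 `<=` F]]].

Definition energy tau eps E F : \bar R :=
  (perimeter eps E +
   (1 / tau)%:E * \int[lebesgue_measure \x lebesgue_measure]_(x in E `+` F)
                    discrete_dist eps F x)%E.

Definition is_minimizer tau eps F E : Prop :=
  admissible eps E /\
  forall E', admissible eps E' -> (energy tau eps E F <= energy tau eps E' F)%E.

End Lattice.

Section WulffLike.
Context {R : realType}.
Implicit Types (eps : R) (x y nu : plane R) (E K W : set (plane R)).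

Definition exterior_normal E x y nu : Prop :=
  inner nu (y - x) = 0 /\
  forall z, open_segment x y z ->
    \forall r \near (0 : R)^'+, interior E (z - r *: nu) /\ ~ E (z + r *: nu).

(* The vertices p are listed cyclically, the k-th side is [p_k, p_(k+1)] and
   has exterior normal hexn (c k). Sets are taken closed: if parts of the
   frontier of K could be missing, the union of the cells contained in K could
   have a truncated last row. *)
Definition wulff_like E : Prop :=
  [/\ bounded_set E, closed E &
  exists m (p : 'I_m -> plane R) (c : 'I_m -> 'I_6),
  [/\ (2 < m)%N,
      frontier E = \bigcup_k segment (p k) (p (ordS k)),
      forall k, p k != p (ordS k),
      forall k, exterior_normal E (p k) (p (ordS k)) (hexn (c k)) &
      forall k, c (ordS k) = ord_pred (c k) \/ c (ordS k) = ordS (c k)]].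

Definition convex_hexagon E : Prop :=
  wulff_like E /\ convex_set (E : set (convex_lmodType (plane R))).

Definition side E (i : 'I_6) : set (plane R) :=
  [set x | E x /\ forall y, E y -> inner y (hexn i) <= inner x (hexn i)].

Definition side_length E (i : 'I_6) : R :=
  sup [set enorm (xy.1 - xy.2) | xy in side E i `*` side E i].

(* The value of inner x (hexn i) for x in side E i: the (signed) distance from
   the origin of the line containing the side. *)
Definition side_dist E (i : 'I_6) : R := sup [set inner x (hexn i) | x in E].

Definition discrete_hexagon eps E : Prop :=
  exists2 K, convex_hexagon K &
    E = cell_union eps [set i | lattice eps i /\ cell eps i `<=` K].

Definition is_envelope E W : Prop :=
  [/\ convex_hexagon W, E `<=` W &
      forall K, convex_hexagon K -> E `<=` K -> W `<=` K].

(* set0 if there is no smallest hexagon containing E, i.e. if E is empty or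
   unbounded; set0 is at infinite Hausdorff distance from any nonempty set. *)
Definition envelope E : set (plane R) := xget set0 [set W | is_envelope E W].

End WulffLike.

Section Evolution.
Context {R : realType}.
Implicit Types (gamma T : R) (E : R -> set (plane R)).

Definition abs_continuous (a b : R) (f : R -> R) : Prop :=
  forall e, 0 < e -> exists2 d, 0 < d &
    forall m (u v : 'I_m -> R),
      (forall k, [/\ a <= u k, u k <= v k & v k <= b]) ->
      (forall k l, k != l -> v k <= u l \/ v l <= u k) ->
      \sum_k (v k - u k) < d -> \sum_k `|f (v k) - f (u k)| < e.

Definition alpha_hex : R := 16 / 9.

(* The integer part in the velocity of a side of length L. *)
Definition floor_rate gamma (L : R) : R :=
  (Num.floor (alpha_hex * gamma / L))%:~R.

(* Solutions are meant in the sense of Caratheodory: the side distances are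
   absolutely continuous on the compact subintervals of [0, T). *)
Definition is_solution gamma (L0 : 'I_6 -> R) T E : Prop :=
  [/\ forall t, 0 <= t < T -> convex_hexagon (E t) /\ origin_symmetric (E t),
      forall i b, 0 <= b < T -> abs_continuous 0 b (fun t => side_dist (E t) i),
      {ae @lebesgue_measure R, forall t, 0 <= t < T -> forall i,
        is_derive t (1 : R) (fun s => side_dist (E s) i)
          (- (Num.sqrt 3 / 2) *
            (1 / gamma * floor_rate gamma (side_length (E t) i)))} &
      forall i, side_length (E 0) i = L0 i].

Definition side_length_law gamma T E : Prop :=
  {ae @lebesgue_measure R, forall t, 0 <= t < T -> forall i,
    is_derive t (1 : R) (fun s => side_length (E s) i)
      (1 / gamma * floor_rate gamma (side_length (E t) i)
       - 1 / gamma * (floor_rate gamma (side_length (E t) (ord_pred i))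
                      + floor_rate gamma (side_length (E t) (ordS i))))}.

End Evolution.

(* Main.v *)
Require Import Defs.
From mathcomp Require Import all_boot all_order all_algebra.
From mathcomp Require Import all_classical all_reals all_analysis.
From mathcomp Require Import measurable_realfun finmap zify ring lra.
Set Implicit Arguments.
Unset Strict Implicit.
Unset Printing Implicit Defensive.
Import Order.TTheory GRing.Theory Num.Theory.
Import numFieldNormedType.Exports.
Local Open Scope classical_set_scope.
Local Open Scope ring_scope.

(** The theorem rests on a complete description of one minimising step, from
which the discrete evolution can be followed exactly up to an error of a
bounded number of lattice layers.

Write [A = alpha_hex * gamma].  In both cases the initial lengths single out
one integer [N] with [A / (N + 1) < L0 i] and [L0 i * N <= A]
([integer_window]): [N = 0] under pinning, the integer part of [A / L] for a
regular hexagon.  Then [N] is the integer part of [A / L i (t)] as long as the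
lengths stay above [A / (N + 1)], and they decrease at the common rate
[N / gamma].  So the limit is the hexagon [Hex (shrink gamma N s0 t)] whose
support numbers decrease linearly with the same speed, on a time interval
[T] that keeps half of the initial margin [zeta] above [A / (N + 1)].

One step.  A union of cells of finite energy is a finite set [I] of lattice
points.  Its
perimeter counts the bonds leaving [I], and its dissipation relative to a
lattice hexagon charges every missing point its depth below the sides and
every added point at least one.  Divided by the length of an edge the energy
becomes [latenergy] with a coefficient [c] of the order of [eps]
([energy_ge], [energy_le]).  Every lattice line met by [I] contributes a
leaving bond at both of its ends, so emptying the [i]-th layer below a side
with [l] points saves two bonds and costs about [c * i * l]: removing it pays
off as long as [c * i * l < 2].  This heuristic is turned into a proof in
[latenergy_minimizer].  The points near a corner belong to layers of several
sides and spoil the bookkeeping, but only by a bounded number of points per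
layer, hence by [O(c)] in total, whereas a wrong decision about a layer costs
more than that unless [c * N * l] is within [O(c)] of [2].  Therefore a
minimiser is again a lattice hexagon, with every side moved by [N] layers, or by [N - 1]
layers if its length is within [O(1)] of the threshold ([minimizer_step]).

Many steps.  A side makes a slow move, by [N - 1] layers, only while it has
more than [A / (N * eps) - O(1)] points, and it starts with at most
[A / (N * eps) + O(1)].  Since the number of its points plus the number of its
slow moves never increases, it makes only [O(1)] slow moves altogether,
uniformly in [eps] ([discrete_evolution]).  The support numbers of the
discrete envelope stay within [O(eps)] of those of the limit, and for hexagons
this controls the Hausdorff distance ([scale_convergence]).

Uniqueness.  Along a solution the lengths are absolutely continuous.  While
they are close to their initial values all the integer parts are [N], or
[N - 1] if [N >= 2], and then the rate of a side is at most the sum of the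
rates of its neighbours.  So no length increases, and none decreases fast
enough to exhaust the margin before [T].  Hence the integer parts are [N]
throughout, and the support numbers are affine functions of time
([solution_unique]).  The passage from
almost every time to all times is [ac_le], the monotonicity of an absolutely
continuous function with a one-sided bound on its derivative. *)

(** * Lattice hexagons *)

(** The six normals are indexed cyclically, so statements about a side and
its neighbours are written with rotations of the index; all of geometry is
then invariant under rotation and a single index [k] suffices. *)
Definition rt (n : nat) (k : 'I_6) : 'I_6 := iter n (@ordS 6) k.
Arguments rt : simpl never.

Lemma rtD m n k : rt m (rt n k) = rt (m + n) k.
Proof. by rewrite /rt iterD. Qed.

Lemma rt6 n k : rt (6 + n) k = rt n k.
Proof. by rewrite -rtD; case: (rt n k) => [[|[|[|[|[|[|//]]]]]] ?]; exact/val_inj. Qed.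

Lemma rt60 k : rt 6 k = k.
Proof. exact: (rt6 0). Qed.

Lemma rt_pred k : ord_pred k = rt 5 k.
Proof. by case: k => [[|[|[|[|[|[|//]]]]]] ?]; exact/val_inj. Qed.

Lemma rt_ind k (P : 'I_6 -> Prop) :
  P k -> P (rt 1 k) -> P (rt 2 k) -> P (rt 3 k) -> P (rt 4 k) -> P (rt 5 k) ->
  forall j, P j.
Proof.
move=> P0 P1 P2 P3 P4 P5 j.
have [n n6 ->] : exists2 n, (n < 6)%N & j = rt n k.
  exists ((j + 6 - k) %% 6)%N; first by rewrite ltn_mod.
  by case: k {P0 P1 P2 P3 P4 P5} => [[|[|[|[|[|[|//]]]]]] ?];
     case: j => [[|[|[|[|[|[|//]]]]]] ?]; exact/val_inj.
by case: n n6 => [|[|[|[|[|[|]]]]]].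
Qed.

Lemma rt_bij n : bijective (rt n).
Proof.
exists (rt (5 * n)) => k; rewrite rtD ?[(_ + 5 * _)%N]addnC -mulSnr; elim: n => // n IH; by rewrite mulnS rt6.
Qed.

Lemma rt_sum (V : nmodType) n (F : 'I_6 -> V) : \sum_k F (rt n k) = \sum_k F k.
Proof. by rewrite [RHS](reindex (rt n)) //; exact/onW_bij/rt_bij. Qed.

Ltac case6 k := case: k => [[|[|[|[|[|[|//]]]]]] ?].

Section LatticeHexagon.
Implicit Types (z w : int * int) (s : 'I_6 -> int) (A I J : {fset int * int}).

(** Up to the factor [eps * sqrt 3 / 2], [latf k] is the height of a lattice
point in the direction of the [k]-th normal, in coordinates relative to the
basis of the lattice; see [hf_lat]. *)
Definition latf (k : 'I_6) z : int :=
  nth 0 [:: z.2; - z.1; - z.1 - z.2; - z.2; z.1; z.1 + z.2] k.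

(** The six unit lattice vectors, ordered so that [latu k] is parallel to the
[k]-th side and points to the next one. *)
Definition latu (k : 'I_6) : int * int :=
  nth 0 [:: (-1, 0); (0, -1); (1, -1); (1, 0); (0, 1); (-1, 1)] k.

(** Two consecutive heights are coordinates on the lattice, and the remaining
four are linear in them.  This is what reduces every claim about lattice
hexagons to linear arithmetic. *)
Lemma latf2 k z : latf (rt 2 k) z = latf (rt 1 k) z - latf k z.
Proof. by case6 k; rewrite /latf /=; lia. Qed.
Lemma latf3 k z : latf (rt 3 k) z = - latf k z.
Proof. by case6 k; rewrite /latf /=; lia. Qed.
Lemma latf4 k z : latf (rt 4 k) z = - latf (rt 1 k) z.
Proof. by case6 k; rewrite /latf /=; lia. Qed.
Lemma latf5 k z : latf (rt 5 k) z = latf k z - latf (rt 1 k) z.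
Proof. by case6 k; rewrite /latf /=; lia. Qed.

Definition latf_rt := (latf2, latf3, latf4, latf5).

Lemma latfD k z w : latf k (z + w) = latf k z + latf k w.
Proof. by case6 k; rewrite /latf /=; lia. Qed.
Lemma latf_u k : latf k (latu k) = 0.
Proof. by case6 k. Qed.
Lemma latf_u1 k : latf (rt 1 k) (latu k) = 1.
Proof. by case6 k. Qed.

Lemma latf_inj k z w :
  latf k z = latf k w -> latf (rt 1 k) z = latf (rt 1 k) w -> z = w.
Proof.
by case: z w => [a b] [c d]; case6 k; rewrite /latf /= => ? ?; congr pair; lia.
Qed.

Definition latpt k (p q : int) : int * int :=
  ((latu k).1 * q - (latu (rt 1 k)).1 * p,
   (latu k).2 * q - (latu (rt 1 k)).2 * p).

Lemma latf_pt k p q : latf k (latpt k p q) = p.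
Proof. by case6 k; rewrite /latf /latpt /=; lia. Qed.
Lemma latf1_pt k p q : latf (rt 1 k) (latpt k p q) = q.
Proof. by case6 k; rewrite /latf /latpt /=; lia. Qed.

Lemma latptK k z : latpt k (latf k z) (latf (rt 1 k) z) = z.
Proof. by apply: (@latf_inj k); rewrite ?latf_pt ?latf1_pt. Qed.

Definition inhex s z := [forall k, latf k z <= s k].

Lemma inhexP s k z : reflect
  [/\ latf k z <= s k, latf (rt 1 k) z <= s (rt 1 k) &
   [/\ latf (rt 1 k) z - latf k z <= s (rt 2 k), - latf k z <= s (rt 3 k),
    - latf (rt 1 k) z <= s (rt 4 k) & latf k z - latf (rt 1 k) z <= s (rt 5 k)]]
  (inhex s z).
Proof.
apply: (iffP forallP) => [h|[? ? [? ? ? ?]]].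
  by do ![split]; rewrite -?latf_rt.
by apply: (rt_ind (k := k)); rewrite ?latf_rt.
Qed.

(** The last lattice point of side [k] is at height [s (rt 1 k)] for the next
normal, the first one at height [s k - s (rt 5 k)]; so this is the number of
lattice steps along the side, negative if the constraint is redundant. *)
Definition latlen s k : int := s (rt 5 k) + s (rt 1 k) - s k.

Lemma latlen_rt s j k :
  latlen s (rt j.+1 k) = s (rt j k) + s (rt j.+2 k) - s (rt j.+1 k).
Proof. by rewrite /latlen !rtD -[(5 + j.+1)%N]/(6 + j)%N rt6. Qed.

Lemma latlens s k : [/\ latlen s k = s (rt 5 k) + s (rt 1 k) - s k,
  latlen s (rt 1 k) = s k + s (rt 2 k) - s (rt 1 k),
  latlen s (rt 2 k) = s (rt 1 k) + s (rt 3 k) - s (rt 2 k),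
  latlen s (rt 3 k) = s (rt 2 k) + s (rt 4 k) - s (rt 3 k) &
  latlen s (rt 4 k) = s (rt 3 k) + s (rt 5 k) - s (rt 4 k) /\
  latlen s (rt 5 k) = s (rt 4 k) + s k - s (rt 5 k)].
Proof. by rewrite !latlen_rt rt60. Qed.

Lemma finite_inhex s : finite_set [set z | inhex s z].
Proof.
pose r (M : nat) : seq int := [seq n%:Z - M%:Z | n <- iota 0 (M + M).+1].
have rP (M : nat) (d : int) : (`|d| <= M)%N -> d \in r M.
  by move=> ?; apply/mapP; exists `|(d + M%:Z)%R|%N; [rewrite mem_iota; lia|lia].
pose k : 'I_6 := ord0.
pose M := (`|s k| + `|s (rt 3 k)| + `|s (rt 1 k)| + `|s (rt 4 k)|)%N.
apply: (@sub_finite_set _ _ [set` [seq latpt k p q | p <- r M, q <- r M]]);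
  last exact: finite_seq.
move=> z /= /(inhexP _ k) [? ? [? ? ? ?]].
suff : latpt k (latf k z) (latf (rt 1 k) z) \in [seq latpt k p q | p <- r M, q <- r M].
  by rewrite latptK.
apply: allpairs_f.
  by apply: rP; rewrite /M; lia.
by apply: rP; rewrite /M; lia.
Qed.

Definition hexset s : {fset int * int} := fset_set [set z | inhex s z].

Lemma in_hexset s z : (z \in hexset s) = inhex s z.
Proof.
rewrite /hexset in_fset_set; last exact: finite_inhex.
by apply/idP/idP => [/set_mem //|h]; exact/mem_set.
Qed.

Lemma count_line_ge (A : seq (int * int)) (P : pred (int * int)) k p (lo : int) n :
  (forall i, (i < n)%N -> (latpt k p (lo + i%:Z) \in A) && P (latpt k p (lo + i%:Z))) ->
  (n <= count P A)%N.
Proof.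
move=> h; rewrite -size_filter -[leqLHS](size_iota 0).
rewrite -(size_map (fun i : nat => latpt k p (lo + i%:Z))); apply: uniq_leq_size.
  rewrite map_inj_uniq ?iota_uniq // => i j /(congr1 (latf (rt 1 k))).
  by rewrite !latf1_pt; lia.
by move=> z /mapP [i]; rewrite mem_iota => /andP [_ /h /andP [a b]] ->; rewrite mem_filter a b.
Qed.

Lemma count_line_le (A : seq (int * int)) (P : pred (int * int)) k p (lo : int) n :
  uniq A ->
  (forall z, z \in A -> P z -> latf k z = p /\ lo <= latf (rt 1 k) z < lo + n%:Z) ->
  (count P A <= n)%N.
Proof.
move=> uA h; rewrite -size_filter -[leqRHS](size_iota 0).
rewrite -(size_map (fun i : nat => latpt k p (lo + i%:Z))).
apply: uniq_leq_size; first exact: filter_uniq.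
move=> z; rewrite mem_filter => /andP [Pz /h /(_ Pz) [<- /andP [? ?]]].
apply/mapP; exists `|(latf (rt 1 k) z - lo)%R|%N; first by rewrite mem_iota; lia.
by rewrite gez0_abs ?subr_ge0 // addrC subrK latptK.
Qed.

(** The index of the layer parallel to side [k] that contains [z], counted
from one for the points of the side itself. *)
Definition depth s k z : nat := `|(s k + 1 - latf k z)%R|%N.

Lemma depthE s k z : inhex s z -> (depth s k z)%:Z = s k + 1 - latf k z.
Proof. by move=> /forallP /(_ k) ?; rewrite /depth; lia. Qed.

Lemma depth_gt0 s k z : inhex s z -> (0 < depth s k z)%N.
Proof. by move=> /forallP /(_ k) ?; rewrite /depth; lia. Qed.

Definition width s k : nat := `|(s k + s (rt 3 k) + 1)%R|%N.

(** For a point of the hexagon this is its distance, in lattice steps, to the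
points outside. *)
Definition mindepth s z : nat := \big[minn/depth s ord0 z]_k depth s k z.

Lemma mindepth_le s k z : (mindepth s z <= depth s k z)%N.
Proof. by rewrite /mindepth -minEnat -leEnat; exact: bigmin_le. Qed.

Lemma le_mindepth s z n : (forall k, n <= depth s k z)%N -> (n <= mindepth s z)%N.
Proof. by move=> h; rewrite /mindepth -minEnat -leEnat; apply: le_bigmin => [|? _]; exact: h. Qed.

End LatticeHexagon.

(** * Bonds leaving a finite set of lattice points *)

Section Exits.
Implicit Types (z w : int * int) (s : 'I_6 -> int) (A I J : {fset int * int}).

Definition exits (k : 'I_6) I : {fset int * int} := [fset z in I | (z + latu k)%R \notin I]%fset.

Definition unmet s I k n : bool := ~~ has (fun z => inhex s z && (depth s k z == n)) I.

(** Walking from a point of [I] in direction [latu k] one must leave [I],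
because [I] is finite; the bond found has the same height as the start. *)
Lemma exitsP k I z : z \in I -> exists2 w, w \in exits k I & latf k w = latf k z.
Proof.
move=> zI; apply: contrapT => no.
have all_in i : latpt k (latf k z) (latf (rt 1 k) z + i%:Z) \in I.
  elim: i => [|i IH]; first by rewrite addr0 latptK.
  apply: contrapT => nI; apply: no.
  exists (latpt k (latf k z) (latf (rt 1 k) z + i%:Z)); last by rewrite latf_pt.
  rewrite !inE /= IH /=; apply/negP; apply: contra_not nI.
  suff -> : latpt k (latf k z) (latf (rt 1 k) z + i%:Z) + latu k =
     latpt k (latf k z) (latf (rt 1 k) z + i.+1%:Z) by [].
  by apply: (@latf_inj k); rewrite latfD ?latf_u ?latf_u1 ?latf_pt ?latf1_pt; lia.
have : (#|` I|.+1 <= count predT I)%N.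
  by apply: (@count_line_ge _ _ k (latf k z) (latf (rt 1 k) z)) => i _; rewrite all_in.
by rewrite count_predT ltnn.
Qed.

(** Each line parallel to side [k] that meets [I] inside the hexagon provides
at least one leaving bond in direction [latu k], and distinct lines provide
distinct bonds. *)
Lemma exits_ge s I k :
  (width s k <= #|` exits k I| + \sum_(1 <= n < (width s k).+1) unmet s I k n)%N.
Proof.
set W := width s k.
rewrite -[leqLHS](size_iota 1) -(count_predC (unmet s I k)) addnC.
rewrite /index_iota subSS subn0.
have -> : (\sum_(n <- iota 1 W) unmet s I k n = count (unmet s I k) (iota 1 W))%N.
  by rewrite -sum1_count [RHS]big_mkcond /=; apply: eq_bigr => i _; case: unmet.
rewrite leq_add2r -size_filter -(size_map (depth s k)); apply: uniq_leq_size.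
  by rewrite filter_uniq ?iota_uniq.
move=> n; rewrite mem_filter /= negbK => /andP [/hasP [z zI /andP [zs /eqP zn]] _].
have [w wI wz] := exitsP k zI; apply/mapP; exists w => //.
by rewrite -zn /depth wz.
Qed.

(** A hexagon is convex, so each line leaves it only once: the lower bound of
[exits_ge] is attained. *)
Lemma exits_hexset_le s k : 0 <= s k + s (rt 3 k) + 1 ->
  (#|` exits k (hexset s)|%:Z <= s k + s (rt 3 k) + 1).
Proof.
move=> W0; rewrite -[leRHS]gez0_abs // lez_nat -/(width s k).
rewrite -(size_iota 1 (width s k)) -(size_map (depth s k)).
have exP z : z \in exits k (hexset s) -> inhex s z /\ ~~ inhex s (z + latu k).
  by rewrite !inE /= !in_hexset => /andP [].
apply: uniq_leq_size.
  rewrite map_inj_in_uniq ?fset_uniq // => z w /exP [zs zn] /exP [ws wn] /(congr1 Posz).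
  rewrite !depthE // => e; have {}e : latf k z = latf k w by lia.
  wlog lt : z w e zs zn ws wn / latf (rt 1 k) z <= latf (rt 1 k) w.
    move=> H; have [h|h] := leP (latf (rt 1 k) z) (latf (rt 1 k) w); first exact: H.
    by apply/esym/H => //; exact: ltW.
  move: lt; rewrite le_eqVlt => /orP [/eqP|lt]; first exact: latf_inj.
  case/negP: zn; move: zs ws => /(inhexP _ k) [? ? [? ? ? ?]] /(inhexP _ k) [? ? [? ? ? ?]].
  by apply/(inhexP _ k); rewrite !latfD latf_u latf_u1; do ![split]; lia.
move=> n /mapP [z /exP [zs _] ->]; rewrite mem_iota.
have := depth_gt0 k zs; rewrite /depth /width.
by move: zs => /(inhexP _ k) [? ? [? ? ? ?]]; lia.
Qed.

(** Opposite sides share their lines; their layers are numbered in opposite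
order. *)
Lemma unmet_sym s I k n : 0 <= s k + s (rt 3 k) + 1 -> (1 <= n <= width s k)%N ->
  unmet s I (rt 3 k) n = unmet s I k ((width s k).+1 - n)%N.
Proof.
move=> W0 n1; congr negb; apply: eq_in_has => z zI; case zs: (inhex s z) => //=.
move: zs n1 => /(inhexP _ k) [? ? [? ? ? ?]]; rewrite /depth /width latf3.
move=> ?; apply/idP/idP => /eqP ?; apply/eqP; lia.
Qed.

End Exits.

(** * Weights on the points of a lattice hexagon *)

Section Counting.
Implicit Types (z w : int * int) (s : 'I_6 -> int) (A I J : {fset int * int}).

(** Only points that are shallow with respect to a single side can be charged
entirely to the layers of that side. *)
Definition private D s k z : bool :=
  (depth s k z <= D)%N && [forall j, (j != k) ==> (D < depth s j z)%N].

(** Points far from all the sides lie on six deep lines, one for each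
direction, among which their cost has to be shared. *)
Definition core D s z : bool := [forall j, (D < depth s j z)%N].

(** The share of six times its depth that a missing point [z] contributes to
the layer of side [k] containing it: everything for a private point, a sixth
part of the least possible amount for a core point, and nothing near the
corners. *)
Definition layer_weight D s k z : nat :=
  if private D s k z then 6 * depth s k z else if core D s z then D.+1 else 0.

(** The shares never exceed what the point pays: a private point has positive
weight for one side only, and there its depth is the minimal one. *)
Lemma layer_weight_unmet D s I z : inhex s z -> z \notin I ->
  (\sum_k layer_weight D s k z * unmet s I k (depth s k z) <= 6 * mindepth s z)%N.
Proof.
move=> zs zI; have [c|nc] := boolP (core D s z).
  apply: (@leq_trans (\sum_(k < 6) D.+1)).
    apply: leq_sum => k _; rewrite /layer_weight c /private.
    by have := forallP c k; case: leqP => //= _ _; case: unmet; rewrite ?muln1 ?muln0.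
  rewrite sum_nat_const card_ord leq_mul2l /=.
  by apply: le_mindepth => k; exact: (forallP c k).
have wtE k : layer_weight D s k z = if private D s k z then (6 * depth s k z)%N else 0%N.
  by rewrite /layer_weight (negbTE nc).
have [/existsP [k0 pk0]|/existsPn np] := boolP [exists k, private D s k z]; last first.
  by rewrite big1 // => k _; rewrite wtE (negbTE (np k)) mul0n.
have pk k : k != k0 -> private D s k z = false.
  move=> kk0; apply/negbTE; apply/negP => /andP [h _].
  by case/andP: pk0 => _ /forallP /(_ k); rewrite kk0 /= ltnNge h.
rewrite (bigD1 k0) //= big1 => [|k kk0]; last by rewrite wtE pk.
rewrite addn0 wtE pk0 -mulnA leq_mul2l /=.
apply: (@leq_trans (depth s k0 z)); first by case: unmet; rewrite ?muln1 ?muln0.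
apply: le_mindepth => k; have [->//|kk0] := eqVneq k k0.
case/andP: pk0 => h1 /forallP /(_ k); rewrite kk0 /= => h2.
exact: leq_trans h1 (ltnW h2).
Qed.

Lemma met_unmet s I z k : inhex s z -> z \in I -> unmet s I k (depth s k z) = false.
Proof. by move=> zs zI; apply/negbF/hasP; exists z => //; rewrite zs eqxx. Qed.

Variables (s : 'I_6 -> int) (D M : nat).
Hypothesis Dlarge : forall k, (D + D + 1 + M)%:Z <= latlen s k.

Lemma width_large k : s k + s (rt 3 k) = latlen s (rt 1 k) + latlen s (rt 2 k).
Proof. by rewrite !latlen_rt -[rt 0 k]/k; lia. Qed.

Lemma width_ge0 k : 0 <= s k + s (rt 3 k) + 1.
Proof. by rewrite width_large; have := Dlarge (rt 1 k); have := Dlarge (rt 2 k); lia. Qed.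

Lemma widthE k : (width s k)%:Z = s k + s (rt 3 k) + 1.
Proof. by rewrite /width gez0_abs // width_ge0. Qed.

Lemma width_gt k : (D + D + 1 + M < width s k)%N.
Proof.
by have := widthE k; rewrite width_large; have := Dlarge (rt 1 k);
   have := Dlarge (rt 2 k); lia.
Qed.

Let H k := (Dlarge k, Dlarge (rt 1 k), Dlarge (rt 2 k), Dlarge (rt 3 k), Dlarge (rt 4 k), Dlarge (rt 5 k)).

(** A shallow layer loses at most [D] points at each of its two ends to the
neighbouring sides. *)
Lemma private_layer_size_ge k n : (0 < n <= D)%N ->
  latlen s k - (D + D)%:Z <=
  (count (fun z => private D s k z && (depth s k z == n)) (hexset s))%:Z.
Proof.
move=> nD; have [[[[[[h0 h1] h2] h3] h4] h5] [l0 l1 l2 l3 [l4 l5]]] := (H k, latlens s k).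
rewrite -[leLHS]gez0_abs; last by lia.
rewrite lez_nat.
pose p := s k + 1 - n%:Z.
apply: (@count_line_ge _ _ k p (p - s (rt 5 k) + D%:Z)) => i iM.
set z := latpt _ _ _; have [zp zq] := (latf_pt k p (p - s (rt 5 k) + D%:Z + i%:Z),
  latf1_pt k p (p - s (rt 5 k) + D%:Z + i%:Z)); rewrite -/z in zp zq.
have zs : inhex s z by apply/(inhexP _ k); rewrite zp zq /p; do ![split]; lia.
have dn : depth s k z = n by rewrite /depth zp /p; lia.
rewrite in_hexset zs dn eqxx andbT /private dn /=; apply/andP; split; first by case/andP: nD.
apply/forallP => j; apply/implyP; elim/(@rt_ind k) : j; rewrite ?eqxx // => _; rewrite /depth ?latf_rt ?zp ?zq /p; lia.
Qed.

Lemma core_layer_size_ge k n : (D < n <= width s k - D)%N ->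
  (M <= count (fun z => core D s z && (depth s k z == n)) (hexset s))%N.
Proof.
move=> nD; have [[[[[[h0 h1] h2] h3] h4] h5] [l0 l1 l2 l3 [l4 l5]]] := (H k, latlens s k).
have wE := widthE k.
(* The deep part of the line at height [p] starts [D] steps after the line
enters the hexagon, through whichever of the two sides comes last. *)
pose p := s k + 1 - n%:Z.
pose lo := Num.max (- s (rt 4 k)) (p - s (rt 5 k)) + D%:Z.
apply: (@count_line_ge _ _ k p lo) => i iM.
set z := latpt _ _ _; have [zp zq] := (latf_pt k p (lo + i%:Z),
  latf1_pt k p (lo + i%:Z)); rewrite -/z in zp zq.
have zs : inhex s z by apply/(inhexP _ k); rewrite zp zq /lo /p; do ![split]; lia.
have dn : depth s k z = n by rewrite /depth zp /p; lia.
rewrite in_hexset zs dn eqxx andbT /=.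
apply/forallP => j; elim/(@rt_ind k) : j; rewrite /depth ?latf_rt ?zp ?zq /lo /p; lia.
Qed.

(** The layers widen by at most one point per step inwards. *)
Lemma layer_size_le k n : (0 < n <= D)%N ->
  (count (fun z => depth s k z == n) (hexset s))%:Z <= latlen s k + n%:Z.
Proof.
move=> nD; have [[[[[[h0 h1] h2] h3] h4] h5] [l0 l1 l2 l3 [l4 l5]]] := (H k, latlens s k).
rewrite -[leRHS]gez0_abs; last by lia.
rewrite lez_nat.
pose p := s k + 1 - n%:Z.
apply: (@count_line_le _ _ k p (p - s (rt 5 k))) => [|z]; first exact: fset_uniq.
rewrite in_hexset => zs /eqP; have := depthE k zs; move: zs => /(inhexP _ k) [? ? [? ? ? ?]].
by rewrite /p; split; lia.
Qed.

End Counting.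

(** * The dissipation of missing points *)

Section Cost.
Implicit Types (z w : int * int) (I J : {fset int * int}).

Lemma sum_fibers (T : eqType) (A : seq T) (h : T -> nat) (r : seq nat) (G : T -> nat) :
  uniq r -> (\sum_(n <- r) \sum_(z <- A | h z == n) G z <= \sum_(z <- A) G z)%N.
Proof.
move=> ur; rewrite (exchange_big_dep xpredT) //=; apply: leq_sum => z _.
rewrite big_const_seq iter_addn_0 -[leqRHS]muln1 leq_mul2l; apply/orP; right.
rewrite (eq_count (a2 := pred1 (h z))) => [|n]; last by rewrite /= eq_sym.
by rewrite count_uniq_mem //; case: (_ \in _).
Qed.

Variables (s : 'I_6 -> int) (D M : nat).
Hypothesis Dlarge : forall k, (D + D + 1 + M)%:Z <= latlen s k.

(** The lines of one direction are split into the [D] first ones seen from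
side [k], the [D] first ones seen from the opposite side, and the deep ones. *)
Lemma unmet_split I k :
  (\sum_(1 <= n < (width s k).+1) unmet s I k n =
   \sum_(1 <= n < D.+1) unmet s I k n + \sum_(1 <= n < D.+1) unmet s I (rt 3 k) n +
   \sum_(D.+1 <= n < (width s k - D).+1) unmet s I k n)%N.
Proof.
have wD := width_gt Dlarge k.
rewrite (big_cat_nat (n := D.+1)) //=; last by lia.
rewrite [X in (_ + X)%N](big_cat_nat (n := (width s k - D).+1)) /=; [|lia|lia].
rewrite [RHS]addnAC -addnA; congr (_ + (_ + _))%N.
transitivity (\sum_(1 <= n < D.+1) unmet s I k ((width s k).+1 - n))%N.
  have -> : (width s k - D).+1 = (1 + (width s k - D))%N by [].
  rewrite big_addn; have -> : ((width s k).+1 - (width s k - D) = D.+1)%N by lia.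
  rewrite big_nat_rev; apply: eq_big_nat => n nD.
  by congr (nat_of_bool (unmet _ _ _ _)); lia.
apply: eq_big_nat => n nD; rewrite unmet_sym //; last by lia.
exact: width_ge0 Dlarge k.
Qed.

(** The cost of the missing points, distributed over the lines that [I] fails
to meet: all the private points of an unmet shallow layer are missing, and so
are the [M] core points of an unmet deep line. *)
Lemma unmet_cost I :
  (\sum_k (\sum_(1 <= n < D.+1) unmet s I k n * (6 * (n * `|(latlen s k - (D + D)%:Z)%R|)) +
     \sum_(D.+1 <= n < (width s k - D).+1) unmet s I k n * (D.+1 * M)) <=
   6 * \sum_(z <- hexset s | z \notin I) mindepth s z)%N.
Proof.
apply: (@leq_trans (\sum_(z <- hexset s) \sum_k layer_weight D s k z * unmet s I k (depth s k z))%N); last first.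
  rewrite big_distrr /= [leqRHS]big_mkcond /= big_seq [leqRHS]big_seq.
  apply: leq_sum => z; rewrite in_hexset => zs; case: ifPn => [zI|]; first exact: layer_weight_unmet.
  by rewrite negbK => zI; rewrite big1 // => k _; rewrite met_unmet // muln0.
rewrite exchange_big /=; apply: leq_sum => k _.
apply: leq_trans (sum_fibers (hexset s) (depth s k) _ (iota_uniq _ _ :
  uniq (index_iota 1 (width s k - D).+1))).
have wD := width_gt Dlarge k.
rewrite [leqRHS](@big_cat_nat _ _ _ D.+1) /=; [|lia|lia].
apply: leq_add; rewrite big_seq [leqRHS]big_seq; apply: leq_sum => n; rewrite mem_index_iota => nD.
  rewrite (eq_bigr (fun z => unmet s I k n * layer_weight D s k z)%N) => [|z /eqP ->]; last by rewrite mulnC.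
  rewrite -big_distrr /= leq_mul2l; apply/orP; right.
  apply: (@leq_trans (\sum_(z <- hexset s | private D s k z && (depth s k z == n)) 6 * n)%N); last first.
    rewrite big_mkcond [leqRHS]big_mkcond /=; apply: leq_sum => z _.
    by rewrite /layer_weight; case: private => //=; case: eqP => // ->.
  rewrite big_const_seq iter_addn_0.
  rewrite mulnA leq_mul2l; apply/orP; right.
  have nD' : (0 < n <= D)%N by lia.
  rewrite -lez_nat gez0_abs; first exact: private_layer_size_ge.
  by have := Dlarge k; lia.
rewrite (eq_bigr (fun z => unmet s I k n * layer_weight D s k z)%N) => [|z /eqP ->]; last by rewrite mulnC.
rewrite -big_distrr /= leq_mul2l; apply/orP; right.
apply: (@leq_trans (\sum_(z <- hexset s | core D s z && (depth s k z == n)) D.+1)%N); last first.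
  rewrite big_mkcond [leqRHS]big_mkcond /=; apply: leq_sum => z _.
  case c : (core D s z) => //=; case: eqP => // dn; rewrite /layer_weight c /private.
  by have := forallP c k; rewrite ltnNge => /negbTE ->.
rewrite big_const_seq iter_addn_0 leq_mul2l; apply/orP; right.
by apply: (core_layer_size_ge Dlarge); lia.
Qed.

(** The competitor, obtained by moving side [j] inwards by [n j] layers, is a
hexagon: it saves exactly the lines that it does not meet. *)
Lemma shift_exits_le (n : 'I_6 -> nat) k : (forall j, n j <= D)%N ->
  (#|` exits k (hexset (fun j => (s j - (n j)%:Z)%R))| + n k + n (rt 3 k) <= width s k)%N.
Proof.
move=> nD; have := nD k; have := nD (rt 3 k); have := width_gt Dlarge k; have := widthE Dlarge k => wE wD n3 nk.
have := @exits_hexset_le (fun j => s j - (n j)%:Z) k.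
by rewrite /=; lia.
Qed.

(** A point removed by the shift lies in one of the removed layers, say the
[i]-th one of side [k], and its depth is at most [i]. *)
Lemma shift_cost_le (n : 'I_6 -> nat) : (forall j, n j <= D)%N ->
  (\sum_(z <- hexset s | z \notin hexset (fun j => (s j - (n j)%:Z)%R)) mindepth s z <=
   \sum_k \sum_(1 <= i < D.+1) (i <= n k)%N * (i * `|(latlen s k + i%:Z)%R|))%N.
Proof.
move=> nD.
apply: (@leq_trans (\sum_(z <- hexset s) \sum_k \sum_(1 <= i < D.+1 | depth s k z == i) (i <= n k) * i)%N).
  rewrite [leqLHS]big_mkcond /= big_seq [leqRHS]big_seq; apply: leq_sum => z.
  rewrite in_hexset => zs; case: ifPn => // zn.
  have [k kn] : exists k, (depth s k z <= n k)%N.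
    apply: contrapT => no; case/negP: zn; rewrite in_hexset; apply/forallP => k.
    by have := depthE k zs; case: (leqP (depth s k z) (n k)) => [h|]; [case: no; exists k|lia].
  apply: leq_trans (mindepth_le s k z) _; rewrite (bigD1 k) //=.
  apply: leq_trans (leq_addr _ _).
  rewrite (big_rem (depth s k z)) /=; last first.
    by rewrite mem_index_iota depth_gt0 //= ltnS; exact: leq_trans kn _.
  by rewrite eqxx kn mul1n leq_addr.
rewrite exchange_big /=; apply: leq_sum => k _.
rewrite (exchange_big_dep xpredT) //= big_seq [leqRHS]big_seq; apply: leq_sum => i.
rewrite mem_index_iota => iD; rewrite big_const_seq iter_addn_0 -mulnA leq_mul2l; apply/orP; right.
rewrite leq_mul2l; apply/orP; right.
have iD' : (0 < i <= D)%N by lia.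
by have := layer_size_le Dlarge k iD'; lia.
Qed.

End Cost.

(** * Minimisers of the discrete energy *)

Section Step.
Variable R : realFieldType.
Implicit Types (z w : int * int) (I J : {fset int * int}) (c : R).

(** The energy divided by the length of an edge.  Points outside the hexagon
are charged one, their least possible distance, which makes it a lower bound
for the energy of a finite set and exact for subsets of the hexagon. *)
Definition latenergy c (s : 'I_6 -> int) I : R :=
  (\sum_k #|` exits k I|)%:R +
  c * (\sum_(z <- hexset s | z \notin I) mindepth s z + #|` (I `\` hexset s)%fset|)%:R.

(** The depth at which layers stop being shallow.  A core point shares its
depth among six directions, which is why six times the critical index is
needed for a deep line to be too expensive to empty; see [len_large]. *)
Definition cutoff (N : nat) : nat := 6 * N.+1.

(** The corner corrections amount to at most [3 * c * cutoff N ^ 2] for each of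
the [6 * cutoff N] shallow layers; the slack exceeds their sum, and also what
[len_large] loses at the corners of a deep line. *)
Definition slack (N : nat) : nat := 18 * cutoff N ^ 3 + N.+1 * (2 * cutoff N + 1) + 1.

(** A layer that is emptied contributes its cost minus the two bonds it saves.
Here [u] and [p] tell whether the set and the competitor empty the [n]-th
layer of a side with [l] points: if they disagree, the competitor is better by
[th], apart from the error made by counting [D + D] points too few for the set
and [n] points too many for the competitor. *)
Lemma layer_defect_ge (u p : bool) (c l : R) (n D : nat) (th : R) : 0 < c -> (n <= D)%N ->
  (u != p -> th <= (u%:R - p%:R) * (c * n%:R * l - 2)) ->
  (u != p)%:R * th - 3 * c * D%:R ^+ 2 <=
  u%:R * (c * (n%:R * (l - (D + D)%:R)) - 2) - p%:R * (c * (n%:R * (l + n%:R)) - 2).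
Proof.
move=> c0 nD h; have n0 : 0 <= n%:R :> R by [].
have nD' : n%:R <= D%:R :> R by rewrite ler_nat.
have nn : n%:R * n%:R <= D%:R ^+ 2 :> R by rewrite expr2 ler_pM.
have nd : n%:R * D%:R <= D%:R ^+ 2 :> R by rewrite expr2 ler_wpM2r.
have cnn : c * (n%:R * n%:R) <= c * D%:R ^+ 2 by rewrite ler_pM2l.
have cnd : c * (n%:R * D%:R) <= c * D%:R ^+ 2 by rewrite ler_pM2l.
have cd : 0 <= c * D%:R ^+ 2 by rewrite mulr_ge0 ?exprn_ge0 ?(ltW c0).
have cn0 : 0 <= c * (n%:R * n%:R) by rewrite !mulr_ge0 ?(ltW c0).
rewrite natrD; case: u h; case: p => /= h; rewrite ?mul1r ?mul0r ?subr0 ?sub0r.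
- nra.
- have {}h := h isT; nra.
- have {}h := h isT; nra.
- nra.
Qed.

Variables (s : 'I_6 -> int) (N : nat) (c eta : R).
Let D := cutoff N.
Let B : R := (slack N)%:R.
Hypothesis c_gt0 : 0 < c.
Hypothesis cB : 2 * (c * B) <= 1.
Hypothesis cBeta : c * B <= eta.
Hypothesis len_ge : forall k, 2 + eta <= c * (latlen s k)%:~R * N.+1%:R.
Hypothesis len_le : forall k, c * (latlen s k)%:~R * N.-1%:R <= 2 - eta.

(** Sides are long enough for a deep line to have [M] core points, and emptying
it costs more than the single bond it saves in its direction, with a margin. *)
Lemma len_large : exists2 M : nat,
  (forall k, (D + D + 1 + M)%:Z <= latlen s k) & 1 + c * B <= c * (D.+1 * M)%:R / 6.
Proof.
pose k0 := [arg min_(k < ord0 : 'I_6) latlen s k]%O.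
have k0P k : latlen s k0 <= latlen s k.
  by rewrite /k0; case: arg_minP => // i _; exact.
have D0 : (6 * N.+1 = D)%N by [].
have Bge : (N.+1 * (2 * D + 1) + 1)%:R <= B by rewrite ler_nat /slack -/D; lia.
have NB : c * (N.+1 * (2 * D + 1) + 1)%:R <= c * B by rewrite ler_pM2l.
have B1 : 0 < c * B by rewrite mulr_gt0 // (lt_le_trans _ Bge) // ltr0n; lia.
have l0 := len_ge k0.
set l := latlen s k0 in l0 *.
have lD : (D + D + 1)%:Z <= l.
  have : c * N.+1%:R * (D + D + 1)%:R <= c * N.+1%:R * l%:~R.
    rewrite mulrAC in l0; apply: le_trans l0; rewrite -mulrA -natrM.
    apply: (@le_trans _ _ (c * (N.+1 * (2 * D + 1) + 1)%:R)); first by rewrite ler_pM2l // ler_nat; lia.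
    apply: le_trans NB _; move: (c * B) B1 cB cBeta => X; lra.
  by rewrite ler_pM2l ?mulr_gt0 ?ltr0n // -[(D + D + 1)%:R]/((D + D + 1)%:Z%:~R) ler_int.
exists `|(l - (D + D + 1)%:Z)%R|%N.
  by move=> k; apply: le_trans (k0P k); rewrite -/l; lia.
set M := `|_|%N; have lE : l = (M + (D + D + 1))%:Z by rewrite /M; lia.
move: l0; rewrite lE -[_%:~R]/((M + (D + D + 1))%:R : R) => l0.
have DM : 6 * (N.+1 * M)%:R <= (D.+1 * M)%:R :> R by rewrite -natrM ler_nat; nia.
have : c * (6 * (N.+1 * M)%:R) <= c * (D.+1 * M)%:R by rewrite ler_pM2l.
have e0 : 0 < eta by apply: lt_le_trans cBeta.
have e1 : c * (M + (D + D + 1))%:R * N.+1%:R =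
    c * (N.+1 * M)%:R + c * (N.+1 * (2 * D + 1))%:R.
  by rewrite -mulrA -natrM -mulrDr -natrD; congr (c * _%:R); move: D; clear; lia.
have e2 : c * (N.+1 * (2 * D + 1))%:R <= c * (N.+1 * (2 * D + 1) + 1)%:R.
  by rewrite ler_pM2l // ler_nat leq_addr.
have e3 : c * (6 * (N.+1 * M)%:R) = 6 * (c * (N.+1 * M)%:R) by rewrite mulrCA.
move=> h3; move: l0 NB e2 h3 cB cBeta B1; rewrite e1 e3.
set X := c * (N.+1 * M)%:R; set Y := c * (N.+1 * _)%:R; set Z := c * (_ + 1)%:R.
set W := c * (D.+1 * M)%:R; set V := c * B.
by move=> *; lra.
Qed.

Lemma natr_sum2 m (f : 'I_6 -> nat -> nat) :
  (\sum_k \sum_(1 <= i < m) f k i)%:R = \sum_k \sum_(1 <= i < m) (f k i)%:R :> R.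
Proof. by rewrite natr_sum; apply: eq_bigr => k _; rewrite natr_sum. Qed.

(** A minimiser is compared with the competitor that moves side [k] by [N]
layers if the minimiser empties the [N]-th one or if the cost of that layer is
clearly below [2], and by [N - 1] otherwise.  Every layer on which the two
disagree then costs the minimiser [c * B] at least, every deep line that it
empties as well, and together the corner corrections are smaller than [c * B].
So there is no disagreement at all; the minimiser is contained in the
competitor and, since a missing point is never free, equal to it. *)
Lemma latenergy_minimizer I :
  (forall I', {subset I' <= hexset s} -> latenergy c s I <= latenergy c s I') ->
  exists n : 'I_6 -> nat,
    [/\ forall k, n k = N \/ n k = N.-1,
        forall k, c * (latlen s k)%:~R * N%:R <= 2 - c * B -> n k = N &
        I = hexset (fun k => s k - (n k)%:Z)].
Proof.
move=> Imin; have [M Dlarge MB] := len_large.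
pose l k : R := (latlen s k)%:~R.
pose U k i := unmet s I k i.
pose n k := if U k N || (c * l k * N%:R <= 2 - c * B) then N else N.-1.
have nN k : n k = N \/ n k = N.-1 by rewrite /n; case: ifP; [left|right].
have nB k : c * (latlen s k)%:~R * N%:R <= 2 - c * B -> n k = N.
  by move=> h; rewrite /n /l h orbT.
have nleN k : (n k <= N)%N by case: (nN k) => ->; rewrite ?leq_pred.
have nD k : (n k <= D)%N by apply: leq_trans (nleN k) _; rewrite /D /cutoff; lia.
have l0 k : 0 <= l k by rewrite /l ler0z; have := Dlarge k; lia.
have D0 : (0 < D)%N by rewrite /D /cutoff.
have B1 : 0 < c * B.
  by rewrite mulr_gt0 // ltr0n /slack; lia.
pose p k i := (i <= n k)%N.
pose J := hexset (fun k => s k - (n k)%:Z).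
have JJ : {subset J <= hexset s}.
  move=> z; rewrite !in_hexset => /forallP h; apply/forallP => k.
  by apply: le_trans (h k) _; rewrite gerBl.
(* Layers before the [N]-th are worth removing and layers after it are not, by
the margin [eta].  The [N]-th one is kept by the competitor only if removing
it gains at most [c * B], or is removed by it because the minimiser does so. *)
have gap k i : (0 < i <= D)%N -> U k i != p k i ->
    c * B <= ((U k i)%:R - (p k i)%:R) * (c * i%:R * l k - 2).
  move=> iD Up; have [iN|iN|iN] := ltngtP i N.
  - have pT : p k i by rewrite /p; case: (nN k) => ->; lia.
    move: Up; rewrite pT; case: (U k i) => //= _.
    have : c * i%:R * l k <= c * l k * N.-1%:R.
      by rewrite mulrAC ler_wpM2l ?mulr_ge0 ?(ltW c_gt0) // ler_nat; lia.
    by have := cBeta; have := len_le k; rewrite -/(l k) ?sub0r ?subr0 ?mulN1r ?mul1r; lra.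
  - have pF : p k i = false by rewrite /p; have := nleN k; lia.
    move: Up; rewrite pF; case: (U k i) => //= _.
    have : c * l k * N.+1%:R <= c * i%:R * l k.
      by rewrite [leRHS]mulrAC ler_wpM2l ?mulr_ge0 ?(ltW c_gt0) // ler_nat; lia.
    by have := cBeta; have := len_ge k; rewrite -/(l k) ?sub0r ?subr0 ?mulN1r ?mul1r; lra.
  - move: Up; rewrite iN /p /n; case: (U k N) => //=; first by rewrite leqnn.
    case: ifP => [h _|_]; first by rewrite leqnn /= mulrAC; lra.
    by have -> : (N <= N.-1)%N = false by lia.
pose F k i : R := (U k i)%:R * (c * (i%:R * (l k - (D + D)%:R)) - 2) -
    (p k i)%:R * (c * (i%:R * (l k + i%:R)) - 2).
have Fge k i : (0 < i <= D)%N -> (U k i != p k i)%:R * (c * B) - 3 * c * D%:R ^+ 2 <= F k i.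
  by move=> iD; apply: layer_defect_ge => //; [lia|exact: gap].
pose deep := (\sum_k \sum_(D.+1 <= i < (width s k - D).+1) U k i)%N.
pose X1 := (\sum_k \sum_(1 <= i < D.+1) U k i * (i * `|(latlen s k - (D + D)%:Z)%R|))%N.
pose X2 := (\sum_k \sum_(1 <= i < D.+1) U k i)%N.
pose X3 := (\sum_k \sum_(1 <= i < D.+1) p k i * (i * `|(latlen s k + i%:Z)%R|))%N.
pose X4 := (\sum_k \sum_(1 <= i < D.+1) p k i)%N.
have FE : \sum_k \sum_(1 <= i < D.+1) F k i = c * X1%:R - 2 * X2%:R - (c * X3%:R - 2 * X4%:R).
  rewrite /X1 /X2 /X3 /X4 !natr_sum2 !mulr_sumr -!sumrB; apply: eq_bigr => k _.
  rewrite !mulr_sumr -!sumrB; apply: eq_bigr => i _; rewrite /F !natrM !natr_absz.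
  rewrite !ger0_norm; [|have := Dlarge k; lia|have := Dlarge k; lia].
  rewrite ![(latlen s k + _)%:~R]intrD [(- _)%:~R]mulrNz -/(l k) -!pmulrn; ring.
have X4E : X4 = (\sum_k n k)%N.
  apply: eq_bigr => k _; rewrite (@big_cat_nat _ _ _ (n k).+1) //=; last by rewrite ltnS.
  rewrite [X in (_ + X)%N]big1_seq => [|i]; last by rewrite mem_index_iota /p => ?; lia.
  rewrite addn0 (eq_big_nat _ _ (F2 := fun=> 1%N)) => [|i ?]; last by rewrite /p; lia.
  by rewrite sum_nat_const_nat; lia.
pose W := (\sum_k width s k)%N.
(* Summed over all directions, each shallow line is counted from both of its
sides, hence the two copies of [X2] and [X4]. *)
have exI : (W <= \sum_k #|` exits k I| + X2 + X2 + deep)%N.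
  have X2r : X2 = (\sum_k \sum_(1 <= i < D.+1) U (rt 3 k) i)%N by rewrite /X2 -(rt_sum 3).
  rewrite [X in (_ + X + deep)%N]X2r -!big_split /=; apply: leq_sum => k _.
  by have := exits_ge s I k; rewrite (unmet_split Dlarge) -!addnA.
have exJ : (\sum_k #|` exits k J| + X4 + X4 <= W)%N.
  have X4r : X4 = (\sum_k n (rt 3 k))%N by rewrite X4E -(rt_sum 3).
  rewrite [X in (_ + X <= _)%N]X4r X4E -!big_split /=; apply: leq_sum => k _.
  exact: (shift_exits_le Dlarge).
have costI : (6 * X1 + deep * (D.+1 * M) <= 6 * \sum_(z <- hexset s | z \notin I) mindepth s z)%N.
  apply: leq_trans (unmet_cost Dlarge I); rewrite big_split /=; apply/eq_leq; congr addn.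
    rewrite big_distrr; apply: eq_bigr => k _; rewrite big_distrr; apply: eq_bigr => i _.
    by rewrite /= mulnCA.
  by rewrite /deep big_distrl; apply: eq_bigr => k _; rewrite big_distrl.
have costJ : (\sum_(z <- hexset s | z \notin J) mindepth s z <= X3)%N := shift_cost_le Dlarge nD.
have J0 : #|` (J `\` hexset s)%fset| = 0%N.
  by apply/eqP; rewrite cardfs_eq0 fsetD_eq0; apply/fsubsetP.
have := Imin J JJ; rewrite /latenergy J0 addn0.
set a := (\sum_k #|` exits k I|)%N in exI *; set a' := (\sum_k #|` exits k J|)%N in exJ *.
set b := (\sum_(z <- hexset s | z \notin I) mindepth s z)%N in costI *.
set b' := (\sum_(z <- hexset s | z \notin J) mindepth s z)%N in costJ *.
set e := #|` (I `\` hexset s)%fset| => Eab.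
pose Y := (\sum_k \sum_(1 <= i < D.+1) (U k i != p k i))%N.
have Ysum : c * B * Y%:R - 18 * c * D%:R ^+ 3 <= \sum_k \sum_(1 <= i < D.+1) F k i.
  have -> : c * B * Y%:R - 18 * c * D%:R ^+ 3 =
      \sum_k \sum_(1 <= i < D.+1) ((U k i != p k i)%:R * (c * B) - 3 * c * D%:R ^+ 2).
    rewrite /Y natr_sum2 mulr_sumr.
    under [RHS]eq_bigr do rewrite sumrB -mulr_suml mulrC.
    rewrite sumrB; congr (_ - _).
    under eq_bigr do rewrite sumr_const_nat subSS subn0.
    by rewrite sumr_const card_ord -mulrnA -[RHS]mulr_natr (natrM _ D 6); ring.
  apply: ler_sum => k _; rewrite big_seq [leRHS]big_seq; apply: ler_sum => i.
  by rewrite mem_index_iota => iD; apply: Fge; lia.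
(* [Y] disagreements and [deep] emptied deep lines cost [c * B] each, while the
corner corrections sum up to less than [c * B]. *)
have Yd : (Y + deep = 0)%N.
  apply/eqP; rewrite -leqn0 -ltnS -(ltr_nat R) -(ltr_pM2l B1) natrD mulr1 mulrDr.
  have BE : 18 * c * D%:R ^+ 3 < c * B.
    rewrite /B /slack -/D mulrAC mulrC ltr_pM2l // -natrX -natrM ltr_nat.
    by move: (D ^ 3)%N; clear; lia.
  have h1 : 6 * (c * X1%:R) + deep%:R * (c * (D.+1 * M)%:R) <= 6 * (c * b%:R).
    have e1 : c * (6 * X1 + deep * (D.+1 * M))%:R =
        6 * (c * X1%:R) + deep%:R * (c * (D.+1 * M)%:R).
      by rewrite natrD (natrM _ 6) (natrM _ deep); ring.
    have e2 : c * (6 * b)%:R = 6 * (c * b%:R) by rewrite (natrM _ 6); ring.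
    by rewrite -e1 -e2 ler_pM2l // ler_nat.
  have h2 : c * b'%:R <= c * X3%:R by rewrite ler_pM2l // ler_nat.
  have h3 : W%:R <= a%:R + X2%:R + X2%:R + deep%:R :> R by rewrite -!natrD ler_nat.
  have h4 : a'%:R + X4%:R + X4%:R <= W%:R :> R by rewrite -!natrD ler_nat.
  have h5 : deep%:R + deep%:R * (c * B) <= deep%:R * (c * (D.+1 * M)%:R) / 6.
    have -> : deep%:R + deep%:R * (c * B) = deep%:R * (1 + c * B) by ring.
    by rewrite -[leRHS]mulrA; apply: ler_wpM2l.
  have h6 : 0 <= c * e%:R by rewrite mulr_ge0 // ltW.
  have h7 : a%:R + (c * b%:R + c * e%:R) <= a'%:R + c * b'%:R by rewrite -mulrDr -natrD.
  move: Ysum; rewrite FE [c * B * deep%:R]mulrC => Ysum.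
  move: BE Ysum h1 h2 h3 h4 h5 h6 h7.
  move: (18 * c * _) (c * B * Y%:R) (c * B) (c * X1%:R) (c * X3%:R) (deep%:R * _) (deep%:R * _).
  move: (deep%:R) (X2%:R) (X4%:R) (c * b%:R) (c * b'%:R) (c * e%:R) (a%:R) (a'%:R) (W%:R) => *.
  lra.
have /eqP := Yd; rewrite addn_eq0 => /andP [/eqP Y0 /eqP deep0].
have Up k i : (0 < i <= D)%N -> U k i = p k i.
  move=> iD; apply/eqP; rewrite -[_ == _]negbK; apply/negP => ne.
  suff : (0 < Y)%N by rewrite Y0.
  rewrite /Y (bigD1 k) //= (big_rem i) /=; last by rewrite mem_index_iota ltnS.
  by rewrite ne.
have X24 : X2 = X4.
  by apply: eq_bigr => k _; apply: eq_big_nat => i; rewrite ltnS => iD; rewrite Up.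
have aa' : (a' <= a)%N by move: exI exJ; rewrite X24 deep0; clear; lia.
have bb' : (b + e <= b')%N.
  rewrite -(ler_nat R) -(ler_pM2l c_gt0).
  have : a'%:R <= a%:R :> R by rewrite ler_nat.
  rewrite natrD mulrDr; move: Eab; rewrite natrD mulrDr.
  by move: (a%:R) (a'%:R) (c * _) (c * _) (c * _); move=> *; lra.
(* The layers met by the minimiser are those of the competitor, so the points
of the minimiser inside the old hexagon are points of the competitor. *)
have IJ z : z \in I -> inhex s z -> z \in J.
  move=> zI zs; rewrite in_hexset; apply/forallP => k.
  have nk : (n k < depth s k z)%N.
    rewrite ltnNge; apply/negP => h; have dk := depth_gt0 k zs.
    have iD : (0 < depth s k z <= D)%N by rewrite dk (leq_trans h).
    by have := Up k _ iD; rewrite /U met_unmet // /p h.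
  by move: (depthE k zs) nk; clear; lia.
have JI z : z \in J -> z \in I.
  move=> zJ; apply: contrapT => /negP zI.
  have zs : inhex s z by rewrite -in_hexset; exact: JJ.
  suff : (b' + 1 <= b)%N by move: bb'; clear; lia.
  have h : (z \in hexset s) by rewrite in_hexset.
  rewrite /b (big_rem z) //= zI addnC leq_add //.
    by rewrite /mindepth; apply: le_mindepth => k; exact: depth_gt0.
  rewrite /b' (big_rem z) //= zJ /= !(big_mkcond (fun i => _ \notin _)) /=.
  rewrite big_seq [leqRHS]big_seq; apply: leq_sum => w wr.
  have ws : inhex s w by rewrite -in_hexset; exact: mem_rem wr.
  by case: ifPn => // wJ; rewrite ifT //; apply: contra wJ => wI; exact: (IJ).
exists n; split => //; apply/fsetP => z; rewrite -/J; apply/idP/idP => [zI|]; last exact: JI.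
apply: (IJ) => //; rewrite -in_hexset; apply: contrapT => /negP zs.
have : z \in (I `\` hexset s)%fset by rewrite inE zs zI.
have : e = 0%N; last by move/eqP; rewrite cardfs_eq0 => /eqP ->.
suff : (b' <= b)%N by move: bb'; clear; lia.
rewrite /b /b' big_mkcond [leqRHS]big_mkcond /= big_seq [leqRHS]big_seq.
apply: leq_sum => w; rewrite in_hexset => ws.
by case: ifPn => // wJ; rewrite ifT //; apply: contra wJ => wI; exact: (IJ).
Qed.

End Step.

(** * Hexagons given by six half-planes *)

Section HexGeom.
Variable R : realType.
Implicit Types (x y z : plane R) (s : 'I_6 -> R) (k : 'I_6).

Let r : R := Num.sqrt 3.
Lemma r3_gt0 : 0 < r. Proof. by rewrite sqrtr_gt0. Qed.
Lemma r3_sqr : r * r = 3. Proof. by rewrite -expr2 sqr_sqrtr. Qed.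

Definition hf k x : R := inner x (hexn k).

Lemma hfD k x y : hf k (x + y) = hf k x + hf k y.
Proof. by rewrite /hf /inner /=; ring. Qed.
Lemma hfZ k a x : hf k (a *: x) = a * hf k x.
Proof. by rewrite /hf /inner -[(a *: x).1]/(a * x.1) -[(a *: x).2]/(a * x.2); ring. Qed.
Lemma hfN k x : hf k (- x) = - hf k x.
Proof. by rewrite -scaleN1r hfZ mulN1r. Qed.
Lemma hfB k x y : hf k (x - y) = hf k x - hf k y.
Proof. by rewrite hfD hfN. Qed.
Lemma hf0 k : hf k 0 = 0.
Proof. by rewrite -(scale0r 0) hfZ mul0r. Qed.

(* Coordinates of the normals, in a form that computes. *)
Definition hexc k : R * R := nth 0 [:: (0, 1); (- (r / 2), 1 / 2); (- (r / 2), - (1 / 2));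
   (0, -1); (r / 2, - (1 / 2)); (r / 2, 1 / 2)] k.

Lemma hexnE k : hexn k = hexc k.
Proof.
by case6 k; rewrite /hexn /hexc /perp /eta3 /eta1 /eta2 /= -/r; congr pair; rewrite /=; field.
Qed.

Lemma hfE k x : hf k x = x.1 * (hexc k).1 + x.2 * (hexc k).2.
Proof. by rewrite /hf hexnE. Qed.

(** Three consecutive normals add up with alternating signs to zero, so the
heights satisfy the same relations as those of the lattice points. *)
Lemma hf2 k x : hf (rt 2 k) x = hf (rt 1 k) x - hf k x.
Proof. by rewrite !hfE; case6 k; rewrite /rt /=; field. Qed.
Lemma hf3 k x : hf (rt 3 k) x = - hf k x.
Proof. by rewrite !hfE; case6 k; rewrite /rt /=; field. Qed.
Lemma hf4 k x : hf (rt 4 k) x = - hf (rt 1 k) x.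
Proof. by rewrite !hfE; case6 k; rewrite /rt /=; field. Qed.
Lemma hf5 k x : hf (rt 5 k) x = hf k x - hf (rt 1 k) x.
Proof. by rewrite !hfE; case6 k; rewrite /rt /=; field. Qed.
Definition hfE_rt := (hf2, hf3, hf4, hf5).

Lemma hf_hexn k : hf k (hexn k) = 1.
Proof.
rewrite hfE hexnE; have := r3_sqr.
by case6 k; rewrite /rt /= => h; lra.
Qed.
Lemma hf1_hexn k : hf (rt 1 k) (hexn k) = 1 / 2.
Proof.
rewrite hfE hexnE; have := r3_sqr.
by case6 k; rewrite /rt /= => h; lra.
Qed.
Lemma hf_hexn1 k : hf k (hexn (rt 1 k)) = 1 / 2.
Proof.
rewrite hfE hexnE; have := r3_sqr.
by case6 k; rewrite /rt /= => h; lra.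
Qed.

Lemma innerE k x : inner x x =
  4 / 3 * (hf k x ^+ 2 - hf k x * hf (rt 1 k) x + hf (rt 1 k) x ^+ 2).
Proof.
case: x => a b; rewrite !hfE /inner; have rr := r3_sqr.
have haa : a * a * (r * r) = a * a * 3 by rewrite rr.
have hab : a * b * (r * r) = a * b * 3 by rewrite rr.
have hbb : b * b * (r * r) = b * b * 3 by rewrite rr.
by case6 k; rewrite /rt /=; lra.
Qed.

Lemma inner_eq0 x : inner x x = 0 -> x = 0.
Proof.
case: x => a b; rewrite /inner /= => h.
have a0 : 0 <= a * a by rewrite -expr2 sqr_ge0.
have b0 : 0 <= b * b by rewrite -expr2 sqr_ge0.
have /eqP : a * a = 0 by lra.
have /eqP : b * b = 0 by lra.
by rewrite !mulf_eq0 !orbb => /eqP -> /eqP ->.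
Qed.

Lemma hf_inj k x y : hf k x = hf k y -> hf (rt 1 k) x = hf (rt 1 k) y -> x = y.
Proof.
move=> h0 h1; apply/eqP; rewrite -subr_eq0; apply/eqP/inner_eq0.
by rewrite (innerE k) !hfB h0 h1 !subrr; lra.
Qed.

Definition hpt k (p q : R) : plane R :=
  ((4 * p - 2 * q) / 3) *: hexn k + ((4 * q - 2 * p) / 3) *: hexn (rt 1 k).

Lemma hf_pt k p q : hf k (hpt k p q) = p.
Proof. by rewrite hfD !hfZ hf_hexn hf_hexn1; field. Qed.
Lemma hf1_pt k p q : hf (rt 1 k) (hpt k p q) = q.
Proof. by rewrite hfD !hfZ hf_hexn hf1_hexn; field. Qed.

Definition Hex s : set (plane R) := [set x | forall k, hf k x <= s k].

Lemma HexP s k x : Hex s x <->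
  [/\ hf k x <= s k, hf (rt 1 k) x <= s (rt 1 k) &
   [/\ hf (rt 1 k) x - hf k x <= s (rt 2 k), - hf k x <= s (rt 3 k),
    - hf (rt 1 k) x <= s (rt 4 k) & hf k x - hf (rt 1 k) x <= s (rt 5 k)]].
Proof.
split=> [h|[? ? [? ? ? ?]]]; first by do ![split]; rewrite -?hfE_rt; exact: h.
by apply: (rt_ind (k := k)); rewrite ?hfE_rt.
Qed.

(** The side with normal [k] has length [2 / sqrt 3] times this quantity; see
[side_length_Hex]. *)
Definition hlen s k : R := s (rt 5 k) + s (rt 1 k) - s k.

Lemma hlen_rt s j k :
  hlen s (rt j.+1 k) = s (rt j k) + s (rt j.+2 k) - s (rt j.+1 k).
Proof. by rewrite /hlen !rtD -[(5 + j.+1)%N]/(6 + j)%N rt6. Qed.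

Lemma hlens s k : [/\ hlen s k = s (rt 5 k) + s (rt 1 k) - s k,
  hlen s (rt 1 k) = s k + s (rt 2 k) - s (rt 1 k),
  hlen s (rt 2 k) = s (rt 1 k) + s (rt 3 k) - s (rt 2 k),
  hlen s (rt 3 k) = s (rt 2 k) + s (rt 4 k) - s (rt 3 k) &
  hlen s (rt 4 k) = s (rt 3 k) + s (rt 5 k) - s (rt 4 k) /\
  hlen s (rt 5 k) = s (rt 4 k) + s k - s (rt 5 k)].
Proof. by rewrite !hlen_rt rt60. Qed.

Lemma hf_continuous k : continuous (hf k).
Proof.
have -> : hf k = (fun x : plane R => x.1 * (hexc k).1 + x.2 * (hexc k).2).
  by apply/funext => x; rewrite hfE.
move=> x; apply: cvgD; apply: cvgM; try exact: cvg_cst; [exact: cvg_fst|exact: cvg_snd].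
Qed.

Lemma enorm_ge_hf k x : `|hf k x| <= enorm x.
Proof.
rewrite -sqrtr_sqr ler_wsqrtr // (innerE k).
have : 0 <= (hf k x - 2 * hf (rt 1 k) x) ^+ 2 by rewrite sqr_ge0.
lra.
Qed.

Lemma enorm_ge0 x : 0 <= enorm x. Proof. exact: sqrtr_ge0. Qed.

Lemma enormZ a x : enorm (a *: x) = `|a| * enorm x.
Proof.
rewrite /enorm.
have -> : inner (a *: x) (a *: x) = a ^+ 2 * inner x x.
  by rewrite /inner -[(a *: x).1]/(a * x.1) -[(a *: x).2]/(a * x.2); ring.
by rewrite sqrtrM ?sqr_ge0 // sqrtr_sqr.
Qed.

Lemma enorm_hf k x : hf k x = 0 -> enorm x = 2 / r * `|hf (rt 1 k) x|.
Proof.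
move=> h; have -> : enorm x = Num.sqrt ((2 / r) ^+ 2 * (hf (rt 1 k) x) ^+ 2).
  rewrite /enorm (innerE k) h; congr Num.sqrt.
  by rewrite expr_div_n [r ^+ 2]expr2 r3_sqr; field.
rewrite sqrtrM ?sqr_ge0 // !sqrtr_sqr ger0_norm //.
by rewrite divr_ge0 // ltW // r3_gt0.
Qed.

Lemma enorm_le_hf k x m : `|hf k x| <= m -> `|hf (rt 1 k) x| <= m -> enorm x <= 2 * m.
Proof.
move=> h0 h1; have m0 : 0 <= m by apply: le_trans h0.
rewrite -[leRHS]ger0_norm ?mulr_ge0 // -sqrtr_sqr ler_wsqrtr // (innerE k).
have e0 : hf k x ^+ 2 <= m ^+ 2 by rewrite -ler_abs_sqr // || (rewrite -real_normK ?num_real // ler_pXn2r ?nnegrE).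
have e1 : hf (rt 1 k) x ^+ 2 <= m ^+ 2 by rewrite -real_normK ?num_real // ler_pXn2r ?nnegrE.
have : 0 <= (hf k x + hf (rt 1 k) x) ^+ 2 by rewrite sqr_ge0.
lra.
Qed.

Lemma closed_Hex s : closed (Hex s).
Proof.
have -> : Hex s = \bigcap_k (hf k @^-1` [set t | t <= s k]).
  by apply/seteqP; split=> [x h k _|x h k]; [exact: h|exact: (h k I)].
apply: closed_bigI => k _; apply: closed_comp; last exact: closed_le.
by move=> x _; exact: hf_continuous.
Qed.

End HexGeom.

(** * Convexity and interior of the hexagons *)

Section HexConvex.
Variable R : realType.
Implicit Types (x y z : plane R) (s : 'I_6 -> R) (k : 'I_6) (A E : set (plane R)).
Local Notation r := (Num.sqrt 3 : R).

Lemma convex_set_conv E : convex_set (E : set (convex_lmodType (plane R))) ->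
  forall x y (t : R), 0 <= t <= 1 -> E x -> E y -> E (t *: x + (1 - t) *: y).
Proof.
move=> cE x y t /andP [t0 t1] Ex Ey.
have := cE x y (Itv01 t0 t1) (mem_set Ex) (mem_set Ey).
by move=> /set_mem.
Qed.

Lemma conv_convex_set E :
  (forall x y (t : R), 0 <= t <= 1 -> E x -> E y -> E (t *: x + (1 - t) *: y)) ->
  convex_set (E : set (convex_lmodType (plane R))).
Proof.
move=> cE x y t /set_mem Ex /set_mem Ey; apply/mem_set.
by apply: cE => //; apply/andP.
Qed.

Lemma convex3 E : convex_set (E : set (convex_lmodType (plane R))) ->
  forall x y z (a b c : R), 0 <= a -> 0 <= b -> 0 <= c -> a + b + c = 1 ->
  E x -> E y -> E z -> E (a *: x + b *: y + c *: z).
Proof.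
move=> /convex_set_conv cE x y z a b c a0 b0 c0 abc Ex Ey Ez.
have [c1|c1] := eqVneq c 1.
  have -> : a = 0 by lra. have -> : b = 0 by lra.
  by rewrite c1 !scale0r scale1r !add0r.
have cP : 0 < 1 - c by rewrite subr_gt0 lt_neqAle c1; lra.
have -> : a *: x + b *: y + c *: z =
    (1 - c) *: ((a / (1 - c)) *: x + (1 - a / (1 - c)) *: y) + (1 - (1 - c)) *: z.
  rewrite scalerDr !scalerA; congr (_ *: _ + _ *: _ + _ *: _).
  - by field; lra.
  - have -> : a = 1 - c - b by lra. by field; lra.
  - by ring.
apply: (cE) => //; first by lra.
apply: cE => //; apply/andP; split; first by rewrite divr_ge0 // ltW.
by rewrite ler_pdivrMr // mul1r; lra.
Qed.

Lemma convex_Hex s : convex_set (Hex s : set (convex_lmodType (plane R))).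
Proof.
apply: conv_convex_set => x y t t01 hx hy k; rewrite hfD !hfZ.
have := hx k; have := hy k; nra.
Qed.

Lemma nbhs_ray A x v : nbhs x A -> exists2 e : R, 0 < e & forall t, `|t| < e -> A (x + t *: v).
Proof.
move=> xA; have : (fun t : R => x + t *: v) @ (0 : R) --> x + (0 : R) *: v.
  by apply: cvgD; [exact: cvg_cst|apply: cvgZr_tmp; exact: cvg_id].
rewrite scale0r addr0 => /(_ _ xA) /nbhs_ballP [e /= e0 he].
exists e => // t te; apply: (he t).
by rewrite /ball /= sub0r normrN.
Qed.

Lemma interior_Hex s x : (forall k, hf k x < s k) -> (Hex s)^° x.
Proof.
move=> h; have H k : \forall y \near x, hf k y <= s k.
  apply: (@hf_continuous _ k x [set t | t <= s k]); near=> t; apply/ltW; near: t.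
  exact: lt_nbhsl.
have := @filter_forall _ _ (fun k y => hf k y <= s k) _ (nbhs_filter x) H; exact.
Unshelve. all: by end_near. Qed.

Lemma interior_Hex_lt s k x : (Hex s)^° x -> hf k x < s k.
Proof.
move=> /(nbhs_ray (hexn k)) [e e0 he].
have /he /(_ k) : `|e / 2| < e by rewrite gtr0_norm; lra.
by rewrite hfD hfZ hf_hexn; lra.
Qed.

End HexConvex.

(** * Nondegenerate hexagons are Wulff-like *)

Section HexIsWulff.
Variable R : realType.
Implicit Types (x y z : plane R) (s : 'I_6 -> R) (k : 'I_6) (A E : set (plane R)).
Local Notation r := (Num.sqrt 3 : R).

Definition nondeg s := forall k, 0 < hlen s k.

(** The vertex at which the sides [rt 5 k] and [k] meet. *)
Definition vtx s k : plane R := hpt k (s k) (s k - s (rt 5 k)).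

Lemma vtx_next s k : vtx s (rt 1 k) = hpt k (s k) (s (rt 1 k)).
Proof.
have e5 : rt 5 (rt 1 k) = k by rewrite rtD rt60.
have h1 : hf (rt 1 k) (vtx s (rt 1 k)) = s (rt 1 k) by rewrite hf_pt.
have : hf (rt 1 (rt 1 k)) (vtx s (rt 1 k)) = s (rt 1 k) - s k by rewrite hf1_pt e5.
rewrite rtD -[(1 + 1)%N]/2%N hf2 h1 => h2.
by apply: (@hf_inj _ k); rewrite ?hf_pt ?hf1_pt //; lra.
Qed.

Lemma segment_Hex s k : nondeg s ->
  segment (vtx s k) (vtx s (rt 1 k)) = Hex s `&` [set x | hf k x = s k].
Proof.
move=> h; have l0 := h k; have l1 := h (rt 1 k); have l5 := h (rt 5 k).
have l2 := h (rt 2 k); have l3 := h (rt 3 k); have l4 := h (rt 4 k).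
have [e0 e1 e2 e3 [e4 e5]] := hlens s k.
rewrite vtx_next /vtx; apply/seteqP; split=> x /=.
  move=> [t]; rewrite /= in_itv /= => /andP [t0 t1] <-.
  have hk : hf k (hpt k (s k) (s k - s (rt 5 k)) +
    t *: (hpt k (s k) (s (rt 1 k)) - hpt k (s k) (s k - s (rt 5 k)))) = s k.
    by rewrite hfD hfZ hfB !hf_pt; ring.
  split=> //; apply/(HexP _ k); rewrite hk hfD hfZ hfB !hf1_pt.
  have : 0 <= t * hlen s k by rewrite mulr_ge0 // ltW.
  have : 0 <= (1 - t) * hlen s k by apply: mulr_ge0; [lra|exact: ltW].
  by rewrite e0 => ? ?; do ![split]; lra.
move=> [/(HexP _ k) [h0 h1 [h2 h3 h4 h5]] hk].
exists ((hf (rt 1 k) x - (s k - s (rt 5 k))) / hlen s k).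
  rewrite /= in_itv /=; apply/andP; split.
    by apply: divr_ge0; [lra|exact: ltW].
  by rewrite ler_pdivrMr // mul1r; lra.
apply: (@hf_inj _ k); rewrite hfD hfZ hfB ?hf_pt ?hf1_pt; first by rewrite hk; ring.
by rewrite e0 in l0 *; field; lra.
Qed.

Lemma bounded_Hex s : bounded_set (Hex s).
Proof.
pose k : 'I_6 := ord0; pose m : R := `|s k| + `|s (rt 3 k)| + `|s (rt 1 k)| + `|s (rt 4 k)|.
exists (2 * m); split; first exact: num_real.
move=> M mM x /(HexP _ k) [h0 h1 [h2 h3 h4 h5]] /=; apply: le_trans (ltW mM).
have a0 := ler_norm (s k); have a1 := ler_norm (s (rt 1 k)).
have a3 := ler_norm (s (rt 3 k)); have a4 := ler_norm (s (rt 4 k)).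
have b0 := normr_ge0 (s k); have b1 := normr_ge0 (s (rt 1 k)).
have b3 := normr_ge0 (s (rt 3 k)); have b4 := normr_ge0 (s (rt 4 k)).
have : enorm x <= 2 * m.
  by apply: (enorm_le_hf (k := k)); rewrite ler_norml; apply/andP; split; rewrite /m; lra.
apply: le_trans; rewrite [leLHS]/(Num.max `|x.1| `|x.2|) ge_max /enorm /inner -!sqrtr_sqr.
by apply/andP; split; rewrite ler_wsqrtr // -!expr2 ?lerDl ?lerDr sqr_ge0.
Qed.

Lemma frontier_Hex s : frontier (Hex s) = Hex s `&` [set x | exists k, hf k x = s k].
Proof.
rewrite /frontier -((closure_id (Hex s)).1 (@closed_Hex _ s)).
apply/seteqP; split=> x /= [hx].
  move=> nix; split => //; apply: contrapT => no; apply: nix; apply: interior_Hex => k.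
  by rewrite lt_neqAle hx andbT; apply/eqP => e; apply: no; exists k.
by move=> [k e]; split => // /(@interior_Hex_lt _ _ k); rewrite e ltxx.
Qed.

Lemma exterior_normal_Hex s k : nondeg s ->
  exterior_normal (Hex s) (vtx s k) (vtx s (rt 1 k)) (hexn k).
Proof.
move=> h; have l0 := h k; have l1 := h (rt 1 k); have l5 := h (rt 5 k).
have l2 := h (rt 2 k); have l3 := h (rt 3 k); have l4 := h (rt 4 k).
have [e0 e1 e2 e3 [e4 e5]] := hlens s k.
split.
  have -> : inner (hexn k) (vtx s (rt 1 k) - vtx s k) = hf k (vtx s (rt 1 k) - vtx s k).
    by rewrite /hf /inner !(mulrC (hexn k).1) !(mulrC (hexn k).2).
  by rewrite hfB vtx_next !hf_pt subrr.
move=> z [t tI zE].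
have : segment (vtx s k) (vtx s (rt 1 k)) z.
  by exists t => //; move: tI; rewrite /= !in_itv /= => /andP [/ltW -> /ltW ->].
rewrite segment_Hex // => -[/(HexP _ k) [h0 h1 [h2 h3 h4 h5]] /= hk].
near=> e.
have e_gt0 : 0 < e by near: e; exact: nbhs_right_gt.
have el1 : e < hlen s (rt 1 k) by near: e; exact: nbhs_right_lt.
have el5 : e < hlen s (rt 5 k) by near: e; exact: nbhs_right_lt.
split.
  apply: interior_Hex; apply: (rt_ind (k := k)); rewrite ?hfE_rt !hfB !hfZ ?hf_hexn ?hf1_hexn; lra.
move=> /(_ k); rewrite hfD hfZ hf_hexn hk; lra.
Unshelve. all: by end_near. Qed.

Lemma convex_hexagon_Hex s : nondeg s -> convex_hexagon (Hex s).
Proof.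
move=> h; split; last exact: convex_Hex.
split; [exact: bounded_Hex|exact: closed_Hex|].
exists 6, (vtx s), id; split => //.
- rewrite frontier_Hex; apply/seteqP; split => x.
    by move=> [hx [k e]]; exists k => //; rewrite -[ordS k]/(rt 1 k) segment_Hex.
  by move=> [k _]; rewrite -[ordS k]/(rt 1 k) segment_Hex // => -[hx e]; split => //; exists k.
- move=> k; rewrite -[ordS k]/(rt 1 k); apply/eqP => e.
  have := congr1 (hf (rt 1 k)) e; rewrite vtx_next /vtx !hf1_pt.
  by have := h k; rewrite /hlen; lra.
- by move=> k; exact: exterior_normal_Hex.
- by move=> k; right.
Qed.

End HexIsWulff.

(** * Convex Wulff-like sets are nondegenerate hexagons *)

Section WulffIsHex.
Variable R : realType.
Implicit Types (x y z : plane R) (s : 'I_6 -> R) (A E : set (plane R)).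

(** A side of a convex set lies on a supporting line.  If a point [y] of the
set were above the line, the triangle spanned by [y] and the end points of the
side would contain the points just outside the middle of the side.  At
height [e] above the side their barycentric coordinates are [e / a],
[1 / 2 + e * A] and [1 / 2 + e * B]. *)
Lemma supporting E p q k : convex_set (E : set (convex_lmodType (plane R))) ->
  E p -> E q -> p != q -> exterior_normal E p q (hexn k) ->
  hf k q = hf k p /\ forall y, E y -> hf k y <= hf k p.
Proof.
move=> cE Ep Eq pq [inn hz].
have {}inn : hf k q = hf k p.
  by apply/eqP; rewrite -subr_eq0 -hfB -inn /hf /inner !(mulrC (hexn k).1) !(mulrC (hexn k).2).
split=> // y Ey; rewrite leNgt; apply/negP => lt.
pose F (u : plane R) : R := hf (rt 1 k) u.
have Fpq : F p - F q != 0.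
  by rewrite subr_eq0; apply: contra_neq pq => e; exact: (@hf_inj _ k).
pose a := hf k y - hf k p.
have a0 : 0 < a by rewrite subr_gt0.
pose A := (F (hexn k) - F y / a + F q / a) / (F p - F q).
pose B := - (a^-1) - A.
pose z := p + (1 / 2) *: (q - p).
have /hz : open_segment p q z by exists (1 / 2) => //; rewrite /= in_itv /=; lra.
move=> near_z.
have : \forall e \near (0 : R)^'+, False; last by move/filter_ex => [].
near=> e.
have e0 : 0 < e by near: e; exact: nbhs_right_gt.
have eA : e < (2 * (`|A| + `|B| + 1))^-1.
  near: e; apply: nbhs_right_lt; rewrite invr_gt0.
  by have := normr_ge0 A; have := normr_ge0 B; lra.
have [_] : E^° (z - e *: hexn k) /\ ~ E (z + e *: hexn k) by near: e.
apply.
have -> : z + e *: hexn k = (e / a) *: y + (1 / 2 + e * A) *: p + (1 / 2 + e * B) *: q.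
  apply: (@hf_inj _ k).
    rewrite !hfD !hfZ hfB hf_hexn inn /B.
    have -> : hf k y = a + hf k p by rewrite /a; ring.
    by field; lra.
  by rewrite !hfD !hfZ hfB -!/(F _) -?/(F (_ _)) /B /A; field; rewrite Fpq; lra.
have AB : e * (`|A| + `|B| + 1) < 1 / 2.
  have P0 : 0 < `|A| + `|B| + 1 by have := normr_ge0 A; have := normr_ge0 B; lra.
  by move: eA; rewrite -[_^-1]div1r ltr_pdivlMr; lra.
have eAB : 0 <= e * `|A| /\ 0 <= e * `|B| by split; rewrite mulr_ge0 // ltW.
have A1 := ler_norm (- A); have B1 := ler_norm (- B); rewrite !normrN in A1 B1.
have A2 : e * - A <= e * `|A| by rewrite ler_pM2l.
have B2 : e * - B <= e * `|B| by rewrite ler_pM2l.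
apply: convex3 => //.
- by apply: divr_ge0; exact: ltW.
- by lra.
- by lra.
- by rewrite /B; field; lra.
Unshelve. all: by end_near. Qed.

(** A segment from an interior point to a point outside a closed set crosses
the frontier, at the last time up to which it stays in the set. *)
Lemma exit_point E o x : closed E -> E^° o -> ~ E x ->
  exists2 t : R, 0 < t < 1 & frontier E (o + t *: (x - o)).
Proof.
move=> cE io nEx.
pose S := [set t : R | 0 <= t <= 1 /\ E (o + t *: (x - o))].
have Eo : E o by exact: interior_subset io.
have S0 : S 0 by split; [lra|rewrite scale0r addr0].
have hS : has_sup S by split; [exists 0|exists 1 => t [/andP []]].
pose t := sup S.
have t0 : 0 <= t by apply: ub_le_sup => //; case: hS.
have t1 : t <= 1 by apply: ge_sup; [exists 0|move=> u [/andP []]].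
have shift u : o + u *: (x - o) = (o + t *: (x - o)) + (u - t) *: (x - o).
  by rewrite -addrA -scalerDl addrC subrK addrC || (rewrite -addrA -scalerDl; congr (_ + _ *: _); ring).
have Et : E (o + t *: (x - o)).
  apply: contrapT => nE.
  have : nbhs (o + t *: (x - o)) (~` E) by apply: open_nbhs_nbhs; split => //; exact: closed_openC.
  move=> /(nbhs_ray (x - o)) [e e0 he].
  have [u Su tu] := sup_adherent e0 hS.
  have ut : u <= t by apply: ub_le_sup => //; case: hS.
  have : (~` E) (o + u *: (x - o)).
    by rewrite shift; apply: he; rewrite ler0_norm -/t in tu *; lra.
  by case: Su.
have nt1 : t != 1.
  by apply/eqP => e; apply: nEx; move: Et; rewrite e scale1r addrC subrK.
have fr : frontier E (o + t *: (x - o)).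
  split; first exact: subset_closure.
  move=> /(nbhs_ray (x - o)) [e e0 he].
  pose d := Num.min (e / 2) (1 - t).
  have d0 : 0 < d by rewrite lt_min; apply/andP; split; [lra|rewrite subr_gt0 lt_neqAle nt1].
  have de : d <= e / 2 by rewrite ge_min lexx.
  have d1 : d <= 1 - t by rewrite ge_min lexx orbT.
  have : S (t + d).
    split; first by apply/andP; split; lra.
    rewrite shift; have -> : t + d - t = d by ring.
    by apply: he; rewrite gtr0_norm; lra.
  have [_ ubS] := hS => /(ub_le_sup ubS); rewrite -/t; lra.
exists t => //; apply/andP; split; last by rewrite lt_neqAle nt1.
rewrite lt_neqAle t0 andbT; apply/eqP => e; case: fr; rewrite -e scale0r addr0.
by [].
Qed.

(** All the sides are supporting, so [E] is the intersection of the half-planes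
that they define.  Two sides with the same normal lie on the same line; hence
the normals cannot turn back after one side, as the side in between would
reduce to a point, and turning always in the same direction they go through
all six of them.  A side with given normal being a nondegenerate segment, the
corresponding length is positive. *)
Lemma convex_hexagonP E : convex_hexagon E -> exists2 s, nondeg s & E = Hex s.
Proof.
move=> [[_ clE [m [p [c [m2 frE pne exn cadj]]]]] cE].
have Ep k : E (p k).
  have : frontier E (p k).
    by rewrite frE; exists k => //; exists 0; [rewrite /= in_itv /=; lra|rewrite scale0r addr0].
  by case; rewrite -((closure_id E).1 clE).
have sup_k k := supporting cE (Ep k) (Ep (ordS k)) (pne k) (exn k).
pose h k := hf (c k) (p k).
have hnext k : hf (c k) (p (ordS k)) = h k by case: (sup_k k).
have hmax k y : E y -> hf (c k) y <= h k by case: (sup_k k) => _; exact.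
have hE k l : c k = c l -> h k = h l.
  move=> e; apply/eqP; rewrite eq_le; apply/andP; split.
    by rewrite /h e; apply: hmax.
  by rewrite /h -e; apply: hmax.
pose k0 : 'I_m := Ordinal (ltn_trans (isT : 0 < 2)%N m2).
have [c0 io] : exists x0, E^° x0.
  have [_ hz] := exn k0.
  have /hz : open_segment (p k0) (p (ordS k0)) (p k0 + (1 / 2) *: (p (ordS k0) - p k0)).
    by exists (1 / 2) => //; rewrite /= in_itv /=; lra.
  by move=> /filter_ex [e [ie _]]; eexists; exact: ie.
(* Strictly inside all the half-planes, so that a segment from here to a point
satisfying the constraints meets no side line before its end. *)
have ho k : hf (c k) c0 < h k.
  have [e e0 he] := nbhs_ray (hexn (c k)) io.
  have /he /(hmax k) : `|e / 2| < e by rewrite gtr0_norm; lra.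
  by rewrite hfD hfZ hf_hexn; lra.
have Ein x : (forall k, hf (c k) x <= h k) -> E x.
  move=> hx; apply: contrapT => /(exit_point clE io) [t /andP [t0 t1]].
  rewrite frE => -[k _] [u _ e].
  have : hf (c k) (c0 + t *: (x - c0)) = h k.
    by rewrite -e hfD hfZ hfB hnext subrr mulr0 addr0.
  rewrite hfD hfZ hfB; have := hx k; have := ho k.
  move: (hf _ c0) (hf _ x) (h k) => a b d; nra.
have noback k : c (ordS (ordS k)) <> c k.
  move=> e.
  have e1 : hf (c k) (p (ordS k)) = hf (c k) (p (ordS (ordS k))).
    by rewrite hnext -(hE _ _ e) /h e.
  have e2 : hf (c (ordS k)) (p (ordS k)) = hf (c (ordS k)) (p (ordS (ordS k))).
    by rewrite hnext.
  have := pne (ordS k); apply/negP; rewrite negbK; apply/eqP.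
  case: (cadj k) => ce; last by apply: (@hf_inj _ (c k)) => //; rewrite -[rt 1 _]/(ordS (c k)) -ce.
  apply: (@hf_inj _ (c (ordS k))) => //.
  by rewrite ce -[rt 1 _]/(ordS (ord_pred (c k))) ord_predK.
have nbr k : (c (ord_pred k) = rt 5 (c k) /\ c (ordS k) = rt 1 (c k)) \/
    (c (ord_pred k) = rt 1 (c k) /\ c (ordS k) = rt 5 (c k)).
  have nb := noback (ord_pred k); rewrite ord_predK in nb.
  have [e1|e1] : c (ord_pred k) = rt 5 (c k) \/ c (ord_pred k) = rt 1 (c k).
    have := cadj (ord_pred k); rewrite ord_predK => -[->|->].
      by right; rewrite -[rt 1 _]/(ordS _) ord_predK.
    by left; rewrite -rt_pred ordSK.
  - left; split=> //; case: (cadj k) => // e2.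
    by case: nb; rewrite e1 e2 rt_pred.
  - right; split=> //; case: (cadj k) => e2; first by rewrite e2 rt_pred.
    by case: nb; rewrite e1 e2.
have hit j : exists k, c k = j.
  have hS i : (exists k, c k = i) -> exists k, c k = rt 1 i.
    by move=> [k <-]; case: (nbr k) => -[a b]; [exists (ordS k)|exists (ord_pred k)].
  have hn n : exists k, c k = rt n (c k0).
    elim: n => [|n IH]; first by exists k0.
    by have := hS _ IH; rewrite rtD.
  by elim/(@rt_ind (c k0)) : j; [exact: (hn 0%N)|exact: hn..].
have [kk kkP] := choice hit.
pose s j := h (kk j).
have sE k : s (c k) = h k by rewrite /s; apply: hE; rewrite kkP.
have EHex : E = Hex s.
  apply/seteqP; split=> x; first by move=> Ex j; have := hmax (kk j) _ Ex; rewrite kkP.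
  by move=> hx; apply: Ein => k; rewrite -sE.
exists s => // j.
have key P Q : E P -> E Q -> P <> Q -> hf j P = s j -> hf j Q = s j ->
    hf (rt 1 j) P = s (rt 1 j) -> hf (rt 5 j) Q = s (rt 5 j) -> 0 < hlen s j.
  move=> EP EQ PQ P0 Q0 P1; rewrite hf5 => Q5.
  have QE : hf (rt 1 j) Q = s j - s (rt 5 j) by lra.
  have : hf (rt 1 j) Q <= s (rt 1 j) by move: EQ; rewrite EHex; exact.
  rewrite le_eqVlt => /orP [/eqP e|]; last by rewrite /hlen; lra.
  by case: PQ; apply: (@hf_inj _ j); lra.
have hk k : c k = j -> hf j (p k) = s j by move=> e; rewrite -e sE.
have hk1 k : c k = j -> hf j (p (ordS k)) = s j by move=> e; rewrite -e sE hnext.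
have pv k : hf (c (ord_pred k)) (p k) = s (c (ord_pred k)).
  by rewrite sE -hnext ord_predK.
have nx k : hf (c (ordS k)) (p (ordS k)) = s (c (ordS k)) by rewrite sE.
set k := kk j; have ck : c k = j by exact: kkP.
have := pv k; have := nx k; case: (nbr k) => -[-> ->]; rewrite ck => h1 h2.
  apply: (key (p (ordS k)) (p k)) => //; [|exact: hk1|exact: hk].
  by move=> e; have /eqP := pne k; rewrite e.
apply: (key (p k) (p (ordS k))) => //; [|exact: hk|exact: hk1].
by apply/eqP; exact: pne.
Qed.

End WulffIsHex.

(** * Metric quantities of hexagons *)

Section HexMetric.
Variable R : realType.
Implicit Types (x y z : plane R) (s u : 'I_6 -> R) (k : 'I_6) (A B E : set (plane R)).

Lemma sup_max (S : set R) m : S m -> (forall t, S t -> t <= m) -> sup S = m.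
Proof.
move=> Sm mx; apply/eqP; rewrite eq_le; apply/andP; split.
  by apply: ge_sup; [exists m|].
by apply: ub_le_sup => //; exists m.
Qed.

Lemma vtx_in s k : nondeg s -> Hex s (vtx s k) /\ hf k (vtx s k) = s k.
Proof.
move=> h; have : segment (vtx s k) (vtx s (rt 1 k)) (vtx s k).
  by exists 0; [rewrite /= in_itv /=; lra|rewrite scale0r addr0].
by rewrite segment_Hex.
Qed.

Lemma vtx_next_in s k : nondeg s ->
  Hex s (vtx s (rt 1 k)) /\ hf k (vtx s (rt 1 k)) = s k.
Proof.
move=> h; have : segment (vtx s k) (vtx s (rt 1 k)) (vtx s (rt 1 k)).
  by exists 1; [rewrite /= in_itv /=; lra|rewrite scale1r addrC subrK].
by rewrite segment_Hex.
Qed.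

Lemma side_dist_Hex s k : nondeg s -> side_dist (Hex s) k = s k.
Proof.
move=> h; have [v1 v2] := vtx_in k h; apply: sup_max; first by exists (vtx s k).
by move=> _ [x hx <-]; exact: hx.
Qed.

Lemma side_Hex s k : nondeg s -> side (Hex s) k = Hex s `&` [set x | hf k x = s k].
Proof.
move=> h; have [v1 v2] := vtx_in k h; apply/seteqP; split=> x /= [hx e]; split=> //.
  by apply/eqP; rewrite eq_le hx /=; move: (e _ v1); rewrite -/(hf k _) v2.
by move=> y hy; rewrite -!/(hf k _) e; exact: hy.
Qed.

Lemma side_length_Hex s k : nondeg s -> side_length (Hex s) k = 2 / Num.sqrt 3 * hlen s k.
Proof.
move=> h; have h0 := h k; rewrite /side_length side_Hex //.
have r0 : 0 <= 2 / Num.sqrt 3 :> R by rewrite divr_ge0 ?sqrtr_ge0.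
have [v1 v2] := vtx_in k h; have [w1 w2] := vtx_next_in k h.
apply: sup_max.
  exists (vtx s (rt 1 k), vtx s k) => //=.
  rewrite (enorm_hf (k := k)); last by rewrite hfB v2 w2 subrr.
  rewrite hfB vtx_next /vtx !hf1_pt ger0_norm; last by rewrite /hlen in h0; lra.
  by rewrite /hlen; congr (_ * _); ring.
move=> _ [[x y] [/= [/(HexP _ k) [a0 a1 [a2 a3 a4 a5]] ex] [/(HexP _ k) [b0 b1 [b2 b3 b4 b5]] ey]] <-].
rewrite (enorm_hf (k := k)); last by rewrite hfB ex ey subrr.
rewrite ler_wpM2l // hfB ler_norml /hlen; apply/andP; split; lra.
Qed.

Lemma origin_symmetric_Hex s : (forall k, s (rt 3 k) = s k) -> origin_symmetric (Hex s).
Proof.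
move=> h; apply/seteqP; split=> x.
  move=> hx; exists (- x); rewrite ?opprK // => k.
  by rewrite hfN -hf3 -h; exact: hx.
by move=> [y hy <-] k; rewrite hfN -hf3 -h; exact: hy.
Qed.

Lemma Hex_symmetric s k : nondeg s -> origin_symmetric (Hex s) -> s (rt 3 k) = s k.
Proof.
move=> h hs.
have le j : s j <= s (rt 3 j).
  have [v1 v2] := vtx_in j h; move: v1; rewrite hs => -[y hy e].
  by rewrite -v2 -e hfN -hf3; exact: hy.
by apply/eqP; rewrite eq_le le andbT; have := le (rt 3 k); rewrite rtD rt60.
Qed.

(** Any hexagon that contains points at height [s k] for all [k] has support
numbers at least [s k]. *)
Lemma envelope_Hex E s : nondeg s -> E `<=` Hex s ->
  (forall k, exists2 x, E x & hf k x = s k) -> envelope E = Hex s.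
Proof.
move=> h Es ex.
have envs : is_envelope E (Hex s).
  split; [exact: convex_hexagon_Hex|by []|].
  move=> K /convex_hexagonP [u hu ->] EK x hx k.
  have [y Ey e] := ex k; apply: le_trans (hx k) _; rewrite -e; exact: EK.
rewrite /envelope; case: xgetP => [W _ [cW EW minW]|/(_ (Hex s)) //].
apply/seteqP; split; first by apply: minW => //; exact: convex_hexagon_Hex.
by case: envs => _ _; exact.
Qed.

Lemma hausdorff_le A B (d : R) :
  (forall x, A x -> exists2 y, B y & enorm (x - y) <= d) ->
  (forall x, B x -> exists2 y, A y & enorm (x - y) <= d) ->
  (hausdorff_dist A B <= d%:E)%E.
Proof.
move=> hA hB; rewrite /hausdorff_dist ge_max; apply/andP; split.
  apply: ge_ereal_sup => _ [x Ax <-]; have [y By xy] := hA x Ax.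
  by apply: ge_ereal_inf; exists (enorm (x - y))%:E; [exists y|rewrite lee_fin].
apply: ge_ereal_sup => _ [x Ax <-]; have [y By xy] := hB x Ax.
by apply: ge_ereal_inf; exists (enorm (x - y))%:E; [exists y|rewrite lee_fin].
Qed.

Lemma hausdorff_ltl A B (d : R) x : (hausdorff_dist A B < d%:E)%E -> A x ->
  exists2 y, B y & enorm (x - y) < d.
Proof.
rewrite /hausdorff_dist gt_max => /andP [h _] Ax.
have : (edist_set x B < d%:E)%E.
  by apply: le_lt_trans h; apply: ereal_sup_ubound; exists x.
by move=> /ereal_inf_lt [_ [y By <-]]; rewrite lte_fin; exists y.
Qed.

Lemma hausdorffC A B : hausdorff_dist A B = hausdorff_dist B A.
Proof. by rewrite /hausdorff_dist maxC. Qed.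

(** A vertex of one hexagon has a point of the other one within distance [d],
and heights are 1-Lipschitz. *)
Lemma hausdorff_Hex_le s u d k : nondeg s -> nondeg u ->
  (hausdorff_dist (Hex s) (Hex u) < d%:E)%E -> `|s k - u k| <= d.
Proof.
move=> hs hu hd.
have key (a b : 'I_6 -> R) : nondeg a -> (hausdorff_dist (Hex a) (Hex b) < d%:E)%E ->
    a k - b k <= d.
  move=> ha hab; have [v1 v2] := vtx_in k ha.
  have [y hy xy] := hausdorff_ltl hab v1.
  have := enorm_ge_hf k (vtx a k - y); have := ler_norm (hf k (vtx a k - y)).
  by rewrite hfB v2; have := hy k; lra.
rewrite ler_norml; have := key _ _ hs hd; rewrite hausdorffC in hd.
by have := key _ _ hu hd => *; apply/andP; split; lra.
Qed.

(** Scaling by [rho / (rho + d)] maps one hexagon into the other, and moves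
its points by at most [d / rho] times their norm. *)
Lemma hausdorff_Hex_close s u (rho M d : R) : 0 < rho -> 0 <= d ->
  (forall k, rho <= s k <= M) -> (forall k, rho <= u k <= M) ->
  (forall k, `|s k - u k| <= d) ->
  (hausdorff_dist (Hex s) (Hex u) <= (2 * M * d / rho)%:E)%E.
Proof.
move=> r0 d0 hs hu hd.
have key (a b : 'I_6 -> R) x : (forall k, rho <= a k <= M) -> (forall k, rho <= b k <= M) ->
    (forall k, a k <= b k + d) ->
    Hex a x -> exists2 y, Hex b y & enorm (x - y) <= 2 * M * d / rho.
  move=> ha hb hab hx; pose l := rho / (rho + d).
  have rd : 0 < rho + d by lra.
  have l0 : 0 <= l by apply: divr_ge0; lra.
  exists (l *: x).
    move=> k; rewrite hfZ.
    have h1 : l * hf k x <= l * (b k + d).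
      by rewrite ler_wpM2l //; apply: le_trans (hx k) _; exact: hab.
    apply: le_trans h1 _; rewrite /l mulrAC ler_pdivrMr //.
    have /andP [hb1 _] := hb k.
    have : rho * d <= b k * d by rewrite ler_wpM2r.
    by lra.
  have -> : x - l *: x = (d / (rho + d)) *: x.
    rewrite -[X in X - _]scale1r -scalerBl; congr (_ *: _); rewrite /l; field; lra.
  rewrite enormZ ger0_norm; last by apply: divr_ge0; lra.
  have xM : enorm x <= 2 * M.
    have hM k : `|hf k x| <= M.
      rewrite ler_norml; have := hx k; have := hx (rt 3 k); rewrite hf3.
      by have /andP [_ ?] := ha k; have /andP [_ ?] := ha (rt 3 k) => *; apply/andP; split; lra.
    exact: (enorm_le_hf (hM ord0)).
  have -> : 2 * M * d / rho = (d / rho) * (2 * M) by ring.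
  apply: ler_pM => //; [by apply: divr_ge0; lra|exact: enorm_ge0|].
  by rewrite ler_wpM2l // lef_pV2 ?posrE //; lra.
apply: hausdorff_le => x hx.
  by apply: (key _ _ _ hs hu) hx => k; have := hd k; rewrite ler_norml => /andP [_]; lra.
by apply: (key _ _ _ hu hs) hx => k; have := hd k; rewrite ler_norml => /andP []; lra.
Qed.

End HexMetric.

(** * The lattice and its hexagonal cell *)

Section Cells.
Variable R : realType.
Implicit Types (x y : plane R) (z w : int * int) (I : set (int * int)) (eps : R).
Local Notation r := (Num.sqrt 3 : R).

Definition lat eps z : plane R := eps *: (z.1%:~R *: eta1 + z.2%:~R *: eta2).

Lemma latP eps x : lattice eps x <-> exists z, x = lat eps z.
Proof.
split=> [[a [b ->]]|[[a b] ->]]; first by exists (a, b).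
by exists a, b.
Qed.

Lemma hf_lat eps k z : hf k (lat eps z) = eps * (r / 2) * (latf k z)%:~R.
Proof.
rewrite /lat hfZ hfD !hfZ -mulrA; congr (_ * _); case: z => a b /=.
rewrite !hfE; have rr := r3_sqr R; by case6 k; rewrite /latf /= ?intrD ?mulrNz; field.
Qed.

Lemma latB eps z w : lat eps z - lat eps w = lat eps (z - w).
Proof.
apply: (@hf_inj _ ord0); rewrite hfB !hf_lat; case: z w => [a b] [c d];
  by rewrite /latf /= ?intrD ?mulrNz; ring.
Qed.

Lemma lat_inj eps : 0 < eps -> injective (lat eps).
Proof.
move=> e0 z w e.
have c0 : eps * (r / 2) != 0 by rewrite mulf_neq0 ?gt_eqF // divr_gt0 // r3_gt0.
have key k : latf k z = latf k w.
  have := congr1 (hf k) e; rewrite !hf_lat => /(mulfI c0) /eqP.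
  by rewrite eqr_int => /eqP.
by apply: (@latf_inj ord0).
Qed.

(** The height in the direction of the sum of two consecutive normals; these
sums are normal to the edges of the cells, whose vertices point along the
[hexn k]. *)
Definition hg k x : R := hf k x + hf (rt 1 k) x.

Lemma hgD k x y : hg k (x + y) = hg k x + hg k y.
Proof. by rewrite /hg !hfD; ring. Qed.
Lemma hgZ k a x : hg k (a *: x) = a * hg k x.
Proof. by rewrite /hg !hfZ; ring. Qed.
Lemma hgB k x y : hg k (x - y) = hg k x - hg k y.
Proof. by rewrite /hg !hfB; ring. Qed.

Lemma hg_sum k (F : 'I_6 -> plane R) : hg k (\sum_j F j) = \sum_j hg k (F j).
Proof.
elim/big_ind2: _ => // [|x1 x2 y1 y2 <- <-]; last by rewrite hgD.
by rewrite /hg !hf0 addr0.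
Qed.

Lemma hg_hexn_le k j : hg k (hexn j) <= 3 / 2.
Proof.
rewrite /hg !hfE hexnE; have rr := r3_sqr R.
by case6 k; case6 j; rewrite /rt /=; lra.
Qed.

Lemma hexagon_le y : hexagon y -> forall k, hg k y <= r / 2.
Proof.
move=> [w [w0 w1 ->]] k; rewrite hgZ hg_sum.
have -> : r / 2 = r / 3 * (3 / 2) by field.
rewrite ler_wpM2l ?divr_ge0 ?sqrtr_ge0 //.
apply: (@le_trans _ _ (\sum_j w j * (3 / 2))); last by rewrite -mulr_suml w1 mul1r.
apply: ler_sum => j _.
by rewrite hgZ; apply: ler_wpM2l => //; exact: hg_hexn_le.
Qed.

(** A point [(a, b)] of the cell is written as a convex combination of the
vertices by first cutting the cell along the vertical line through the point.
The end points of the cut lie on the upper and lower pairs of edges, at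
ordinates [t] and [- t]; [l] locates the point between them, and [up], [vp]
are the coordinates of the end points along the edges. *)
Lemma hexagon_ge y : (forall k, hg k y <= r / 2) -> hexagon y.
Proof.
move=> h; have rr := r3_sqr R; have r0 := r3_gt0 R.
case: y h => a b h.
have hk k (k6 : (k < 6)%N) := h (Ordinal k6).
have := hk 0%N isT; have := hk 1%N isT; have := hk 2%N isT; have := hk 3%N isT.
have := hk 4%N isT; have := hk 5%N isT.
rewrite /hg !hfE /rt /= => h5 h4 h3 h2 h1 h0.
have a1 : - (1 / 2) <= a by rewrite -(ler_pM2l r0); lra.
have a2 : a <= 1 / 2 by rewrite -(ler_pM2l r0); lra.
pose A := `|a|.
have A0 : 0 <= A by exact: normr_ge0.
have A2 : 2 * A <= 1 by rewrite /A; case: (ger0P a) => _; lra.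
pose t := r / 3 * (1 - A).
have t0 : 0 < t by rewrite mulr_gt0 ?divr_gt0 //; lra.
have bt1 : b <= t by rewrite /t /A; case: (ger0P a) => _; lra.
have bt2 : - t <= b by rewrite /t /A; case: (ger0P a) => _; lra.
pose l := (b + t) / (2 * t).
have l0 : 0 <= l by apply: divr_ge0; lra.
have l1 : l <= 1 by rewrite /l ler_pdivrMr; lra.
have lE : l * (2 * t) = b + t by rewrite /l; field; lra.
pose up := if 0 <= a then 0 else 2 * A; pose vp := if 0 <= a then 2 * A else 0.
have up0 : 0 <= up by rewrite /up; case: ifP => _; lra.
have vp0 : 0 <= vp by rewrite /vp; case: ifP => _; lra.
have uv : up + vp = 2 * A by rewrite /up /vp; case: ifP => _; lra.
have uva : vp - up = 2 * a.
  by rewrite /up /vp /A; case: (ger0P a) => ha; lra.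
exists (fun k : 'I_6 => nth 0 [:: l * (1 - 2 * A); l * up; (1 - l) * up;
   (1 - l) * (1 - 2 * A); (1 - l) * vp; l * vp] k).
have l2 : 0 <= 1 - l by lra.
have A3 : 0 <= 1 - 2 * A by lra.
split.
- by move=> k; case6 k => /=; exact: mulr_ge0.
- rewrite !big_ord_recl big_ord0 /=; transitivity (1 - 2 * A + (up + vp)); first by ring.
  by rewrite uv; ring.
- rewrite !big_ord_recl big_ord0 !hexnE /= /hexc /=.
  have sc (c d : R) : (c *: (d : R) : R) = c * d by [].
  congr pair; rewrite /= !sc.
    transitivity (r * r / 6 * (vp - up)); first by rewrite rr uva; field.
    by field.
  transitivity ((2 * l - 1) * t); first by move: lE; move: (l) (t) => *; lra.
  transitivity (r / 3 * ((2 * l - 1) * (1 - 2 * A) + (2 * l - 1) * ((up + vp) / 2))); last by field.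
  by rewrite uv /t; field.
Qed.

End Cells.

(** * Unions of cells *)

Section CellUnion.
Variable R : realType.
Implicit Types (x y : plane R) (z w : int * int) (I J : set (int * int)) (eps : R).
Local Notation r := (Num.sqrt 3 : R).

Lemma cellP eps i x : 0 < eps ->
  cell eps i x <-> forall k, hg k (x - i) <= eps * (r / 2).
Proof.
move=> e0; split=> [[y hy <-] k|h].
  by rewrite addrAC subrr add0r hgZ ler_pM2l //; exact: hexagon_le.
exists (eps^-1 *: (x - i)); last first.
  by rewrite scalerA mulfV ?gt_eqF // scale1r addrC subrK.
by apply: hexagon_ge => k; rewrite hgZ mulrC ler_pdivrMr // mulrC.
Qed.

(** Open cells are disjoint, so that a point of one belongs to a union of cells
precisely if the union contains that cell; see [ocell_cells]. *)
Definition ocell eps i : set (plane R) := [set x | forall k, hg k (x - i) < eps * (r / 2)].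

Lemma ocell_cell eps i : 0 < eps -> ocell eps i `<=` cell eps i.
Proof. by move=> e0 x hx; apply/cellP => // k; apply/ltW/hx. Qed.

Lemma ocell_center eps i : 0 < eps -> ocell eps i i.
Proof.
move=> e0 k; rewrite hgB subrr mulr_gt0 // divr_gt0 //; exact: r3_gt0.
Qed.

Lemma hf_hexagon y k : hexagon y -> hf k y <= r / 3.
Proof.
move=> hy; have := hexagon_le hy k; have := hexagon_le hy (rt 5 k).
by rewrite /hg rtD rt60 hf5; lra.
Qed.

Lemma hexagon_vtx k : hexagon ((r / 3) *: hexn k : plane R).
Proof.
exists (fun j => (j == k)%:R); split.
- by move=> j; exact: ler0n.
- by rewrite (bigD1 k) //= eqxx big1 ?addr0 // => j /negbTE ->.
- congr (_ *: _); rewrite (bigD1 k) //= eqxx scale1r big1 ?addr0 // => j /negbTE ->.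
  by rewrite scale0r.
Qed.

Lemma cell_top eps i k : exists2 x, cell eps i x & hf k x = hf k i + eps * (r / 3).
Proof.
exists (i + eps *: ((r / 3) *: hexn k)); first by eexists; [exact: hexagon_vtx|].
by rewrite hfD !hfZ hf_hexn mulr1.
Qed.

Lemma cell_le eps i x k : 0 < eps -> cell eps i x -> hf k x <= hf k i + eps * (r / 3).
Proof. by move=> e0 [y hy <-]; rewrite hfD hfZ lerD2l ler_pM2l // hf_hexagon. Qed.

Lemma cell_Hex eps i (s : 'I_6 -> R) : 0 < eps ->
  cell eps i `<=` Hex s <-> forall k, hf k i + eps * (r / 3) <= s k.
Proof.
move=> e0; split=> [h k|h x hx k]; last by apply: le_trans (cell_le _ e0 hx) (h k).
by have [x /h hx <-] := cell_top eps i k.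
Qed.

Definition latg k z : int := latf k z + latf (rt 1 k) z.

Lemma hg_lat eps k z : hg k (lat eps z) = eps * (r / 2) * (latg k z)%:~R.
Proof. by rewrite /hg !hf_lat /latg intrD mulrDr. Qed.

(** Two centres whose difference is less than [2] in all six edge directions
coincide; this is the disjointness of the open cells. *)
Lemma latg_small z : (forall k, latg k z < 2) -> z = 0.
Proof.
move=> h; have hk k (k6 : (k < 6)%N) := h (Ordinal k6).
have := hk 0%N isT; have := hk 1%N isT; have := hk 2%N isT; have := hk 3%N isT.
have := hk 4%N isT; have := hk 5%N isT.
case: z {h hk} => a b; rewrite /latg /latf /rt /= => *.
by congr pair; lia.
Qed.

Lemma ocell_unique eps z w x : 0 < eps ->
  ocell eps (lat eps z) x -> cell eps (lat eps w) x -> z = w.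
Proof.
move=> e0 hz /(cellP _ _ e0) hw.
have c0 : 0 < eps * (r / 2) by rewrite mulr_gt0 // divr_gt0 // r3_gt0.
apply/esym/eqP; rewrite -subr_eq0; apply/eqP/latg_small => k.
rewrite -(ltr_int R) -(ltr_pM2l c0) -hg_lat -latB hgB.
have hg3 (y : plane R) : hg (rt 3 k) y = - hg k y.
  by rewrite /hg rtD hf3 hf4; ring.
have := hz k; have := hw (rt 3 k); rewrite hg3 !hgB => h1 h2.
rewrite (_ : 2%:~R = 2) //; lra.
Qed.

Definition cells eps I : set (plane R) := cell_union eps [set lat eps z | z in I].

Lemma cell_sub eps I z : I z -> cell eps (lat eps z) `<=` cells eps I.
Proof. by move=> Iz x hx; exists (lat eps z) => //; exists z. Qed.

Lemma cellsP eps I x : cells eps I x <-> exists2 z, I z & cell eps (lat eps z) x.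
Proof.
split; first by move=> [_ [z Iz <-] hx]; exists z.
by move=> [z Iz hx]; exact: (cell_sub Iz).
Qed.

Lemma ocell_cells eps I z x : 0 < eps -> ocell eps (lat eps z) x -> cells eps I x <-> I z.
Proof.
move=> e0 hx; split=> [/cellsP [w Iw hw]|Iz]; first by rewrite (ocell_unique e0 hx hw).
by apply: (cell_sub Iz); exact: ocell_cell.
Qed.

Lemma cell_subP eps I z : 0 < eps -> cell eps (lat eps z) `<=` cells eps I <-> I z.
Proof.
move=> e0; split; last exact: cell_sub.
have c := ocell_center (lat eps z) e0.
by move=> /(_ _ (ocell_cell e0 c)) /(ocell_cells I e0 c).
Qed.

Lemma admissible_cells eps I : admissible eps (cells eps I).
Proof.
by exists [set lat eps z | z in I] => // _ [z _ <-]; apply/latP; exists z.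
Qed.

Lemma admissibleP eps E : admissible eps E -> exists I, E = cells eps I.
Proof.
move=> [A hA ->]; exists [set z | A (lat eps z)]; congr cell_union.
apply/seteqP; split=> [x Ax|_ [z Az <-]] //.
by have /latP [z e] := hA _ Ax; exists z; rewrite /= -?e.
Qed.

(** A cell is contained in a hexagon precisely if its vertices are, which
bounds the six heights of its centre; rounding down gives integral bounds. *)
Lemma discrete_hexagonP eps E : 0 < eps -> discrete_hexagon eps E ->
  exists s : 'I_6 -> int, E = cells eps [set z | inhex s z].
Proof.
move=> e0 [K /convex_hexagonP [u _ ->] ->].
have c0 : 0 < eps * (r / 2) by rewrite mulr_gt0 // divr_gt0 // r3_gt0.
exists (fun k => Num.floor ((u k - eps * (r / 3)) / (eps * (r / 2)))).
congr cell_union; apply/seteqP; split=> x.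
  move=> [/latP [z ->] /(cell_Hex _ _ e0) h]; exists z => //=.
  apply/forallP => k; rewrite real_floor_ge_int ?num_real // ler_pdivlMr // mulrC -hf_lat.
  by have := h k; lra.
move=> [z /forallP h <-]; split; first by apply/latP; exists z.
apply/cell_Hex => // k; have := h k.
rewrite real_floor_ge_int ?num_real // ler_pdivlMr // mulrC -hf_lat; lra.
Qed.

End CellUnion.

(** * The perimeter as a bond count *)

Section Perimeter.
Variable R : realType.
Implicit Types (x y : plane R) (z w : int * int) (eps : R) (I : {fset int * int}).
Local Notation r := (Num.sqrt 3 : R).

Lemma latu_opp k : - latu k = latu (rt 3 k).
Proof. by case6 k. Qed.

Lemma inner_lat eps z : inner (lat eps z) (lat eps z) =
  eps ^+ 2 * (z.1 ^+ 2 + z.1 * z.2 + z.2 ^+ 2)%:~R.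
Proof.
rewrite (innerE ord0) !hf_lat; case: z => a b; rewrite /latf /rt /=.
rewrite !expr2 !intrD !intrM mulrNz; have rr := r3_sqr R; move: (a%:~R : R) (b%:~R : R) => A B.
transitivity (r * r / 3 * (eps * eps * (A * A + A * B + B * B))); first by field.
by rewrite rr; field.
Qed.

(** Nearest neighbours are the six points where the quadratic form of the
lattice takes the value one. *)
Lemma int_unit (a b : int) : a ^+ 2 + a * b + b ^+ 2 = 1 -> exists k, (a, b) = latu k.
Proof.
move=> h.
have ha : -1 <= a <= 1 by apply/andP; split; nia.
have hb : -1 <= b <= 1 by apply/andP; split; nia.
have ca : [\/ a = -1, a = 0 | a = 1].
  have [|[|]] : a = -1 \/ a = 0 \/ a = 1 by lia.
  - by constructor 1.
  - by constructor 2.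
  - by constructor 3.
have cb : [\/ b = -1, b = 0 | b = 1].
  have [|[|]] : b = -1 \/ b = 0 \/ b = 1 by lia.
  - by constructor 1.
  - by constructor 2.
  - by constructor 3.
have o k (k6 : (k < 6)%N) : exists j, nth 0 [:: (-1, 0); (0, -1); (1, -1); (1, 0); (0, 1); (-1, 1)] k = latu j.
  by exists (Ordinal k6).
case: ca h => ->; case: cb => -> h; try by lia.
- exact: (o 0%N).
- exact: (o 5%N).
- exact: (o 1%N).
- exact: (o 4%N).
- exact: (o 2%N).
- exact: (o 3%N).
Qed.

Lemma lat_unit eps z : 0 < eps -> enorm (lat eps z) = eps <-> exists k, z = latu k.
Proof.
move=> e0; rewrite /enorm inner_lat sqrtrM ?sqr_ge0 // sqrtr_sqr gtr0_norm //.
split=> [e|[k ->]].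
  case: z e => a b /= e; apply: int_unit.
  have /(mulfI (lt0r_neq0 e0)) h : eps * Num.sqrt (a ^+ 2 + a * b + b ^+ 2)%:~R = eps * 1.
    by rewrite mulr1.
  have : (a ^+ 2 + a * b + b ^+ 2)%:~R = 1 :> R.
    rewrite -[LHS]sqr_sqrtr ?h ?expr1n // ler0z; nia.
  by move=> /eqP; rewrite (_ : 1 = 1%:~R) // eqr_int => /eqP.
by rewrite (_ : _ + _ + _ = 1) ?sqrtr1 ?mulr1 //; case6 k.
Qed.

Definition bond_seq eps I : seq (plane R * plane R) :=
  [seq (lat eps z, lat eps (z + latu k)) | k <- enum 'I_6, z <- exits k I].

Lemma boundary_bonds_cells eps I : 0 < eps ->
  boundary_bonds eps (cells eps [set` I]) = [set` bond_seq eps I].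
Proof.
move=> e0; apply/seteqP; split=> [[x y]|[x y]] /=.
  move=> [/= /latP [z zE] /latP [w wE] + + wI]; rewrite {x}zE {y}wE in wI *.
  rewrite latB => /(lat_unit _ e0) [k e] /(cell_subP _ _ e0) zI.
  have {}wI : w \notin I by apply/negP => h; apply: wI; apply/cell_subP.
  have -> : w = z + latu (rt 3 k) by rewrite -latu_opp -e opprB addrC subrK.
  apply/allpairsPdep; exists (rt 3 k), z; split; rewrite ?mem_enum //.
  rewrite !inE /= [z \in I]zI /=.
  by rewrite -latu_opp -e opprB addrC subrK.
move=> /allpairsPdep [k [z [_ ]]]; rewrite !inE /= => /andP [zI wI] [-> ->]; split.
- by apply/latP; exists z.
- by apply/latP; eexists.
- rewrite latB lat_unit //; exists (rt 3 k); by rewrite opprD addrA subrr add0r latu_opp.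
- exact/cell_subP.
- by move=> /cell_subP => /(_ e0) /= h; rewrite h in wI.
Qed.

Lemma size_bond_seq eps I : size (bond_seq eps I) = (\sum_k #|` exits k I|)%N.
Proof.
rewrite size_allpairs_dep sumnE big_map big_enum /=; exact: eq_bigr.
Qed.

Lemma uniq_bond_seq eps I : 0 < eps -> uniq (bond_seq eps I).
Proof.
move=> e0; apply: allpairs_uniq_dep => [|k _|]; [exact: enum_uniq|exact: fset_uniq|].
move=> [k z] [l w] /= _ _ e.
have e1 : z = w by apply: (lat_inj e0); exact: (congr1 fst e).
have e2 : z + latu k = w + latu l by apply: (lat_inj e0); exact: (congr1 snd e).
move: e2; rewrite {e}e1 => /addrI e2.
suff -> : k = l by [].
by move: e2; case6 k; case6 l => // _; exact/val_inj.
Qed.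

Lemma perimeter_cells eps I : 0 < eps ->
  perimeter eps (cells eps [set` I]) = (r / 3 * eps * (\sum_k #|` exits k I|)%:R)%:E.
Proof.
move=> e0; rewrite /perimeter boundary_bonds_cells // /counting asboolT; last exact: finite_seq.
have -> : fset_set [set` bond_seq eps I] = [fset p in bond_seq eps I]%fset.
  apply/fsetP => p; rewrite in_fset_set; last exact: finite_seq.
  by rewrite !inE; apply/idP/idP => [/set_mem|h] //; exact/mem_set.
by rewrite card_fseq undup_id ?uniq_bond_seq // size_bond_seq -EFinM.
Qed.

Lemma perimeter_ge0 eps (E : set (plane R)) : 0 < eps -> (0 <= perimeter eps E)%E.
Proof.
move=> e0; rewrite /perimeter; apply: mule_ge0; rewrite ?lee_fin.
  by rewrite mulr_ge0 ?(ltW e0) // divr_ge0 // sqrtr_ge0.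
by rewrite /counting; case: ifP; rewrite ?lee_fin ?leey.
Qed.

End Perimeter.

(** * Area of a cell *)

Section CellArea.
Variable R : realType.
Implicit Types (x y : plane R) (eps : R).
Local Notation r := (Num.sqrt 3 : R).
Local Notation mu := (@lebesgue_measure R).

Lemma integral_affine (a b c d : R) : a < b ->
  (\int[mu]_(u in `[a, b]) (c + d * u)%:E =
   ((c * b + d / 2 * b ^+ 2) - (c * a + d / 2 * a ^+ 2))%:E)%E.
Proof.
move=> ab; pose F (u : R) : R := c * u + d / 2 * u ^+ 2.
have dF (u : R) : is_derive u (1 : R) F (c + d * u).
  apply: is_derive_eq.
  by rewrite /GRing.scale /=; field.
have cF (u : R) : {for u, continuous F}.
  by apply/differentiable_continuous/derivable1_diffP; have [] := dF u.
rewrite (@continuous_FTC2 _ _ F) //.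
- apply: continuous_subspaceT => u; apply: cvgD; first exact: cvg_cst.
  by apply: cvgM; [exact: cvg_cst|exact: cvg_id].
- split=> [u _||]; first by have [] := dF u.
    by apply: cvg_at_right_filter; exact: cF.
  by apply: cvg_at_left_filter; exact: cF.
- by move=> u _; rewrite derive1E; have [] := dF u.
Qed.

(** Over the abscissa [i.1 + a], with [|a| <= eps / 2], the cell is a vertical
segment of half-length [sqrt 3 / 3 * (eps - |a|)]. *)
Lemma cell_coord eps i x : 0 < eps -> cell eps i x <->
  `|x.1 - i.1| <= eps / 2 /\ `|x.2 - i.2| <= r / 3 * (eps - `|x.1 - i.1|).
Proof.
move=> e0; have rr := r3_sqr R; have r0 := r3_gt0 R.
rewrite cellP //.
have -> : x.1 - i.1 = (x - i).1 by []. have -> : x.2 - i.2 = (x - i).2 by [].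
case: (x - i) => a b /=; split.
  move=> h; have hk k (k6 : (k < 6)%N) := h (Ordinal k6).
  have := hk 0%N isT; have := hk 1%N isT; have := hk 2%N isT; have := hk 3%N isT.
  have := hk 4%N isT; have := hk 5%N isT.
  rewrite /hg !hfE /rt /= => h5 h4 h3 h2 h1 h0.
  have a1 : - (eps / 2) <= a by rewrite -(ler_pM2l r0); lra.
  have a2 : a <= eps / 2 by rewrite -(ler_pM2l r0); lra.
  split; first by rewrite ler_norml a1 a2.
  by rewrite ler_norml; apply/andP; split; case: (ger0P a) => _; lra.
rewrite !ler_norml => -[/andP [a1 a2] /andP [b1 b2]].
have ra1 : r * - (eps / 2) <= r * a by rewrite ler_pM2l.
have ra2 : r * a <= r * (eps / 2) by rewrite ler_pM2l.
have [n1 n2] : r * a <= r * `|a| /\ - (r * a) <= r * `|a|.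
  rewrite -mulrN !ler_pM2l //; split; first exact: ler_norm.
  by rewrite -normrN ler_norm.
move=> k; rewrite /hg !hfE; case6 k; rewrite /rt /=; lra.
Qed.

Lemma ocell_coord eps i x : 0 < eps -> ocell eps i x <->
  `|x.1 - i.1| < eps / 2 /\ `|x.2 - i.2| < r / 3 * (eps - `|x.1 - i.1|).
Proof.
move=> e0; have rr := r3_sqr R; have r0 := r3_gt0 R.
rewrite /ocell /=.
have -> : x.1 - i.1 = (x - i).1 by []. have -> : x.2 - i.2 = (x - i).2 by [].
case: (x - i) => a b /=; split.
  move=> h; have hk k (k6 : (k < 6)%N) := h (Ordinal k6).
  have := hk 0%N isT; have := hk 1%N isT; have := hk 2%N isT; have := hk 3%N isT.
  have := hk 4%N isT; have := hk 5%N isT.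
  rewrite /hg !hfE /rt /= => h5 h4 h3 h2 h1 h0.
  have a1 : - (eps / 2) < a by rewrite -(ltr_pM2l r0); lra.
  have a2 : a < eps / 2 by rewrite -(ltr_pM2l r0); lra.
  split; first by rewrite ltr_norml a1 a2.
  by rewrite ltr_norml; apply/andP; split; case: (ger0P a) => _; lra.
rewrite !ltr_norml => -[/andP [a1 a2] /andP [b1 b2]].
have ra1 : r * - (eps / 2) < r * a by rewrite ltr_pM2l.
have ra2 : r * a < r * (eps / 2) by rewrite ltr_pM2l.
have [n1 n2] : r * a <= r * `|a| /\ - (r * a) <= r * `|a|.
  rewrite -mulrN !ler_pM2l //; split; first exact: ler_norm.
  by rewrite -normrN ler_norm.
move=> k; rewrite /hg !hfE; case6 k; rewrite /rt /=; lra.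
Qed.

Lemma integral_tent (c eps : R) : 0 < eps ->
  (\int[mu]_(u in `[(c - eps / 2)%R, (c + eps / 2)%R])
    (2 * (r / 3 * (eps - `|u - c|)))%:E = (eps ^+ 2 * (r / 2))%:E)%E.
Proof.
move=> e0.
have cont : continuous (fun u : R => 2 * (r / 3 * (eps - `|u - c|))).
  move=> u; apply: cvgM; first exact: cvg_cst.
  apply: cvgM; first exact: cvg_cst.
  apply: cvgB; first exact: cvg_cst.
  by apply: cvg_norm; apply: cvgB; [exact: cvg_id|exact: cvg_cst].
pose tent := fun u : R => (2 * (r / 3 * (eps - `|u - c|)))%:E.
have mf D : measurable_fun (D : set R) tent.
  apply: measurable_funTS; apply/measurable_EFinP; exact: continuous_measurable_fun.
have ca : c - eps / 2 < c by lra. have cb : c < c + eps / 2 by lra.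
rewrite (@itv_bndbnd_setU _ _ (BLeft (c - eps / 2)) (BRight c)) ?bnd_simp ?ltW //.
rewrite ge0_integral_setU //=; first last.
- rewrite disj_set2E; apply/eqP/seteqP; split=> // u /=; rewrite !in_itv /= => -[/andP [_ h1] /andP [h2 _]].
  by move: h2; rewrite ltNge h1.
- move=> u hu; have : `|u - c| <= eps / 2.
    by move: hu => [] /=; rewrite in_itv /= ler_norml => /andP [? ?]; apply/andP; split; lra.
  move=> h; rewrite lee_fin; apply: mulr_ge0 => //; apply: mulr_ge0; last by lra.
  by rewrite divr_ge0 // sqrtr_ge0.
- exact: mf.
rewrite integral_itv_obnd_cbnd; last exact: mf.
have -> : (\int[mu]_(u in `[(c - eps / 2)%R, c]) (2 * (r / 3 * (eps - `|u - c|)))%:E =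
    \int[mu]_(u in `[(c - eps / 2)%R, c]) ((2 * r / 3 * (eps - c)) + 2 * r / 3 * u)%:E)%E.
  apply: eq_integral => u /set_mem /=; rewrite in_itv /= => /andP [_ h]; congr _%:E.
  by rewrite ler0_norm ?subr_le0 //; field.
rewrite integral_affine //.
have -> : (\int[mu]_(u in `[c, (c + eps / 2)%R]) (2 * (r / 3 * (eps - `|u - c|)))%:E =
    \int[mu]_(u in `[c, (c + eps / 2)%R]) ((2 * r / 3 * (eps + c)) + (- (2 * r / 3)) * u)%:E)%E.
  apply: eq_integral => u /set_mem /=; rewrite in_itv /= => /andP [h _]; congr _%:E.
  by rewrite ger0_norm ?subr_ge0 //; field.
rewrite integral_affine // -EFinD; congr _%:E.
by field.
Qed.

Local Notation mu2 := (mu \x mu)%E.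

(** By definition the product measure integrates the lengths of the vertical
sections, which form a tent function. *)
Lemma cell_area eps i : 0 < eps -> mu2 (cell eps i) = (eps ^+ 2 * (r / 2))%:E.
Proof.
move=> e0; rewrite -(integral_tent i.1 e0) [RHS]integral_mkcond; apply: eq_integral => u _.
have r0 : 0 < r / 3 by rewrite divr_gt0 // r3_gt0.
rewrite /= /patch; case: ifPn => [/set_mem|/negP hu].
  rewrite /= in_itv /= => hu.
  have hu' : `|u - i.1| <= eps / 2 by rewrite ler_norml; apply/andP; split; lra.
  set h := r / 3 * (eps - `|u - i.1|).
  have h0 : 0 < h by rewrite mulr_gt0 //; lra.
  have -> : xsection (cell eps i) u = [set` `[i.2 - h, i.2 + h]].
    apply/seteqP; split=> v.
      rewrite /xsection /= => /set_mem /(cell_coord _ _ e0) [/= _].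
      by rewrite -/h /= in_itv /= ler_norml => /andP [? ?]; apply/andP; split; lra.
    rewrite /= in_itv /= => /andP [? ?]; rewrite /xsection /=; apply/mem_set/cell_coord => //=.
    by split=> //; rewrite -/h ler_norml; apply/andP; split; lra.
  rewrite lebesgue_measure_itv /= lte_fin ifT; last by lra.
  by rewrite -EFinB; congr _%:E; ring.
have -> : xsection (cell eps i) u = set0; last by rewrite measure0.
apply/seteqP; split=> v //; rewrite /xsection /= => /set_mem /(cell_coord _ _ e0) [/=].
rewrite ler_norml => /andP [? ?] _; apply: hu; apply/mem_set; rewrite /= in_itv /=.
by apply/andP; split; lra.
Qed.

Lemma ocell_area eps i : 0 < eps -> mu2 (ocell eps i) = (eps ^+ 2 * (r / 2))%:E.
Proof.
move=> e0; rewrite -(integral_tent i.1 e0).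
rewrite integral_itv_bndoo; last first.
  apply: measurable_funTS; apply/measurable_EFinP; apply: continuous_measurable_fun.
  move=> u; apply: cvgM; first exact: cvg_cst.
  apply: cvgM; first exact: cvg_cst.
  apply: cvgB; first exact: cvg_cst.
  by apply: cvg_norm; apply: cvgB; [exact: cvg_id|exact: cvg_cst].
rewrite [RHS]integral_mkcond; apply: eq_integral => u _.
have r0 : 0 < r / 3 by rewrite divr_gt0 // r3_gt0.
rewrite /= /patch; case: ifPn => [/set_mem|/negP hu].
  rewrite /= in_itv /= => hu.
  have hu' : `|u - i.1| < eps / 2 by rewrite ltr_norml; apply/andP; split; lra.
  set h := r / 3 * (eps - `|u - i.1|).
  have h0 : 0 < h by rewrite mulr_gt0 //; lra.
  have -> : xsection (ocell eps i) u = [set` `]i.2 - h, i.2 + h[].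
    apply/seteqP; split=> v.
      rewrite /xsection /= => /set_mem /(ocell_coord _ _ e0) [/= _].
      by rewrite -/h /= in_itv /= ltr_norml => /andP [? ?]; apply/andP; split; lra.
    rewrite /= in_itv /= => /andP [? ?]; rewrite /xsection /=; apply/mem_set/ocell_coord => //=.
    by split=> //; rewrite -/h ltr_norml; apply/andP; split; lra.
  rewrite lebesgue_measure_itv /= lte_fin ifT; last by lra.
  by rewrite -EFinB; congr _%:E; ring.
have -> : xsection (ocell eps i) u = set0; last by rewrite measure0.
apply/seteqP; split=> v //; rewrite /xsection /= => /set_mem /(ocell_coord _ _ e0) [/=].
rewrite ltr_norml => /andP [? ?] _; apply: hu; apply/mem_set; rewrite /= in_itv /=.
by apply/andP; split; lra.
Qed.

Lemma measurable_hg k i : measurable_fun setT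
  (fun x : measurableTypeR R * measurableTypeR R => hg k ((x : plane R) - i)).
Proof.
have -> : (fun x : measurableTypeR R * measurableTypeR R => hg k ((x : plane R) - i)) =
   (fun x : measurableTypeR R * measurableTypeR R => x.1 * ((hexc R k).1 + (hexc R (rt 1 k)).1) +
      x.2 * ((hexc R k).2 + (hexc R (rt 1 k)).2) - hg k i).
  by apply/funext => x; rewrite hgB {1}/hg !hfE; ring.
apply: measurable_funB; last exact: measurable_cst.
apply: measurable_funD; apply: measurable_funM; try exact: measurable_cst.
  exact: measurable_fst.
exact: measurable_snd.
Qed.

Lemma measurable_cell eps i : 0 < eps ->
  measurable (cell eps i : set (measurableTypeR R * measurableTypeR R)).
Proof.
move=> e0.
have -> : cell eps i = \bigcap_k [set x | hg k (x - i) <= eps * (r / 2)].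
  apply/seteqP; split=> x; first by move=> /(cellP _ _ e0) h k _; exact: h.
  by move=> h; apply/cellP => // k; exact: (h k I).
apply: fin_bigcap_measurable => // k _.
have := measurable_fun_ler (measurable_hg k i) (measurable_cst (eps * (r / 2))).
by move=> /(_ measurableT [set true] I); rewrite setTI.
Qed.

Lemma measurable_ocell eps i :
  measurable (ocell eps i : set (measurableTypeR R * measurableTypeR R)).
Proof.
have -> : ocell eps i = \bigcap_k [set x | hg k (x - i) < eps * (r / 2)].
  apply/seteqP; split=> x; first by move=> h k _; exact: h.
  by move=> h k; exact: (h k I).
apply: fin_bigcap_measurable => // k _.
have := measurable_fun_ltr (measurable_hg k i) (measurable_cst (eps * (r / 2))).
by move=> /(_ measurableT [set true] I); rewrite setTI.
Qed.

End CellArea.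

(** * Bounds for the dissipation integral *)

Section Dissipation.
Variable R : realType.
Implicit Types (z : int * int) (eps : R) (I J : set (int * int)).
Local Notation r := (Num.sqrt 3 : R).
Local Notation mu2 := (@lebesgue_measure R \x @lebesgue_measure R)%E.

Section Mono.
Local Open Scope ereal_scope.
Context d (T : measurableType d) (mu : {measure set T -> \bar R}).

(** Monotonicity for arbitrary nonnegative functions: the integral is a
supremum over simple functions below the integrand, so that the measurability
of [discrete_dist] never has to be established. *)
Lemma ge0_integral_mono (D D' : set T) (f g : T -> \bar R) :
  (forall x, D x -> 0 <= f x) -> (forall x, D' x -> 0 <= g x) ->
  (forall x, D x -> D' x /\ f x <= g x) ->
  \int[mu]_(x in D) f x <= \int[mu]_(x in D') g x.
Proof.
move=> f0 g0 fg; rewrite !ge0_integralE //; apply: le_ereal_sup => _ [h hf <-].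
exists h => // x; apply: le_trans (hf x) _; rewrite /patch.
case: ifPn => [/set_mem /fg [D'x fgx]|_]; first by rewrite mem_set.
by case: ifPn => // /set_mem; exact: g0.
Qed.

Lemma integral_step (S : seq (int * int)) (A : int * int -> set T) (w : int * int -> R) (a : R) :
  (forall z, measurable (A z)) -> (forall z, mu (A z) = a%:E) -> (forall z, 0 <= w z)%R ->
  \int[mu]_x (\sum_(z <- S) w z * \1_(A z) x)%R%:E = ((\sum_(z <- S) w z) * a)%R%:E.
Proof.
move=> mA muA w0.
under eq_integral do rewrite -sumEFin.
rewrite ge0_integral_sum //; last 2 first.
- move=> z; apply/measurable_EFinP; apply: measurable_funM; first exact: measurable_cst.
  exact: measurable_indic.
- by move=> z x _; rewrite lee_fin mulr_ge0.
rewrite mulr_suml -sumEFin; apply: eq_bigr => z _.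
under eq_integral do rewrite EFinM.
rewrite ge0_integralZl_EFin //.
  by rewrite integral_indic // setIT muA.
by apply/measurable_EFinP; exact: measurable_indic.
Qed.
End Mono.

Lemma latu_abs j k : `|latf j (latu k)| <= 1.
Proof. by case6 j; case6 k. Qed.

Lemma phi_ge (x : plane R) k : r / 2 * `|hf k x| <= phi_hex_dual x.
Proof.
rewrite /phi_hex_dual ler_wpM2l ?divr_ge0 ?sqrtr_ge0 //.
by case6 k; rewrite /hf /hexn /= /inner /= ?mulrN -?opprD ?normrN !le_max lexx ?orbT.
Qed.

Lemma phi_le (x : plane R) (m : R) : (forall k, `|hf k x| <= m) -> phi_hex_dual x <= r / 2 * m.
Proof.
move=> h; rewrite /phi_hex_dual ler_wpM2l ?divr_ge0 ?sqrtr_ge0 // !ge_max.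
have := h (Ordinal (isT : 0 < 6)%N); have := h (Ordinal (isT : 1 < 6)%N).
by have := h (Ordinal (isT : 5 < 6)%N); rewrite /hf /hexn /= => -> -> ->.
Qed.

Lemma phi_ge0 (x : plane R) : 0 <= phi_hex_dual x.
Proof. by apply: le_trans (phi_ge x ord0); rewrite mulr_ge0 ?divr_ge0 ?sqrtr_ge0. Qed.

(** One lattice step is [3 / 4 * eps] in the dual norm: a factor
[sqrt 3 / 2] comes from the norm and another one from the spacing of the
lattice lines. *)
Lemma phi_lat_ge eps z k n : 0 < eps -> n%:Z <= `|latf k z| ->
  3 / 4 * eps * n%:R <= phi_hex_dual (lat eps z).
Proof.
move=> e0 h; apply: le_trans (phi_ge _ k); rewrite hf_lat normrM ger0_norm; last first.
  by rewrite mulr_ge0 ?(ltW e0) // divr_ge0 ?sqrtr_ge0.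
have -> : r / 2 * (eps * (r / 2) * `|(latf k z)%:~R|) = r * r / 4 * eps * `|(latf k z)%:~R|.
  by field.
rewrite (r3_sqr R) ler_wpM2l //; first by rewrite mulr_ge0 ?(ltW e0) // divr_ge0.
by rewrite -intr_norm -[n%:R]/(n%:Z%:~R) ler_int.
Qed.

Lemma phi_lat_le eps z n : 0 < eps -> (forall k, `|latf k z| <= n%:Z) ->
  phi_hex_dual (lat eps z) <= 3 / 4 * eps * n%:R.
Proof.
move=> e0 h; apply: le_trans (phi_le (m := eps * (r / 2) * n%:R) _) _ => [k|].
  rewrite hf_lat normrM ger0_norm; last first.
    by rewrite mulr_ge0 ?(ltW e0) // divr_ge0 ?sqrtr_ge0.
  rewrite ler_wpM2l //; first by rewrite mulr_ge0 ?(ltW e0) // divr_ge0 ?sqrtr_ge0.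
  by rewrite -intr_norm -[n%:R]/(n%:Z%:~R) ler_int.
have -> : r / 2 * (eps * (r / 2) * n%:R) = r * r / 4 * eps * n%:R by field.
by rewrite (r3_sqr R).
Qed.

Lemma discrete_dist_ge0 eps (F : set (plane R)) x : (0 <= discrete_dist eps F x)%E.
Proof.
by rewrite /discrete_dist; case: ifP => _; apply: le_ereal_inf_tmp => _ [ij _ <-];
  rewrite lee_fin phi_ge0.
Qed.

Variables (s : 'I_6 -> int) (eps : R).
Hypothesis e0 : 0 < eps.
Let F := cells eps [set z | inhex s z].

(** The discrete distance from the cell of [z] to the frontier in lattice
steps, exactly for cells inside the hexagon and from below for the others. *)
Definition layer z : nat := if inhex s z then mindepth s z else 1%N.

Lemma layer_dist z w : inhex s z -> ~~ inhex s w ->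
  exists k, (depth s k z)%:Z <= `|latf k (z - w)|.
Proof.
move=> zs; rewrite /inhex negb_forall => /existsP [j jw].
exists j; rewrite depthE //; have := latfD j (z - w) w; rewrite subrK => e.
by move/forallP: zs => /(_ j); lia.
Qed.

(** Leaving the hexagon from [z] takes at least as many steps as there are
layers between [z] and the side that is crossed; entering it takes at least
one step. *)
Lemma discrete_dist_ge z x : ocell eps (lat eps z) x ->
  ((3 / 4 * eps * (layer z)%:R)%:E <= discrete_dist eps F x)%E.
Proof.
move=> hx; rewrite /discrete_dist /layer.
have inF : F x <-> inhex s z := ocell_cells [set z | inhex s z] e0 hx.
case: ifPn => zs.
  rewrite (mem_set (inF.2 zs)).
  apply: le_ereal_inf_tmp => _ [[i j] [/= /latP [z' ->] /latP [w ->] zx wF] <-].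
  rewrite -(ocell_unique e0 hx zx).
  have ws : ~~ inhex s w by apply/negP => ws; apply: wF; exact/cell_subP.
  have [k hk] := layer_dist zs ws.
  rewrite lee_fin latB; apply: (phi_lat_ge (k := k)) => //.
  by apply: le_trans hk; rewrite lez_nat; exact: mindepth_le.
have nF : ~ F x by move=> /inF h; rewrite h in zs.
rewrite (memNset nF); apply: le_ereal_inf_tmp => _ [[i j] [/= /latP [z' ->] /latP [w ->] zx /(cell_subP _ _ e0) /= ws] <-].
rewrite -(ocell_unique e0 hx zx) lee_fin latB.
have : z - w != 0 by rewrite subr_eq0; apply: contraNneq zs => ->.
move=> zw; have [k hk] : exists k, latf k (z - w) != 0.
  apply/existsP; apply: contraNT zw => /existsPn h; apply/eqP.
  by apply: (@latf_inj ord0); [have := h ord0|have := h (rt 1 ord0)];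
    rewrite negbK => /eqP -> ; rewrite /latf /rt.
by apply: (phi_lat_ge (k := k)) => //; lia.
Qed.

(** Walking from [z] straight out through side [k] takes [depth s k z] steps in
the direction [latu (rt 5 k)], along which no height grows faster. *)
Lemma discrete_dist_le z x : cell eps (lat eps z) x -> inhex s z ->
  (discrete_dist eps F x <= (3 / 4 * eps * (mindepth s z)%:R)%:E)%E.
Proof.
move=> hx zs; rewrite /discrete_dist mem_set; last exact: (cell_sub _ hx).
set D := ereal_inf _.
have key k : (D <= (3 / 4 * eps * (depth s k z)%:R)%:E)%E.
  pose n := depth s k z; pose w : int * int := ((latu (rt 5 k)).1 * n%:Z, (latu (rt 5 k)).2 * n%:Z).
  have wE j : latf j w = latf j (latu (rt 5 k)) * n%:Z by rewrite /latf; case6 j => /=; ring.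
  have wk : latf k w = n%:Z.
    by rewrite wE; have := latf_u1 (rt 5 k); rewrite rtD rt60 => ->; rewrite mul1r.
  apply: ge_ereal_inf; exists (phi_hex_dual (lat eps z - lat eps (z + w)))%:E.
    exists (lat eps z, lat eps (z + w)) => //=; split=> //.
    - by apply/latP; exists z.
    - by apply/latP; eexists.
    - move=> /(cell_subP _ _ e0) /= /forallP /(_ k); rewrite latfD wk /n depthE //; lia.
  rewrite lee_fin latB opprD addrA subrr add0r; apply: phi_lat_le => // j.
  have -> : latf j (- w) = - latf j w by case: w {wE wk} => a b; case6 j; rewrite /latf /=; lia.
  rewrite wE; have := latu_abs j (rt 5 k).
  by move: (latf j _) => t; rewrite -/n; nia.
rewrite /mindepth; elim/big_ind : _ => // a b ha hb; rewrite /minn; by case: ifP.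
Qed.

(** The interiors of the cells of [S] are disjoint and contained in the
symmetric difference. *)
Lemma dissipation_ge I (S : seq (int * int)) : uniq S ->
  (forall z, z \in S -> (I z /\ ~~ inhex s z) \/ (~ I z /\ inhex s z)) ->
  ((3 / 4 * eps * (eps ^+ 2 * (r / 2)) * (\sum_(z <- S) layer z)%:R)%:E <=
   \int[mu2]_(x in cells eps I `+` F) discrete_dist eps F x)%E.
Proof.
move=> uS hS.
have <- : (\int[mu2]_x (\sum_(z <- S) (3 / 4 * eps * (layer z)%:R) * \1_(ocell eps (lat eps z)) x)%R%:E
   = (3 / 4 * eps * (eps ^+ 2 * (r / 2)) * (\sum_(z <- S) layer z)%:R)%:E)%E.
  rewrite (@integral_step _ _ _ S _ _ (eps ^+ 2 * (r / 2))).
  - by rewrite -mulr_sumr -natr_sum; congr _%:E; ring.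
  - by move=> z; exact: measurable_ocell.
  - by move=> z; exact: ocell_area.
  - by move=> z; rewrite !mulr_ge0 ?(ltW e0) // divr_ge0.
pose U := [set x | exists2 z, z \in S & ocell eps (lat eps z) x].
have -> : (\int[mu2]_x (\sum_(z <- S) (3 / 4 * eps * (layer z)%:R) * \1_(ocell eps (lat eps z)) x)%R%:E
   = \int[mu2]_(x in U) (\sum_(z <- S) (3 / 4 * eps * (layer z)%:R) * \1_(ocell eps (lat eps z)) x)%R%:E)%E.
  rewrite [RHS]integral_mkcond; apply: eq_integral => x _; rewrite /patch.
  case: ifPn => // /negP hx; rewrite big_seq big1 // => z zS.
  rewrite indicE memNset ?mulr0 // => zx; apply: hx; apply/mem_set; by exists z.
apply: ge0_integral_mono => [x _|x _|x [z zS zx]]; last split.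
- by rewrite lee_fin sumr_ge0 // => z _; rewrite !mulr_ge0 ?(ltW e0) // divr_ge0.
- exact: discrete_dist_ge0.
- case: (hS z zS) => -[h1 h2]; [left|right]; split.
  + exact/(ocell_cells _ e0 zx).
  + by move=> /(ocell_cells _ e0 zx) /= h; rewrite h in h2.
  + exact/(ocell_cells _ e0 zx).
  + by move=> /(ocell_cells _ e0 zx).
- rewrite (big_rem z) //= big_seq big1 => [|w wS].
    by rewrite addr0 indicE mem_set // mulr1; exact: discrete_dist_ge.
  rewrite indicE memNset ?mulr0 // => wx.
  have e := ocell_unique e0 zx (ocell_cell e0 wx).
  by move: wS; rewrite -e mem_rem_uniq // inE eqxx.
Qed.

(** The cells of [S] cover the symmetric difference. *)
Lemma dissipation_le (I : {fset int * int}) (S : seq (int * int)) :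
  (forall z, z \in I -> inhex s z) ->
  (forall z, inhex s z -> z \notin I -> z \in S) ->
  (\int[mu2]_(x in cells eps [set` I] `+` F) discrete_dist eps F x <=
   (3 / 4 * eps * (eps ^+ 2 * (r / 2)) * (\sum_(z <- S) layer z)%:R)%:E)%E.
Proof.
move=> hI hS.
have <- : (\int[mu2]_x (\sum_(z <- S) (3 / 4 * eps * (layer z)%:R) * \1_(cell eps (lat eps z)) x)%R%:E
   = (3 / 4 * eps * (eps ^+ 2 * (r / 2)) * (\sum_(z <- S) layer z)%:R)%:E)%E.
  rewrite (@integral_step _ _ _ S _ _ (eps ^+ 2 * (r / 2))).
  - by rewrite -mulr_sumr -natr_sum; congr _%:E; ring.
  - by move=> z; exact: measurable_cell.
  - by move=> z; exact: cell_area.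
  - by move=> z; rewrite !mulr_ge0 ?(ltW e0) // divr_ge0.
have w0 x z : 0 <= 3 / 4 * eps * (layer z)%:R * \1_(cell eps (lat eps z)) x.
  by rewrite !mulr_ge0 ?(ltW e0) // divr_ge0.
apply: ge0_integral_mono => [x _|x _|x hx]; last split=> //.
- exact: discrete_dist_ge0.
- by rewrite lee_fin sumr_ge0.
have [z zx [zs zI]] : exists2 z, cell eps (lat eps z) x & inhex s z /\ z \notin I.
  case: hx => -[/cellsP [z zI zx] nx].
    by case: nx; apply: (cell_sub _ zx); exact: hI.
  by exists z => //; split=> //; apply/negP => h; apply: nx; exact: (cell_sub _ zx).
apply: le_trans (discrete_dist_le zx zs) _; rewrite lee_fin (big_rem z) ?hS //=.
rewrite indicE mem_set // mulr1 {1}/layer zs lerDl; apply: sumr_ge0 => w _; exact: w0.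
Qed.

End Dissipation.

(** * One minimising movement step *)

Section MinimizerStep.
Variable R : realType.
Local Notation r := (Num.sqrt 3 : R).
Variables (gamma eps : R) (s : 'I_6 -> int).
Hypotheses (g0 : 0 < gamma) (e0 : 0 < eps).

(** The ratio of the dissipation of one cell at distance one, which is
[1 / tau] times [3 / 4 * eps] times the area [sqrt 3 / 2 * eps ^ 2], to the
length [sqrt 3 / 3 * eps] of an edge, for [tau = g * e]. *)
Definition dissipation_coef (g e : R) : R := 9 * e / (8 * g).

Let F : set (plane R) := cells eps [set z | inhex s z].
Let c := dissipation_coef gamma eps.
Let u : R := r / 3 * eps.
Let a : R := 3 / 4 * eps * (eps ^+ 2 * (r / 2)).

Let u0 : 0 < u. Proof. by rewrite mulr_gt0 // divr_gt0 // r3_gt0. Qed.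
Let a0 : 0 < a.
Proof. by rewrite !mulr_gt0 ?exprn_gt0 ?divr_gt0 // r3_gt0. Qed.

Let c0 : 0 < c. Proof. by rewrite /c /dissipation_coef divr_gt0 ?mulr_gt0. Qed.

Let ac : 1 / (gamma * eps) * a = u * c.
Proof. by rewrite /a /u /c /dissipation_coef; field; rewrite !gt_eqF. Qed.

Let tau0 : 0 <= 1 / (gamma * eps).
Proof. by rewrite divr_ge0 // mulr_ge0 ?ltW. Qed.

Lemma card_fsetD_sum (I J : {fset int * int}) :
  (\sum_(z <- I | z \notin J) 1 = #|` (I `\` J)%fset|)%N.
Proof.
rewrite card_fset_sum1 big_fset_condE; congr (\sum_(i <- enum_fset _) _)%N.
by apply/fsetP => z; rewrite !inE andbC.
Qed.

Lemma energy_ge (I : {fset int * int}) :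
  ((u * latenergy c s I)%:E <= energy (gamma * eps) eps (cells eps [set` I]) F)%E.
Proof.
rewrite /energy perimeter_cells // /latenergy mulrDr EFinD leeD2l //.
set S := [seq z <- hexset s | z \notin I] ++ [seq z <- I | z \notin hexset s].
have uS : uniq S.
  rewrite cat_uniq !filter_uniq ?fset_uniq //= andbT; apply/hasPn => z.
  by rewrite !mem_filter => /andP [h _]; rewrite (negbTE h) andbF.
have hS z : z \in S -> ([set` I] z /\ ~~ inhex s z) \/ (~ [set` I] z /\ inhex s z).
  rewrite mem_cat !mem_filter !in_hexset /= => /orP [/andP [/negP h1 h2]|/andP [h1 h2]].
    by right.
  by left.
have h := dissipation_ge e0 uS hS.
have tt : (0 <= (1 / (gamma * eps))%:E)%E by rewrite lee_fin.
apply: le_trans (lee_wpmul2l tt h); rewrite -EFinM lee_fin [leRHS]mulrA.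
rewrite -/a ac -[leRHS]mulrA (ler_pM2l u0) (ler_pM2l c0) ler_nat.
rewrite /S big_cat /= !big_filter -card_fsetD_sum leq_add //.
  rewrite [leqLHS]big_seq_cond [leqRHS]big_seq_cond; apply: leq_sum => z /andP [].
  by rewrite in_hexset /layer => ->.
by apply: leq_sum => z; rewrite in_hexset /layer => /negbTE ->.
Qed.

Lemma energy_le (I : {fset int * int}) : {subset I <= hexset s} ->
  (energy (gamma * eps) eps (cells eps [set` I]) F <= (u * latenergy c s I)%:E)%E.
Proof.
move=> IJ; rewrite /energy perimeter_cells // /latenergy mulrDr EFinD leeD2l //.
have hI z : z \in I -> inhex s z by move=> /IJ; rewrite in_hexset.
set S := [seq z <- hexset s | z \notin I].
have hS z : inhex s z -> z \notin I -> z \in S.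
  by move=> h1 h2; rewrite mem_filter h2 in_hexset.
have h := dissipation_le e0 hI hS.
have tt : (0 <= (1 / (gamma * eps))%:E)%E by rewrite lee_fin.
apply: le_trans (lee_wpmul2l tt h) _; rewrite -EFinM lee_fin [leLHS]mulrA.
rewrite -/a ac -[leLHS]mulrA (ler_pM2l u0) (ler_pM2l c0) ler_nat.
rewrite /S big_filter; apply: leq_trans (leq_addr _ _).
rewrite [leqLHS]big_seq_cond [leqRHS]big_seq_cond; apply: leq_sum => z /andP [].
by rewrite in_hexset /layer => ->.
Qed.

(** Infinitely many added cells at distance at least one make the dissipation
infinite; so minimisers are finite unions of cells. *)
Lemma finite_energy (I : set (int * int)) (M : R) :
  (energy (gamma * eps) eps (cells eps I) F <= M%:E)%E -> finite_set I.
Proof.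
move=> hM; apply: contrapT => infI.
have infD : infinite_set (I `\` [set z | inhex s z]).
  by apply: infinite_setD infI _; exact: finite_inhex.
pose b := 1 / (gamma * eps) * a.
have b0 : 0 < b by rewrite /b ac mulr_gt0.
have [S SI nS] := infinite_set_fset (Num.truncn (M / b)).+1 infD.
have hS z : z \in S -> (I z /\ ~~ inhex s z) \/ (~ I z /\ inhex s z).
  by move=> /SI [Iz /negP h]; left.
have h := dissipation_ge e0 (fset_uniq S) hS.
have tt : (0 <= (1 / (gamma * eps))%:E)%E by rewrite lee_fin.
have : (M%:E < energy (gamma * eps) eps (cells eps I) F)%E.
  apply: lt_le_trans (leeDr _ (perimeter_ge0 _ e0)).
  apply: lt_le_trans (lee_wpmul2l tt h).
  rewrite -EFinM lte_fin [ltRHS]mulrA -/a -/b.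
  have : M / b < (Num.truncn (M / b)).+1%:R.
    have [M0|M0] := leP 0 (M / b); first by case/andP: (truncn_itv M0).
    by apply: lt_trans M0 _; rewrite ltr0n.
  rewrite ltr_pdivrMr // => h2; apply: lt_le_trans h2 _; rewrite [leLHS]mulrC (ler_pM2l b0) ler_nat.
  apply: leq_trans nS _; rewrite card_fset_sum1 [leqLHS]big_seq [leqRHS]big_seq.
  apply: leq_sum => z /hS; rewrite /layer => -[[_ /negbTE -> //]|[_ zs]].
  by rewrite zs; apply: le_mindepth => k; exact: depth_gt0.
by rewrite ltNge hM.
Qed.

(** The lower bound for the energy holds for all finite sets and is attained on
subsets of the old hexagon, in particular on the competitors used above. *)
Lemma minimizer_step (N : nat) (eta : R) (E : set (plane R)) :
  2 * (c * (slack N)%:R) <= 1 -> c * (slack N)%:R <= eta ->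
  (forall k, 2 + eta <= c * (latlen s k)%:~R * N.+1%:R) ->
  (forall k, c * (latlen s k)%:~R * N.-1%:R <= 2 - eta) ->
  is_minimizer (gamma * eps) eps F E ->
  exists n : 'I_6 -> nat,
    [/\ forall k, n k = N \/ n k = N.-1,
        forall k, c * (latlen s k)%:~R * N%:R <= 2 - c * (slack N)%:R -> n k = N &
        E = cells eps [set z | inhex (fun k => s k - (n k)%:Z) z]].
Proof.
move=> h1 h2 h3 h4 [/admissibleP [I ->] minE].
have setE (A : {fset int * int}) : (energy (gamma * eps) eps (cells eps I) F <=
   energy (gamma * eps) eps (cells eps [set` A]) F)%E by apply/minE/admissible_cells.
have finI : finite_set I.
  by apply: finite_energy (le_trans (setE (hexset s)) (energy_le _)).
have IE : I = [set` fset_set I] by rewrite fset_setK.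
have [|n [n1 n2 n3]] := @latenergy_minimizer R s N c eta c0 h1 h2 h3 h4 (fset_set I).
  move=> I' I'J; rewrite -(ler_pM2l u0) -lee_fin.
  apply: le_trans (energy_ge _) _; rewrite -IE.
  exact: le_trans (setE I') (energy_le I'J).
exists n; split => //; rewrite IE n3; congr cells.
by apply/seteqP; split=> z /=; rewrite in_hexset.
Qed.

End MinimizerStep.

(** * Monotonicity of absolutely continuous functions *)

Section AbsoluteContinuity.
Variable R : realType.
Implicit Types (f g : R -> R) (t x y : R).
Local Notation mu := (@lebesgue_measure R).

Lemma is_derive_local f t df (e : R) : is_derive t (1 : R) f df -> 0 < e ->
  exists2 d : R, 0 < d & forall h, `|h| < d -> `|f (t + h) - f t - df * h| <= e * `|h|.
Proof.
move=> [/derivableP dv <-] e0.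
have := @ex_derive _ _ _ _ _ _ _ dv => /cvgrPdist_le /(_ e e0).
rewrite near_withinE => /nbhs_ballP [d /= d0 hd]; exists d => // h hd'.
have [->|h0] := eqVneq h 0; first by rewrite addr0 subrr mulr0 subr0 normr0 mulr0.
have /hd : ball 0 d h by rewrite /ball /= sub0r normrN.
move=> /(_ h0); rewrite -[_ *: 1]/(h * 1) mulr1 [h + t]addrC => hh.
rewrite -ler_pdivrMr ?normr_gt0 // -normf_div.
apply: le_trans hh; rewrite le_eqVlt; apply/orP; left; apply/eqP.
have -> : (f (t + h) - f t - 'D_1 f t * h) / h = h^-1 * (f (t + h) - f t) - 'D_1 f t by field.
by rewrite -[_ *: _]/(h^-1 * (f (t + h) - f t)) distrC.
Qed.

Lemma abs_cont_seq f (b e : R) : abs_continuous 0 b f -> 0 < e ->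
  exists2 d : R, 0 < d & forall l : seq (R * R),
    {in l, forall p, [/\ 0 <= p.1, p.1 <= p.2 & p.2 <= b]} ->
    pairwise (fun p q => q.2 <= p.1) l ->
    \sum_(p <- l) (p.2 - p.1) < d -> \sum_(p <- l) `|f p.2 - f p.1| < e.
Proof.
move=> ac e0; have [d d0 hd] := ac e e0; exists d => // l hl pl sl.
pose p k := nth (0, 0) l k.
have pin (k : 'I_(size l)) : p k \in l by exact: mem_nth.
have sumE (F : R * R -> R) : \sum_(p <- l) F p = \sum_(k < size l) F (p k).
  by rewrite (big_nth (0, 0)) big_mkord.
rewrite sumE; apply: (hd _ (fun k => (p k).1) (fun k => (p k).2)).
- by move=> k; exact: hl.
- have /(pairwiseP (0, 0)) pw := pl.
  move=> k j; rewrite neq_ltn => /orP [kj|kj].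
    by right; apply: pw => //; exact: ltn_ord.
  by left; apply: pw => //; exact: ltn_ord.
- by rewrite -(sumE (fun p => p.2 - p.1)).
Qed.

(** Cover the exceptional null set by an open set [U] of measure less than [d].
Going through the interval from left to right, outside [U] the derivative
bounds the growth of [f] by [K + e] per unit of time for a while; inside [U]
the interval travelled is recorded together with the variation of [f] on it.
The recorded intervals are disjoint and of total length less than [d], so absolute
continuity bounds the variation of [f] on them by [e].  The supremum of the
times that can be reached is the end of the interval. *)
Lemma ac_le (b K : R) f g : 0 <= b -> abs_continuous 0 b f ->
  {ae mu, forall t, 0 <= t < b -> is_derive t (1 : R) f (g t)} ->
  (forall t, 0 <= t < b -> g t <= K) -> f b - f 0 <= K * b.
Proof.
move=> b0 ac [N [mN N0 hN]] gK.
have b1 : 0 < b + 1 by lra.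
suff key e : 0 < e -> f b - f 0 <= (K + e) * b + 2 * e.
  rewrite leNgt; apply/negP => lt.
  pose e := (f b - f 0 - K * b) / (2 * (b + 2)).
  have e0 : 0 < e by apply: divr_gt0; lra.
  have := key e e0; have : e * (2 * (b + 2)) = f b - f 0 - K * b.
    by rewrite /e; field; lra.
  by lra.
move=> e0; have [d1 d10 hd] := abs_cont_seq ac e0.
pose C := `|K + e|; have C0 : 0 <= C by exact: normr_ge0.
pose d := Num.min d1 (e / (C + 1)).
have d0 : 0 < d by rewrite lt_min d10 divr_gt0 //; lra.
have dd1 : d <= d1 by rewrite ge_min lexx.
have dC : C * d <= e.
  have : d <= e / (C + 1) by rewrite ge_min lexx orbT.
  by rewrite ler_pdivlMr; lra.
(* The end point is added to the null set because no derivative is known there. *)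
pose N' := N `|` [set b].
have mN' : measurable N' by exact: measurableU.
have N'0 : mu N' = 0.
  apply/eqP; rewrite -measure_le0; apply: le_trans (measureU2 _ _ _) _ => //.
  by rewrite [X in (X + _)%E]N0 [X in (_ + X)%E](lebesgue_measure_set1 b) adde0.
have N'f : (mu N' < +oo)%E by rewrite N'0 ltry.
have [U [oU NU mU]] := lebesgue_regularity_outer mN' N'f d0.
have mUm : measurable (U : set (measurableTypeR R)) by exact: open_measurable.
have {}mU : (mu U < d%:E)%E.
  have -> : U = N' `|` (U `\` N') by rewrite setDUK.
  apply: le_lt_trans (measureU2 _ _ _) _ => //; first exact: measurableD.
  by rewrite [X in (X + _)%E]N'0 add0e.
(* [good x] says that [x] can be reached, [l] being the list of the recorded
intervals, the last one first. *)
pose good x := exists l : seq (R * R),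
  [/\ {in l, forall p, [/\ 0 <= p.1, p.1 <= p.2 & p.2 <= x]},
      pairwise (fun p q => q.2 <= p.1) l,
      ((\sum_(p <- l) (p.2 - p.1))%:E <= mu (U `&` `[0%R, x[))%E &
      f x - f 0 <= (K + e) * x + \sum_(p <- l) (`|f p.2 - f p.1| + C * (p.2 - p.1))].
have mUi x : measurable (U `&` `[0%R, x[ : set (measurableTypeR R)) by exact: measurableI.
have step_slope x y : x <= y -> f y - f x <= (K + e) * (y - x) -> good x -> good y.
  move=> xy fxy [l [h1 h2 h3 h4]]; exists l; split=> //.
  - by move=> p /h1 [? ? ?]; split=> //; lra.
  - apply: le_trans h3 _; apply: le_measure; [exact: mem_set (mUi x)|exact: mem_set (mUi y)|].
    by apply: setIS => u /=; rewrite !in_itv /= => /andP [-> ?]; exact: lt_le_trans xy.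
  - by lra.
have step_U x y : 0 <= x -> x <= y -> `[x, y[ `<=` U -> good x -> good y.
  move=> x0 xy sU [l [h1 h2 h3 h4]]; exists ((x, y) :: l); split=> /=.
  - move=> p; rewrite inE => /orP [/eqP -> //=|/h1 [? ? ?]]; split=> //; lra.
  - by rewrite h2 andbT; apply/allP => p /h1 [].
  - rewrite big_cons /= EFinD addeC.
    have -> : U `&` `[0, y[ = (U `&` `[0, x[) `|` `[x, y[.
      apply/seteqP; split=> u /=; rewrite !in_itv /=.
        by move=> [Uu /andP [u0 uy]]; case: (ltP u x) => ux; [left|right]; rewrite ?ux ?u0 ?uy.
      move=> [[Uu /andP [u0 ux]]|/andP [xu uy]].
        by split=> //; rewrite u0 (lt_le_trans ux).
      by split; [apply: sU; rewrite /= in_itv /= xu|rewrite uy andbT (le_trans x0)].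
    have disj : (U `&` `[0, x[) `&` `[x, y[ = set0.
      apply/seteqP; split=> u //=; rewrite !in_itv /= => -[[_ /andP [_ ux]] /andP [xu _]].
      by move: ux; rewrite ltNge xu.
    have -> : mu ((U `&` `[0, x[) `|` `[x, y[) = (mu (U `&` `[0%R, x[) + mu `[x, y[)%E.
      have mI : measurable (`[x, y[ : set (measurableTypeR R)) by exact: measurable_itv.
      exact: (measureU mu (mUi x) mI disj).
    have ixy : mu `[x, y[ = (y - x)%:E.
      rewrite lebesgue_measure_itv /= lte_fin; case: ltP => [_|yx]; first by rewrite EFinB.
      have -> : y = x by lra. by rewrite subrr.
    by rewrite ixy leeD2r.
  - rewrite big_cons /=; have := ler_norm (f y - f x).
    have : - (K + e) * (y - x) <= C * (y - x).
      by rewrite ler_wpM2r //; [lra|rewrite /C -normrN ler_norm].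
    by lra.
have loc t : 0 <= t <= b -> exists2 rho : R, 0 < rho &
    (forall x, 0 <= x -> t - rho < x <= t -> good x -> good t) /\
    (forall y, t <= y < t + rho -> good t -> good y).
  move=> /andP [t0 tb]; have [tU|tU] := pselect (U t).
    have /nbhs_ballP [rho /= rho0 hrho] : nbhs t U by exact: open_nbhs_nbhs.
    exists rho => //; split.
      move=> x x0 /andP [xt1 xt2]; apply: step_U => // u /=; rewrite in_itv /= => /andP [? ?].
      by apply: hrho; rewrite /ball /= ltr_norml; apply/andP; split; lra.
    move=> y /andP [ty1 ty2]; apply: step_U => // u /=; rewrite in_itv /= => /andP [? ?].
    by apply: hrho; rewrite /ball /= ltr_norml; apply/andP; split; lra.
  have tb' : t < b.
    by rewrite lt_neqAle tb andbT; apply/eqP => e1; apply: tU; apply: NU; right.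
  have t0b : 0 <= t < b by rewrite t0.
  have dt : is_derive t (1 : R) f (g t).
    by apply: contrapT => nd; apply: tU; apply: NU; left; apply: hN => /= /(_ t0b).
  have [rho rho0 hrho] := is_derive_local dt e0.
  exists rho => //; split.
    move=> x x0 /andP [xt1 xt2]; apply: step_slope => //.
    have /hrho : `|x - t| < rho by rewrite ltr_norml; apply/andP; split; lra.
    have -> : t + (x - t) = x by ring.
    rewrite (ler0_norm (_ : x - t <= 0)); last by lra.
    rewrite ler_norml => /andP [h1 h2].
    have : g t * (t - x) <= K * (t - x) by rewrite ler_wpM2r ?gK //; lra.
    by lra.
  move=> y /andP [ty1 ty2]; apply: step_slope => //.
  have /hrho : `|y - t| < rho by rewrite ltr_norml; apply/andP; split; lra.
  have -> : t + (y - t) = y by ring.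
  rewrite (ger0_norm (_ : 0 <= y - t)); last by lra.
  rewrite ler_norml => /andP [h1 h2].
  have : g t * (y - t) <= K * (y - t) by rewrite ler_wpM2r ?gK //; lra.
  by lra.
pose S := [set x | 0 <= x <= b /\ good x].
have S0 : S 0.
  split; first by rewrite lexx.
  by exists [::]; split=> //; rewrite big_nil ?mulr0 ?addr0 ?subrr // measure_ge0.
have ubS : has_ubound S by exists b => x [/andP []].
have hS : has_sup S by split; [exists 0|].
pose t := sup S.
have tb : 0 <= t <= b.
  apply/andP; split; first exact: ub_le_sup.
  by apply: ge_sup; [exists 0|move=> x [/andP []]].
have [rho rho0 [hl hr]] := loc t tb.
have gt : good t.
  have [x [/andP [x0 xb] gx] tx] := sup_adherent rho0 hS.
  by apply: (hl x) => //; rewrite tx /=; apply: ub_le_sup => //; split=> //; rewrite x0.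
have te : t = b.
  apply/eqP; rewrite eq_le; case/andP: (tb) => t0 -> /=; rewrite leNgt; apply/negP => tltb.
  pose y := Num.min (t + rho / 2) b.
  have yb : y <= b by rewrite ge_min lexx orbT.
  have yr : y <= t + rho / 2 by rewrite ge_min lexx.
  have ty : t < y by rewrite lt_min tltb andbT; lra.
  have : y <= t.
    apply: ub_le_sup => //; split; first by apply/andP; split; lra.
    by apply: hr => //; apply/andP; split; lra.
  by lra.
move: gt; rewrite te => -[l [h1 h2 h3 h4]].
have sd : \sum_(p <- l) (p.2 - p.1) < d.
  rewrite -lte_fin; apply: le_lt_trans h3 _; apply: le_lt_trans mU.
  by apply: le_measure; [exact: mem_set (mUi b)|exact: mem_set mUm|exact: subIsetl].
have := hd l h1 h2 (lt_le_trans sd dd1).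
move: h4; rewrite big_split /= -mulr_sumr => h4.
have : C * \sum_(p <- l) (p.2 - p.1) <= C * d by rewrite ler_wpM2l // ltW.
by lra.
Qed.

End AbsoluteContinuity.

(** * The initial discrete hexagon *)

Section DiscreteStart.
Variable R : realType.
Local Notation r := (Num.sqrt 3 : R).
Implicit Types (s : 'I_6 -> int) (eps : R).

(** The support numbers of a union of cells exceed those of the centres by
[eps * sqrt 3 / 3], the distance from a centre to a vertex of its cell. *)
Definition hexsupp eps s : 'I_6 -> R := fun k => eps * (r / 2 * (s k)%:~R + r / 3).

Lemma hlen_hexsupp eps s k :
  hlen (hexsupp eps s) k = eps * (r / 2 * (latlen s k)%:~R + r / 3).
Proof. by rewrite /hlen /hexsupp /latlen intrB intrD; ring. Qed.

Lemma nondeg_hexsupp eps s : 0 < eps -> (forall k, 0 <= latlen s k) -> nondeg (hexsupp eps s).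
Proof.
move=> e0 h k; rewrite hlen_hexsupp mulr_gt0 // ltr_wpDl ?divr_gt0 ?r3_gt0 //.
by rewrite mulr_ge0 ?ler0z // divr_ge0 // sqrtr_ge0.
Qed.

Lemma latvtx s k : (forall j, 0 <= latlen s j) ->
  inhex s (latpt k (s k) (s k - s (rt 5 k))).
Proof.
move=> h; have [l0 l1 l2 l3 [l4 l5]] := latlens s k.
have h0 := h k; have h1 := h (rt 1 k); have h2 := h (rt 2 k).
have h3 := h (rt 3 k); have h4 := h (rt 4 k); have h5 := h (rt 5 k).
by apply/(inhexP _ k); rewrite latf_pt latf1_pt; do ![split]; lia.
Qed.

(** With nonnegative side lengths every side carries a lattice point, and its
cell reaches the height [hexsupp eps s k]. *)
Lemma envelope_cells eps s : 0 < eps -> (forall k, 0 <= latlen s k) ->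
  envelope (cells eps [set z | inhex s z]) = Hex (hexsupp eps s).
Proof.
move=> e0 h; have c0 : 0 < eps * (r / 2) by rewrite mulr_gt0 // divr_gt0 // r3_gt0.
apply: envelope_Hex; first exact: nondeg_hexsupp.
- move=> x /cellsP [z /forallP zs hx] k; apply: le_trans (cell_le k e0 hx) _.
  have : eps * (r / 2) * (latf k z)%:~R <= eps * (r / 2) * (s k)%:~R.
    by rewrite ler_pM2l // ler_int.
  by rewrite hf_lat /hexsupp; lra.
- move=> k; have zs := latvtx k h.
  have [x hx e] := cell_top eps (lat eps (latpt k (s k) (s k - s (rt 5 k)))) k.
  exists x; first exact: (cell_sub _ hx).
  by rewrite e hf_lat latf_pt /hexsupp; ring.
Qed.

(** Two disjoint hexagons both contain the empty set, so it has no smallest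
enclosing one. *)
Lemma envelope0 : envelope (set0 : set (plane R)) = set0.
Proof.
rewrite /envelope; apply: xgetPN => W [cW _ minW].
pose s1 : 'I_6 -> R := fun=> 1.
pose v : plane R := 3 *: hexn ord0.
pose s2 : 'I_6 -> R := fun k => 1 + hf k v.
have l1 : nondeg s1 by move=> k; rewrite /hlen /s1; lra.
have l2 : nondeg s2.
  by move=> k; rewrite /hlen /s2 hf5; lra.
have [u un Wu] := convex_hexagonP cW.
have [v1 _] := vtx_in ord0 un; rewrite -Wu in v1.
have /(_ ord0) := minW _ (convex_hexagon_Hex l1) (@sub0set _ _) _ v1.
have /(_ (rt 3 ord0)) := minW _ (convex_hexagon_Hex l2) (@sub0set _ _) _ v1.
by rewrite /s1 /s2 !hf3 /v hfZ hf_hexn; lra.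
Qed.

Lemma seq_max (T : eqType) (l : seq T) (h : T -> int) : l != [::] ->
  exists2 z, z \in l & forall w, w \in l -> h w <= h z.
Proof.
elim: l => // a l IH _; have [->|/IH [z zl hz]] := eqVneq l [::].
  by exists a; rewrite ?inE // => w; rewrite inE => /eqP ->.
have [az|za] := leP (h a) (h z).
  by exists z; rewrite ?inE ?zl ?orbT // => w; rewrite inE => /orP [/eqP ->|/hz].
exists a; rewrite ?inE ?eqxx // => w; rewrite inE => /orP [/eqP ->//|/hz h1].
exact: le_trans h1 (ltW za).
Qed.

(** The envelope being close to a nonempty set, the discrete set is not empty;
lowering the bounds to the maximal heights attained in it makes all of them
tight, hence the side lengths nonnegative. *)
Lemma discrete_start eps (E E0 : set (plane R)) : 0 < eps -> discrete_hexagon eps E ->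
  (hausdorff_dist (envelope E) E0 < eps%:E)%E -> E0 !=set0 ->
  exists s, E = cells eps [set z | inhex s z] /\ forall k, 0 <= latlen s k.
Proof.
move=> e0 /(discrete_hexagonP e0) [s ->] hd [x0 Ex0].
have ne : (hexset s : seq _) != [::].
  apply/eqP => h.
  have se : [set z | inhex s z] = set0.
    apply/seteqP; split=> // z /= zs.
    by have : z \in enum_fset (hexset s) := etrans (in_hexset s z) zs; rewrite h.
  have : cells eps [set z | inhex s z] = set0.
    by apply/seteqP; split=> // x /cellsP [z]; rewrite se.
  move=> ce; move: hd; rewrite ce envelope0 hausdorffC => hd.
  by have [y] := hausdorff_ltl hd Ex0.
have tight k : exists z, inhex s z /\ forall w, inhex s w -> latf k w <= latf k z.
  have [z zs hz] := seq_max (latf k) ne; exists z; split; first by rewrite -in_hexset.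
  by move=> w ws; apply: hz; rewrite in_hexset.
have [zz zzP] := choice tight.
exists (fun k => latf k (zz k)); split.
  congr cells; apply/seteqP; split=> z /= zs.
    by apply/forallP => k; case: (zzP k) => _; exact.
  apply/forallP => k; have /forallP /(_ k) := zs; move=> h; apply: le_trans h _.
  by case: (zzP k) => /forallP.
move=> k; rewrite /latlen; have [zs _] := zzP k.
have [_ /(_ _ zs) h1] := zzP (rt 1 k); have [_ /(_ _ zs) h5] := zzP (rt 5 k).
by have := latf5 k (zz k); lia.
Qed.

End DiscreteStart.

(** * The discrete evolution *)

(** The length of a side plus the number of its slow moves does not increase:
the former changes by [n - n1 - n5], the latter by [N - n], and [n1 + n5 >= N]
because [2 * (N - 1) >= N] for [N >= 2]. *)
Lemma slow_side_len (N n n1 n5 e : nat) (s s1 s5 X : int) :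
  n = N \/ n = N.-1 /\ (1 < N)%N -> n1 = N \/ n1 = N.-1 /\ (1 < N)%N ->
  n5 = N \/ n5 = N.-1 /\ (1 < N)%N -> s5 + s1 - s + e%:Z <= X ->
  (s5 - n5%:Z) + (s1 - n1%:Z) - (s - n%:Z) + (e + (N - n))%N%:Z <= X.
Proof. by case=> [->|[-> ?]]; case=> [->|[-> ?]]; case=> [->|[-> ?]]; lia. Qed.

Lemma slow_side_count (N b e : nat) : (0 < N)%N -> (e * N < 6 * N + b)%N -> (e < 6 + b)%N.
Proof. by move=> N0 h; rewrite ltnNge; apply/negP => ge; nia. Qed.

Section DiscreteEvolution.
Variable R : realType.
Local Notation r := (Num.sqrt 3 : R).
Variables (gamma zeta xi eps : R) (N : nat) (L0 : 'I_6 -> R).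
Hypotheses (g0 : 0 < gamma) (z0 : 0 < zeta) (e0 : 0 < eps).
Let A : R := alpha_hex * gamma.
Hypothesis L0_ge : forall k, A + zeta * N.+1%:R <= L0 k * N.+1%:R.
Hypothesis L0_le : forall k, L0 k * N%:R <= A.
Hypothesis L0_lt : N = 1%N -> forall k, L0 k + xi <= A.
Let B := slack N.

(** The number of lattice steps within which the scale [eps] resolves the
evolution; it collects the initial error, one step of the evolution, and the
slack of the minimising steps. *)
Definition coarse : nat := 12 + 6 * N + 4 * slack N.
Hypothesis e_z : 4 * (eps * coarse%:R) <= zeta.
Hypothesis e_x : eps * coarse%:R <= xi.
Hypothesis e_A : 4 * (eps * coarse%:R) <= A.
Variables (E : nat -> set (plane R)) (s0 : 'I_6 -> int).
Hypothesis E0E : E 0%N = cells eps [set z | inhex s0 z].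
Hypothesis close0 : forall k, `|eps * (latlen s0 k)%:~R - L0 k| <= 6 * eps.
Hypothesis minE : forall j, is_minimizer (gamma * eps) eps (E j) (E j.+1).

(** After [j] steps side [k] has made [e k] moves by [N - 1] layers and [j - e k]
moves by [N] layers.  By the last clause each slow move has used up at least
one lattice step of its length. *)
Definition evolved j (s : 'I_6 -> int) (e : 'I_6 -> nat) : Prop :=
  [/\ E j = cells eps [set z | inhex s z],
      forall k, s k = s0 k - (N * j)%:Z + (e k)%:Z,
      forall k, (e k <= 6 + B)%N &
      forall k, latlen s k + (e k)%:Z <= latlen s0 k].

Let A0 : 0 < A. Proof. by rewrite /A /alpha_hex mulr_gt0 // divr_gt0. Qed.

Let eB : 4 * (eps * B%:R) + 6 * (eps * N%:R) + 12 * eps = eps * coarse%:R.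
Proof.
rewrite /coarse /B; move: (slack N) => b.
have -> : (12 + 6 * N + 4 * b)%:R = 12 + 6 * N%:R + 4 * b%:R :> R.
  by rewrite (natrD _ (12 + 6 * N)) (natrD _ 12) (natrM _ 6) (natrM _ 4).
by ring.
Qed.

Let Fz : 16 * (eps * B%:R) + 24 * (eps * N%:R) + 48 * eps <= zeta.
Proof. by apply: le_trans e_z; rewrite -eB; move: (B%:R : R) (N%:R : R) => *; lra. Qed.
Let Fx : 4 * (eps * B%:R) + 6 * (eps * N%:R) + 12 * eps <= xi.
Proof. by rewrite eB. Qed.
Let FA : 16 * (eps * B%:R) + 24 * (eps * N%:R) + 48 * eps <= A.
Proof. by apply: le_trans e_A; rewrite -eB; move: (B%:R : R) (N%:R : R) => *; lra. Qed.
Let eB0 : 0 <= eps * B%:R. Proof. by rewrite mulr_ge0 // ltW. Qed.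
Let eN0 : 0 <= eps * N%:R. Proof. by rewrite mulr_ge0 // ltW. Qed.

Let L0_z k : zeta <= L0 k.
Proof.
have N1 : 0 < N.+1%:R :> R by rewrite ltr0n.
by rewrite -(ler_pM2r N1); have := L0_ge k; have := A0; lra.
Qed.

Let jN j : j%:R * (gamma * eps) <= gamma * zeta / (2 * N.+1%:R) ->
  2 * (eps * (N * j)%:R) <= zeta.
Proof.
have N1 : 0 < N.+1%:R :> R by rewrite ltr0n.
rewrite ler_pdivlMr ?mulr_gt0 // => h.
have : gamma * (2 * (eps * (N.+1 * j)%:R)) <= gamma * zeta by rewrite natrM; lra.
rewrite ler_pM2l // => h2; apply: le_trans h2; rewrite !ler_pM2l // ler_nat leq_mul2r leqnSn orbT //.
Qed.

Lemma evolved_len j s e : evolved j s e ->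
  j%:R * (gamma * eps) <= gamma * zeta / (2 * N.+1%:R) ->
  forall k, L0 k - 3 / 4 * zeta <= eps * (latlen s k)%:~R.
Proof.
move=> [_ se eB' _] /jN hj k.
have h : (latlen s0 k - (N * j)%:Z - (6 + B)%:Z)%:~R <= (latlen s k)%:~R :> R.
  rewrite ler_int /latlen !se; move: (eB' k) => {eB'}; move: (6 + B)%N (N * j)%N => b n.
  by clear; lia.
move: (latlen s0 k) (latlen s k) h (close0 k) => X Y h.
have : eps * (X - (N * j)%:Z - (6 + B)%:Z)%:~R <= eps * Y%:~R by rewrite ler_pM2l.
rewrite !intrB -!pmulrn (natrD _ 6 B) => h2; rewrite ler_norml => /andP [c1 _].
move: Fz eB0 eN0 hj h2 c1; move: (B%:R : R) (N%:R : R) ((N * j)%:R : R) (X%:~R : R) (Y%:~R : R) => *; lra.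
Qed.

Let c := dissipation_coef gamma eps.
(* The condition [c * l * m <= 2] says that a side of length [eps * l] satisfies
[eps * l * m <= A]. *)
Let cA : c * A = 2 * eps.
Proof. by rewrite /c /dissipation_coef /A /alpha_hex; field; rewrite gt_eqF. Qed.

(** Slow moves occur only while the number of points of the side exceeds
[A / (N * eps)] up to a constant, and [A / (N * eps)] is at least the initial
number of points up to a constant.  As each slow move shortens the side, there
are at most [6 + B] of them, independently of the scale. *)
Lemma discrete_evolution j : j%:R * (gamma * eps) <= gamma * zeta / (2 * N.+1%:R) ->
  exists s e, evolved j s e.
Proof.
elim: j => [|j IH] hj.
  exists s0, (fun=> 0%N); split=> // k; rewrite ?muln0 ?subr0 ?addr0 //.
have hj' : j%:R * (gamma * eps) <= gamma * zeta / (2 * N.+1%:R).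
  apply: le_trans hj; rewrite ler_pM2r ?mulr_gt0 // ler_nat; exact: leqnSn.
have [s [e ev]] := IH hj'.
have lo := evolved_len ev hj'.
case: ev => Ej se eC le0.
have up k : eps * (latlen s k)%:~R <= L0 k + 6 * eps - eps * (e k)%:R.
  move: (latlen s0 k) (latlen s k) (le0 k) (close0 k) => X Y h.
  have : eps * (Y + (e k)%:Z)%:~R <= eps * X%:~R by rewrite ler_pM2l // ler_int.
  by rewrite intrD -!pmulrn ler_norml => ? /andP [_ ?]; lra.
pose eta := Num.min 1 (zeta / (2 * A)).
have eta1 : eta <= 1 by rewrite ge_min lexx.
have etaA : eta * A <= zeta / 2.
  have : eta <= zeta / (2 * A) by rewrite ge_min lexx orbT.
  by rewrite -(ler_pM2r A0) => /le_trans; apply; rewrite le_eqVlt; apply/orP; left; apply/eqP; field; rewrite gt_eqF.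
have etaA2 : eta * A <= A by rewrite ler_piMl // ltW.
have cl k (m : nat) : c * (latlen s k)%:~R * m%:R * A = 2 * (eps * (latlen s k)%:~R) * m%:R.
  by transitivity (c * A * (latlen s k)%:~R * m%:R); [ring|rewrite cA; ring].
have h1 : 2 * (c * (slack N)%:R) <= 1.
  rewrite -(ler_pM2r A0) mul1r.
  have -> : 2 * (c * (slack N)%:R) * A = 2 * (c * A) * B%:R by rewrite -/B; ring.
  by rewrite cA; move: FA eB0 eN0 e0; move: (B%:R : R) (N%:R : R) => *; lra.
have h2 : c * (slack N)%:R <= eta.
  have cBA : c * (slack N)%:R * A = 2 * (eps * B%:R).
    by transitivity (c * A * B%:R); [rewrite -/B; ring|rewrite cA; ring].
  rewrite /eta le_min; apply/andP; split; first by rewrite -(ler_pM2r A0) cBA mul1r; move: FA eB0 eN0 e0; move: (eps * B%:R) (eps * N%:R) => *; lra.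
  have -> : zeta / (2 * A) = zeta / 2 / A by field; rewrite gt_eqF.
  by rewrite ler_pdivlMr // cBA; move: Fz eB0 eN0 e0; move: (eps * B%:R) (eps * N%:R) => *; lra.
have h3 k : 2 + eta <= c * (latlen s k)%:~R * N.+1%:R.
  rewrite -(ler_pM2r A0) cl.
  have N1 : 1 <= N.+1%:R :> R by rewrite ler1n.
  have : (L0 k - 3 / 4 * zeta) * N.+1%:R <= eps * (latlen s k)%:~R * N.+1%:R.
    by rewrite ler_wpM2r.
  have : zeta <= zeta * N.+1%:R by rewrite ler_peMr // ltW.
  have := L0_ge k; have := z0; move: (eps * _) => X; lra.
have h4 k : c * (latlen s k)%:~R * N.-1%:R <= 2 - eta.
  rewrite -(ler_pM2r A0) cl; have := up k; have := e0; have := z0; have := A0; have := L0_z k; have := L0_le k.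
  have e1 : 0 <= eps * (e k)%:R by rewrite mulr_ge0 // ltW.
  move: Fz eB0; move: (eps * B%:R) => b.
  case: (N) eN0 => [|n] eN Fz' b0 hL hz hA hz0 he hu /=; first by rewrite mulr0; lra.
  have : eps * (latlen s k)%:~R * n%:R <= (L0 k + 6 * eps) * n%:R by rewrite ler_wpM2r //; lra.
  move: eN Fz' hL; rewrite -natr1; lra.
have := minE j; rewrite Ej => /(minimizer_step g0 e0 h1 h2 h3 h4) [n [n1 n2 n3]].
(* A side not yet below the threshold has made fewer than [6 + B] slow moves,
by [up]; and for [N = 1] the lengths are strictly below the threshold [A] from the
beginning, so that all the moves are by one layer. *)
have fast k : ~~ (c * (latlen s k)%:~R * N%:R <= 2 - c * (slack N)%:R) ->
    (1 < N)%N /\ (e k < 6 + B)%N.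
  rewrite -ltNge -(ltr_pM2r A0) cl => h.
  have cBA : (2 - c * (slack N)%:R) * A = 2 * A - 2 * (eps * B%:R).
    by transitivity (2 * A - c * A * B%:R); [rewrite -/B; ring|rewrite cA; ring].
  have hup : eps * (latlen s k)%:~R * N%:R <= (L0 k + 6 * eps - eps * (e k)%:R) * N%:R.
    by rewrite ler_wpM2r.
  have lt : eps * (e k * N)%:R < eps * (6 * N + B)%:R.
    rewrite (natrM _ (e k)) (natrD _ (6 * N)) (natrM _ 6).
    move: h hup (L0_le k); rewrite cBA.
    by move: (B%:R : R) (N%:R : R) ((e k)%:R : R) (eps * (latlen s k)%:~R) => *; lra.
  move: lt; rewrite ltr_pM2l // ltr_nat => lt.
  have N0 : (0 < N)%N.
    rewrite lt0n; apply/eqP => N0; have N0R : N%:R = 0 :> R by rewrite N0.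
    move: h; rewrite cBA N0R mulr0; move: FA eB0 eN0 e0.
    by move: (eps * B%:R) (eps * N%:R) => *; lra.
  split; last exact: slow_side_count N0 lt.
  rewrite ltn_neqAle N0 andbT; apply/eqP => N1; move: h; rewrite cBA -N1.
  have := up k; have := L0_lt (esym N1) k; have := Fx; have := eB0; have := eN0; have := e0.
  have : 0 <= eps * (e k)%:R by rewrite mulr_ge0 // ltW.
  by move: (eps * B%:R) (eps * N%:R) (eps * (e k)%:R) (eps * (latlen s k)%:~R) => *; lra.
have nN k : n k = N \/ [/\ n k = N.-1, (1 < N)%N & (e k < 6 + B)%N].
  have [/n2 ->|/fast [f1 f2]] := boolP (c * (latlen s k)%:~R * N%:R <= 2 - c * (slack N)%:R).
    by left.
  by case: (n1 k) => ->; [left|right].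
exists (fun k => s k - (n k)%:Z), (fun k => (e k + (N - n k))%N); split.
- exact: n3.
- by move=> k; rewrite se; case: (nN k) => [->|[-> h _]]; [|move: h]; clear; lia.
- by move=> k; move: (eC k); case: (nN k) => [->|[-> h h']]; [|move: h h']; clear; lia.
- have nN' k : n k = N \/ n k = N.-1 /\ (1 < N)%N by case: (nN k) => [|[]]; [left|right].
  move=> k; have := le0 k; rewrite /latlen; exact: slow_side_len.
Qed.

End DiscreteEvolution.

(** * Convergence at a fixed scale *)

Section Convergence.
Variable R : realType.
Local Notation r := (Num.sqrt 3 : R).
Variables (gamma zeta xi : R) (N : nat) (s0 : 'I_6 -> R).
Hypotheses (g0 : 0 < gamma) (z0 : 0 < zeta).
Hypotheses (s0n : nondeg s0) (s0s : forall k, s0 (rt 3 k) = s0 k).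
Let A : R := alpha_hex * gamma.
Let L0 k : R := 2 / r * hlen s0 k.
Hypothesis L0_ge : forall k, A + zeta * N.+1%:R <= L0 k * N.+1%:R.
Hypothesis L0_le : forall k, L0 k * N%:R <= A.
Hypothesis L0_lt : N = 1%N -> forall k, L0 k + xi <= A.
Let T : R := gamma * zeta / (2 * N.+1%:R).

Definition speed : R := r / 2 * (N%:R / gamma).
Definition shrink (t : R) : 'I_6 -> R := fun k => s0 k - speed * t.

Lemma hlen_shrink t k : hlen (shrink t) k = hlen s0 k - speed * t.
Proof. by rewrite /hlen /shrink; ring. Qed.

Lemma sqrt3_bounds : 5 / 3 <= r <= 2.
Proof.
have rr := r3_sqr R; have r0 := r3_gt0 R.
apply/andP; split; rewrite leNgt; apply/negP => h.
  have : r * r < 5 / 3 * (5 / 3) by apply: ltr_pM => //; exact: ltW.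
  by rewrite rr; lra.
have : 2 * 2 < r * r by apply: ltr_pM.
by rewrite rr; lra.
Qed.

Lemma speed_ge0 : 0 <= speed.
Proof. by rewrite /speed mulr_ge0 // divr_ge0 // ?sqrtr_ge0 // ltW. Qed.

Lemma length_shrink t k : 2 / r * hlen (shrink t) k = L0 k - N%:R / gamma * t.
Proof.
rewrite hlen_shrink mulrBr -/(L0 k) /speed; congr (_ - _).
by field; rewrite !gt_eqF // r3_gt0.
Qed.

(** Before the time [T] less than half of the margin above [A / (N + 1)] is
used up. *)
Lemma length_shrink_ge t k : t < T -> A + zeta / 2 * N.+1%:R <= (L0 k - N%:R / gamma * t) * N.+1%:R.
Proof.
move=> tT; have N1 : 0 < N.+1%:R :> R by rewrite ltr0n.
have : N%:R / gamma * t * N.+1%:R <= zeta / 2 * N.+1%:R.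
  rewrite ler_pM2r //.
  have h : t * (2 * N.+1%:R) <= gamma * zeta by rewrite -ler_pdivlMr ?mulr_gt0 // ltW.
  have h2 : t * N.+1%:R <= gamma * (zeta / 2) by move: h; lra.
  have [t0|t0] := leP t 0.
    apply: (@le_trans _ _ 0); last by rewrite divr_ge0 // ltW.
    by rewrite mulr_ge0_le0 // divr_ge0 // ltW.
  rewrite mulrAC ler_pdivrMr // mulrC [leRHS]mulrC; apply: le_trans h2.
  by rewrite ler_pM2l // ler_nat.
by have := L0_ge k; lra.
Qed.

Lemma nondeg_shrink t : t < T -> nondeg (shrink t).
Proof.
move=> tT k; have r0 := r3_gt0 R.
have rr : 0 < 2 / r by rewrite divr_gt0.
have N1 : 0 < N.+1%:R :> R by rewrite ltr0n.
rewrite -(pmulr_rgt0 _ rr) length_shrink -(pmulr_lgt0 _ N1).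
apply: lt_le_trans (length_shrink_ge k tT).
have A0 : 0 < A by rewrite /A /alpha_hex mulr_gt0 // divr_gt0.
by rewrite ltr_wpDr // mulr_ge0 // divr_ge0 // ltW.
Qed.

Lemma shrink_ge t k : t < T -> zeta / 4 <= shrink t k.
Proof.
move=> tT; have r0 := r3_gt0 R; have /andP [rl ru] := sqrt3_bounds.
have hl j : zeta / 4 <= hlen (shrink t) j.
  have N1 : 0 < N.+1%:R :> R by rewrite ltr0n.
  have A0 : 0 < A by rewrite /A /alpha_hex mulr_gt0 // divr_gt0.
  have : zeta / 2 <= 2 / r * hlen (shrink t) j.
    rewrite length_shrink -(ler_pM2r N1); apply: le_trans (length_shrink_ge j tT).
    by rewrite lerDr ltW.
  rewrite mulrAC ler_pdivlMr // => h.
  have : zeta / 2 * 1 <= zeta / 2 * r by rewrite ler_pM2l ?divr_gt0 //; lra.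
  by lra.
have [e0 e1 e2 _ _] := hlens (shrink t) k.
have := hl (rt 1 k); have := hl (rt 2 k).
have : shrink t (rt 3 k) = shrink t k by rewrite /shrink s0s.
by lra.
Qed.

Let M : R := \sum_k `|s0 k| + zeta.

Lemma shrink_le t k : 0 <= t -> shrink t k <= M - zeta.
Proof.
move=> t0; rewrite /M addrK /shrink.
have h1 : s0 k <= `|s0 k| by exact: ler_norm.
have h2 : `|s0 k| <= \sum_k `|s0 k|.
  by rewrite (bigD1 k) //= lerDl sumr_ge0.
by have := mulr_ge0 speed_ge0 t0; lra.
Qed.

Section AtScale.
Variables (eps : R) (E : nat -> set (plane R)).
Hypothesis e0 : 0 < eps.
Hypothesis e_z : 8 * (eps * (coarse N)%:R) <= zeta.
Hypothesis e_x : eps * (coarse N)%:R <= xi.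
Hypothesis e_A : 4 * (eps * (coarse N)%:R) <= A.
Hypothesis E0disc : discrete_hexagon eps (E 0%N).
Hypothesis E0close : (hausdorff_dist (envelope (E 0%N)) (Hex s0) < eps%:E)%E.
Hypothesis minE : forall j, is_minimizer (gamma * eps) eps (E j) (E j.+1).

(** Apart from the initial error and from the fraction of a step that separates
[t] from a multiple of the time step, the support numbers of the discrete and
of the limit hexagon differ only by the number of slow moves. *)
Lemma scale_convergence t : 0 <= t < T ->
  (hausdorff_dist (envelope (E (Num.truncn (t / (gamma * eps))))) (Hex (shrink t))
   <= (2 * M * (eps * (coarse N)%:R) / (zeta / 8))%:E)%E.
Proof.
move=> /andP [t0 tT]; have /andP [rl ru] := sqrt3_bounds; have r0 := r3_gt0 R.
have ge0 : 0 < gamma * eps by rewrite mulr_gt0.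
have ne : Hex s0 !=set0.
  by have [v _] := vtx_in ord0 s0n; exists (vtx s0 ord0).
have [q [Eq lq]] := discrete_start e0 E0disc E0close ne.
have cl k : `|hexsupp eps q k - s0 k| <= eps.
  apply: hausdorff_Hex_le => //; first exact: nondeg_hexsupp.
  by rewrite -envelope_cells // -Eq.
have close0 k : `|eps * (latlen q k)%:~R - L0 k| <= 6 * eps.
  have -> : eps * (latlen q k)%:~R - L0 k =
     2 / r * (hlen (hexsupp eps q) k - hlen s0 k) - 2 / 3 * eps.
    by rewrite hlen_hexsupp /L0; field; rewrite gt_eqF.
  have h : `|hlen (hexsupp eps q) k - hlen s0 k| <= 3 * eps.
    move: (cl k) (cl (rt 1 k)) (cl (rt 5 k)); rewrite !ler_norml /hlen.
    by move=> /andP [? ?] /andP [? ?] /andP [? ?]; apply/andP; split; lra.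
  have r2 : 0 <= 2 / r <= 6 / 5.
    by rewrite divr_ge0 ?(ltW r0) //= ler_pdivrMr //; lra.
  apply: le_trans (ler_normB _ _) _; rewrite normrM (ger0_norm (_ : 0 <= 2 / r)); last by case/andP: r2.
  rewrite (ger0_norm (_ : 0 <= 2 / 3 * eps)); last by rewrite mulr_ge0 // ltW.
  have : 2 / r * `|hlen (hexsupp eps q) k - hlen s0 k| <= 6 / 5 * (3 * eps).
    by case/andP: r2 => r20 r21; apply: ler_pM.
  by have := e0; lra.
have e_z' : 4 * (eps * (coarse N)%:R) <= zeta.
  apply: le_trans e_z; rewrite ler_wpM2r ?ler_nat // mulr_ge0 // ltW //.
set j := Num.truncn _.
have te0 : 0 <= t / (gamma * eps) by rewrite divr_ge0 // ltW.
have /andP [] := truncn_itv te0; rewrite -/j ler_pdivlMr // ltr_pdivrMr // => j1 j2.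
have hj : j%:R * (gamma * eps) <= gamma * zeta / (2 * N.+1%:R).
  by apply: le_trans j1 _; exact: ltW.
have [s [e ev]] := discrete_evolution g0 z0 e0 L0_ge L0_le L0_lt e_z' e_x e_A Eq close0 minE hj.
have lo := evolved_len g0 e0 e_z' close0 ev hj.
case: ev => Ej se eC _.
have ls k : 0 <= latlen s k.
  have : 0 < eps * (latlen s k)%:~R.
    apply: lt_le_trans (lo k).
    have N1 : 0 < N.+1%:R :> R by rewrite ltr0n.
    have A0 : 0 < A by rewrite /A /alpha_hex mulr_gt0 // divr_gt0.
    have : zeta <= L0 k by rewrite -(ler_pM2r N1); have := L0_ge k; lra.
    by have := z0; lra.
  by rewrite pmulr_rgt0 // ltr0z => /ltW.
rewrite Ej envelope_cells //.
have dk k : `|hexsupp eps s k - shrink t k| <= eps * (coarse N)%:R.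
  have -> : hexsupp eps s k - shrink t k = (hexsupp eps q k - s0 k) +
      (r / 2 * (eps * (e k)%:R) + speed * (t - j%:R * (gamma * eps))).
    rewrite /hexsupp /shrink se intrD intrB -!pmulrn natrM /speed; field.
    by rewrite !gt_eqF.
  have tj1 : 0 <= t - j%:R * (gamma * eps) by rewrite subr_ge0.
  have tj2 : t - j%:R * (gamma * eps) <= gamma * eps.
    by move: j2; rewrite -natr1; lra.
  have sp0 := speed_ge0.
  have h1 : speed * (t - j%:R * (gamma * eps)) <= eps * N%:R.
    apply: (@le_trans _ _ (speed * (gamma * eps))); first by rewrite ler_wpM2l.
    have -> : speed * (gamma * eps) = r / 2 * (eps * N%:R) by rewrite /speed; field; rewrite gt_eqF.
    by rewrite ler_piMl //; [rewrite mulr_ge0 // ltW|lra].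
  have h0 : 0 <= speed * (t - j%:R * (gamma * eps)) by rewrite mulr_ge0.
  have h2 : r / 2 * (eps * (e k)%:R) <= eps * (6 + slack N)%:R.
    apply: (@le_trans _ _ (eps * (e k)%:R)).
      by rewrite ler_piMl //; [rewrite mulr_ge0 // ltW|lra].
    by rewrite ler_pM2l // ler_nat.
  have h3 : 0 <= r / 2 * (eps * (e k)%:R) by rewrite !mulr_ge0 // ltW.
  have h4 : eps + eps * N%:R + eps * (6 + slack N)%:R <= eps * (coarse N)%:R.
    have -> : (coarse N)%:R = 12 + 6 * N%:R + 4 * (slack N)%:R :> R.
      rewrite /coarse; move: (slack N) => b.
      by rewrite (natrD _ (12 + 6 * N)) (natrD _ 12) (natrM _ 6) (natrM _ 4).
    rewrite (natrD _ 6 (slack N)).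
    have : 0 <= eps * (slack N)%:R by rewrite mulr_ge0 // ltW.
    have : 0 <= eps * N%:R by rewrite mulr_ge0 // ltW.
    by move: (N%:R : R) ((slack N)%:R : R) e0 => *; lra.
  move: (cl k); rewrite !ler_norml => /andP [? ?].
  move: h0 h1 h2 h3 h4; move: (speed * _) (r / 2 * _) (eps * N%:R) (eps * (6 + _)%:R) (eps * (coarse N)%:R) e0.
  by move=> *; apply/andP; split; lra.
have sh k := shrink_ge k tT.
have sl k := shrink_le k t0.
apply: hausdorff_Hex_close.
- by rewrite divr_gt0.
- by rewrite mulr_ge0 // ltW.
- move=> k; move: (dk k) (sh k) (sl k) e_z z0; rewrite ler_norml => /andP [? ?] ? ? ? ?.
  by apply/andP; split; lra.
- move=> k; move: (sh k) (sl k) z0 => ? ? ?.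
  by apply/andP; split; lra.
- exact: dk.
Qed.

End AtScale.
End Convergence.

(** * The limit flow solves the system *)

Section AbsContAlgebra.
Variable R : realType.
Implicit Types (f g : R -> R) (a b k : R).

Lemma abs_continuousD a b f g : abs_continuous a b f -> abs_continuous a b g ->
  abs_continuous a b (fun t => f t + g t).
Proof.
move=> cf cg e e0; have e2 : 0 < e / 2 by rewrite divr_gt0.
have [d1 d10 h1] := cf _ e2; have [d2 d20 h2] := cg _ e2.
exists (Num.min d1 d2); first by rewrite lt_min d10.
move=> m u v uv dis; rewrite lt_min => /andP [s1 s2].
have := h1 m u v uv dis s1; have := h2 m u v uv dis s2.
have : \sum_k `|f (v k) + g (v k) - (f (u k) + g (u k))| <=
    \sum_k `|f (v k) - f (u k)| + \sum_k `|g (v k) - g (u k)|.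
  rewrite -big_split; apply: ler_sum => k _; apply: le_trans (ler_normD _ _).
  by rewrite opprD addrACA.
lra.
Qed.

Lemma abs_continuousZ a b k f : abs_continuous a b f ->
  abs_continuous a b (fun t => k * f t).
Proof.
move=> cf e e0; have k1 : 0 < `|k| + 1 by rewrite ltr_wpDl.
have [d d0 h] := cf (e / (`|k| + 1)) (divr_gt0 e0 k1).
exists d => // m u v uv dis sd; have := h m u v uv dis sd.
rewrite ltr_pdivlMr // mulrDr mulr1; apply: le_lt_trans.
rewrite -[leLHS]addr0 lerD ?sumr_ge0 // mulrC mulr_sumr; apply: ler_sum => i _.
by rewrite -mulrBr normrM.
Qed.

Lemma abs_continuous_affine a b c k : abs_continuous a b (fun t => c + k * t).
Proof.
move=> e e0; have k1 : 0 < `|k| + 1 by rewrite ltr_wpDl.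
exists (e / (`|k| + 1)); first exact: divr_gt0.
move=> m u v uv _; rewrite ltr_pdivlMr // mulrDr mulr1; apply: le_lt_trans.
have uv0 i : 0 <= v i - u i by rewrite subr_ge0; case: (uv i).
rewrite -[leLHS]addr0 lerD ?sumr_ge0 // mulrC mulr_sumr; apply: ler_sum => i _.
by rewrite opprD addrACA subrr add0r -mulrBr normrM (ger0_norm (uv0 i)).
Qed.

Lemma abs_continuous_uniform a b f e : abs_continuous a b f -> 0 < e ->
  exists2 d : R, 0 < d &
    forall x y, a <= x -> x <= y -> y <= b -> y - x < d -> `|f y - f x| < e.
Proof.
move=> cf e0; have [d d0 h] := cf e e0; exists d => // x y ax xy yb yx.
have := h 1%N (fun=> x) (fun=> y); rewrite !big_ord1; apply=> //.
by move=> i j; rewrite !ord1.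
Qed.

Lemma is_derive_affine (c k t : R) : is_derive t (1 : R) (fun s => c + k * s) k.
Proof.
by apply: is_derive_eq; rewrite /GRing.scale /=; ring.
Qed.

Lemma finite_min (h : 'I_6 -> R) : (forall i, 0 < h i) -> exists2 d, 0 < d & forall i, d <= h i.
Proof.
move=> h0; exists (\big[Num.min/h ord0]_i h i).
  by elim/big_ind: _ => // x y x0 y0; rewrite lt_min x0.
by move=> i; exact: bigmin_le.
Qed.

End AbsContAlgebra.

Section LimitFlow.
Variable R : realType.
Local Notation r := (Num.sqrt 3 : R).
Local Notation mu := (@lebesgue_measure R).
Variables (gamma zeta : R) (N : nat) (s0 : 'I_6 -> R).
Hypotheses (g0 : 0 < gamma) (z0 : 0 < zeta).
Hypothesis s0s : forall k, s0 (rt 3 k) = s0 k.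
Let A : R := alpha_hex * gamma.
Let L0 k : R := 2 / r * hlen s0 k.
Hypothesis L0_ge : forall k, A + zeta * N.+1%:R <= L0 k * N.+1%:R.
Hypothesis L0_le : forall k, L0 k * N%:R <= A.
Let T : R := gamma * zeta / (2 * N.+1%:R).

Let A0 : 0 < A. Proof. by rewrite /A /alpha_hex mulr_gt0 // divr_gt0. Qed.
Let N1 : 0 < N.+1%:R :> R. Proof. by rewrite ltr0n. Qed.
Let T0 : 0 < T. Proof. by rewrite /T divr_gt0 ?mulr_gt0. Qed.

Lemma floor_rateE (n : nat) (l : R) : 0 < l -> A < l * n.+1%:R -> l * n%:R <= A ->
  floor_rate gamma l = n%:R.
Proof.
move=> l0 h1 h2; rewrite /floor_rate -/A (@floor_def _ _ n%:Z) //.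
by rewrite ler_pdivlMr // ltr_pdivrMr // mulrC h2 /= mulrC -[(n%:Z + 1)%:~R]/((n + 1)%:R) addn1.
Qed.

Let flow t := shrink gamma N s0 t.
Let fnd t : t < T -> nondeg (flow t).
Proof. exact: nondeg_shrink. Qed.

Lemma side_dist_flow t i : t < T -> side_dist (Hex (flow t)) i = s0 i - speed gamma N * t.
Proof. by move=> tT; rewrite side_dist_Hex //; exact: fnd. Qed.

Lemma side_length_flow t i : t < T -> side_length (Hex (flow t)) i = L0 i - N%:R / gamma * t.
Proof. by move=> tT; rewrite (side_length_Hex _ (fnd tT)) /flow length_shrink. Qed.

Lemma floor_rate_flow t i : 0 <= t < T -> floor_rate gamma (side_length (Hex (flow t)) i) = N%:R.
Proof.
move=> /andP [t0 tT]; rewrite side_length_flow //.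
have h := length_shrink_ge g0 z0 L0_ge i tT.
have zN : 0 < zeta / 2 * N.+1%:R by rewrite mulr_gt0 // divr_gt0.
apply: floor_rateE.
- by rewrite -(pmulr_lgt0 _ N1); apply: lt_le_trans h; rewrite addr_gt0.
- by apply: lt_le_trans h; rewrite ltrDl.
- apply: le_trans (L0_le i); rewrite ler_wpM2r // gerBl.
  by rewrite mulr_ge0 // divr_ge0 // ltW.
Qed.

Lemma near_lt t : t < T -> \forall s \near t, s < T.
Proof. exact: lt_nbhsl. Qed.

Lemma is_solution_flow : is_solution gamma L0 T (fun t => Hex (flow t)).
Proof.
split.
- move=> t /andP [t0 tT]; split; first exact/convex_hexagon_Hex/fnd.
  by apply: origin_symmetric_Hex => k; rewrite /flow /shrink s0s.
- move=> i b /andP [b0 bT] e e0.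
  have [d d0 h] := @abs_continuous_affine R 0 b (s0 i) (- speed gamma N) e e0.
  exists d => // m u v uv dis sd; have := h m u v uv dis sd.
  apply: le_lt_trans; apply: ler_sum => k _; have [? ? ?] := uv k.
  by rewrite !side_dist_flow ?mulNr //; lra.
- apply: aeW => t /andP [t0 tT] i; rewrite floor_rate_flow ?t0 //.
  have -> : - (r / 2) * (1 / gamma * N%:R) = - speed gamma N by rewrite /speed; ring.
  apply: (near_eq_is_derive (f := fun s => s0 i + - speed gamma N * s)); last exact: is_derive_affine.
  near=> s; rewrite side_dist_flow ?mulNr //; near: s; exact: near_lt.
- by move=> i; rewrite side_length_flow // mulr0 subr0.
Unshelve. all: by end_near. Qed.

Lemma side_length_law_flow : side_length_law gamma T (fun t => Hex (flow t)).
Proof.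
apply: aeW => t tT i; rewrite !floor_rate_flow //; case/andP: tT => t0 tT.
have -> : 1 / gamma * N%:R - 1 / gamma * (N%:R + N%:R) = - (N%:R / gamma) by ring.
apply: (near_eq_is_derive (f := fun s => L0 i + - (N%:R / gamma) * s)); last exact: is_derive_affine.
near=> s; rewrite side_length_flow ?mulNr //; near: s; exact: near_lt.
Unshelve. all: by end_near. Qed.

End LimitFlow.

(** * Uniqueness of the limit flow *)

(** The rate of a side is at most the sum of the rates of its neighbours, since
[N <= 2 * (N - 1)] for [N >= 2], so lengths cannot increase; and they lose at
most [N + 1] units. *)
Lemma speed_defect (N a b c : nat) : a = N \/ (a = N.-1 /\ (1 < N)%N) ->
  b = N \/ (b = N.-1 /\ (1 < N)%N) -> c = N \/ (c = N.-1 /\ (1 < N)%N) ->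
  (a <= b + c)%N /\ (b + c <= a + N.+1)%N.
Proof. lia. Qed.

Section Uniqueness.
Variable R : realType.
Local Notation r := (Num.sqrt 3 : R).
Local Notation mu := (@lebesgue_measure R).
Variables (gamma zeta xi : R) (N : nat) (s0 : 'I_6 -> R).
Hypotheses (g0 : 0 < gamma) (z0 : 0 < zeta) (x0 : 0 < xi).
Hypothesis s0s : forall k, s0 (rt 3 k) = s0 k.
Let A : R := alpha_hex * gamma.
Let L0 k : R := 2 / r * hlen s0 k.
Hypothesis L0_ge : forall k, A + zeta * N.+1%:R <= L0 k * N.+1%:R.
Hypothesis L0_le : forall k, L0 k * N%:R <= A.
Hypothesis L0_lt : N = 1%N -> forall k, L0 k + xi <= A.
Let T : R := gamma * zeta / (2 * N.+1%:R).

Let A0 : 0 < A. Proof. by rewrite /A /alpha_hex mulr_gt0 // divr_gt0. Qed.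
Let N1 : 0 < N.+1%:R :> R. Proof. by rewrite ltr0n. Qed.
Let T0 : 0 < T. Proof. by rewrite /T divr_gt0 ?mulr_gt0. Qed.
Let L0z k : zeta <= L0 k.
Proof. by rewrite -(ler_pM2r N1); have := L0_ge k; have := A0; lra. Qed.

Lemma ae_imp (P Q : R -> Prop) : (forall t, P t -> Q t) ->
  {ae mu, forall t, P t} -> {ae mu, forall t, Q t}.
Proof. by move=> PQ [M [mM M0 h]]; exists M; split=> // t nQ; apply: h => /PQ. Qed.

(** A length in this window has an integer part [N], or [N - 1] if it is above
[A / N]; for [N = 1] the window ends below [A], which excludes a rate zero. *)
Lemma speed_window (l : R) i : L0 i - zeta < l -> l < L0 i + xi -> l * N.-1%:R <= A ->
  exists2 n : nat, floor_rate gamma l = n%:R & n = N \/ (n = N.-1 /\ (1 < N)%N).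
Proof.
move=> h1 h2 h3.
have l0 : 0 < l by have := L0z i; lra.
have lA : A < l * N.+1%:R.
  have : (L0 i - zeta) * N.+1%:R < l * N.+1%:R by rewrite ltr_pM2r.
  by have := L0_ge i; lra.
have [hN|hN] := leP (l * N%:R) A.
  by exists N; [exact: floor_rateE|left].
have N2 : (1 < N)%N.
  rewrite ltnNge; apply/negP; rewrite leq_eqVlt ltnS leqn0 => /orP [] /eqP N'.
    by move: hN; rewrite N' mulr1 => hN; have := L0_lt N' i; lra.
  by move: hN; rewrite N' mulr0 ltNge (ltW A0).
exists N.-1; last by right.
by apply: floor_rateE => //; rewrite prednK // ltnW.
Qed.

Variable E : R -> set (plane R).
Hypothesis solE : is_solution gamma L0 T E.

Let f i t := side_dist (E t) i.
Let ell i t : R := 2 / r * (f (rt 5 i) t + f (rt 1 i) t - f i t).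

Let EHex t : 0 <= t < T -> E t = Hex (fun i => f i t) /\ nondeg (fun i => f i t).
Proof.
move=> tT; have [/(_ t tT) [cE _] _ _ _] := solE.
have [u un Eu] := convex_hexagonP cE.
have -> : (fun i => f i t) = u.
  by apply/funext => i; rewrite /f Eu side_dist_Hex.
by [].
Qed.

Let ellE i t : 0 <= t < T -> side_length (E t) i = ell i t.
Proof. by move=> /EHex [-> nd]; rewrite side_length_Hex. Qed.

Let f_ac i b : 0 <= b < T -> abs_continuous 0 b (f i).
Proof. by move=> bT; have [_ /(_ i b bT) h _ _] := solE. Qed.

Let ell_ac i b : 0 <= b < T -> abs_continuous 0 b (ell i).
Proof.
move=> bT; apply: abs_continuousZ; apply: abs_continuousD.
  by apply: abs_continuousD; exact: f_ac.
have -> : (fun t => - f i t) = (fun t => -1 * f i t) by apply/funext => t; rewrite mulN1r.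
by apply: abs_continuousZ; exact: f_ac.
Qed.

Let rate i t : R := floor_rate gamma (ell i t).

Let f_der : {ae mu, forall t, 0 <= t < T -> forall i,
  is_derive t (1 : R) (f i) (- (r / 2) * (1 / gamma * rate i t))}.
Proof.
have [_ _ h _] := solE; move: h; apply: ae_imp => t h tT i.
by have := h tT i; rewrite ellE.
Qed.

Let ell_der i b : b <= T -> {ae mu, forall t, 0 <= t < b ->
  is_derive t (1 : R) (ell i) (1 / gamma * (rate i t - rate (rt 5 i) t - rate (rt 1 i) t))}.
Proof.
move=> bT; move: f_der; apply: ae_imp => t h /andP [t0 tb].
have tT : 0 <= t < T by rewrite t0 (lt_le_trans tb).
have d0 := h tT i; have d1 := h tT (rt 1 i); have d5 := h tT (rt 5 i).
have := is_deriveZ (2 / r) (is_deriveB (is_deriveD d5 d1) d0).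
have -> : (2 / r) \*: (f (rt 5 i) + f (rt 1 i) - f i) = ell i by apply/funext => u.
move=> /is_derive_eq; apply.
by rewrite -[LHS]/(2 / r * _); field; rewrite !gt_eqF // r3_gt0.
Qed.

Let ell0 i : ell i 0 = L0 i.
Proof.
have [_ _ _ h] := solE; rewrite -ellE ?h //.
by rewrite lexx T0.
Qed.

(* Lengths that are [inside] have rates [N] or [N - 1], hence evolve slowly;
this in turn keeps them in the smaller window [strong], by absolute
continuity.  Together with the continuity of the lengths this gives an
argument by small time steps of fixed size. *)
Let inside t := forall i, L0 i - zeta < ell i t /\ ell i t < L0 i + xi /\ ell i t * N.-1%:R <= A.
Let strong t := forall i, L0 i - zeta / 2 <= ell i t <= L0 i.

Let rates t : inside t -> forall i,
  - N.+1%:R <= rate i t - rate (rt 5 i) t - rate (rt 1 i) t <= 0.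
Proof.
move=> h.
have sp i : exists2 n : nat, rate i t = n%:R & n = N \/ (n = N.-1 /\ (1 < N)%N).
  by have [h1 [h2 h3]] := h i; exact: speed_window h1 h2 h3.
move=> i; have [n -> hn] := sp i; have [n5 -> hn5] := sp (rt 5 i).
have [n1 -> hn1] := sp (rt 1 i).
have [up lo] := speed_defect hn hn5 hn1.
move: up lo; rewrite -(ler_nat R) -[(n5 + n1 <= _)%N](ler_nat R) !natrD => up lo.
by apply/andP; split; lra.
Qed.

Let inside_strong t : 0 <= t < T -> (forall u, 0 <= u < t -> inside u) -> strong t.
Proof.
move=> /andP [t0 tT] ins i.
have tT' : 0 <= t < T by rewrite t0.
have ac := @ell_ac i t tT'.
have der := @ell_der i t (ltW tT).
have gi : 0 < 1 / gamma by rewrite divr_gt0.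
have up : ell i t - ell i 0 <= 0 * t.
  apply: (ac_le t0 ac der) => u ut; have /andP [_ h] := rates (ins u ut) i.
  by rewrite mulr_ge0_le0 // ltW.
have lo : -1 * ell i t - -1 * ell i 0 <= N.+1%:R / gamma * t.
  apply: (ac_le (f := fun u => -1 * ell i u) (g := fun u => - (1 / gamma * (rate i u - rate (rt 5 i) u - rate (rt 1 i) u))) t0).
  - exact: abs_continuousZ.
  - move: der; apply: ae_imp => u h ut; have := is_deriveN (h ut).
    by have -> : - ell i = (fun t => -1 * ell i t) by apply/funext => v; rewrite mulN1r.
  - move=> u ut; have /andP [h _] := rates (ins u ut) i.
    by rewrite -mulrN mul1r [leRHS]mulrC ler_pM2l ?invr_gt0 //; lra.
have tz : N.+1%:R / gamma * t <= zeta / 2.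
  have : t * (2 * N.+1%:R) <= gamma * zeta by rewrite -ler_pdivlMr ?mulr_gt0 // ltW.
  by move=> h; rewrite mulrAC ler_pdivrMr //; lra.
by move: up lo; rewrite ell0 => up lo; apply/andP; split; lra.
Qed.

Let inside_near e u v : 0 < e -> e <= zeta / 2 -> e <= xi -> e * N.+1%:R <= zeta ->
  strong v -> (forall i, `|ell i u - ell i v| < e) -> inside u.
Proof.
move=> e0 e1 e2 e3 st cl i; have /andP [h1 h2] := st i.
have := cl i; rewrite ltr_norml => /andP [h3 h4].
split; first by lra.
split; first by lra.
have [N'|N'] := leqP N 1.
  have -> : N.-1 = 0%N by case: (N) N' => [|[|]].
  by rewrite mulr0 ltW // A0.
have NE : N%:R = N.-1%:R + 1 :> R by rewrite natr1 prednK // ltnW.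
have NS : N.+1%:R = N%:R + 1 :> R by rewrite -natr1.
have N0 : 0 <= N.-1%:R :> R by [].
have : ell i u * N.-1%:R <= (L0 i + e) * N.-1%:R by apply: ler_wpM2r => //; lra.
by have := L0_le i; have := L0z i; move: e3; rewrite NS NE; lra.
Qed.

(* Induction over time steps of length [d / 2], with [d] a common modulus of
continuity for the six lengths. *)
Let always_inside t : 0 <= t < T -> inside t.
Proof.
move=> tT.
have [e e0 [e1 e2 e3]] : exists2 e, 0 < e & [/\ e <= zeta / 2, e <= xi & e * N.+1%:R <= zeta].
  exists (Num.min (zeta / 2) (Num.min xi (zeta / N.+1%:R))).
    by rewrite !lt_min x0 !divr_gt0.
  by rewrite -ler_pdivlMr // !ge_min !lexx ?orbT.
have /choice [h hP] : forall i, exists d, 0 < d /\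
    forall x y, 0 <= x -> x <= y -> y <= t -> y - x < d -> `|ell i y - ell i x| < e.
  move=> i; have [d d0 hd] := abs_continuous_uniform (@ell_ac i t tT) e0.
  by exists d.
have [d d0 dh] := finite_min (fun i => (hP i).1).
have d2 : 0 < d / 2 by rewrite divr_gt0.
have [t0 tT'] := andP tT.
have step n : forall u, 0 <= u -> u <= t -> u <= n%:R * (d / 2) -> inside u.
  elim: n => [|n IH] u u0 ut un.
    have -> : u = 0 by apply/eqP; rewrite eq_le u0 andbT; move: un; rewrite mul0r.
    apply: (@inside_near e 0 0) => //; last by move=> i; rewrite subrr normr0.
    by apply: inside_strong => [|v]; rewrite ?lexx ?T0 // => /andP [v0]; rewrite ltNge v0.
  have [un'|un'] := leP u (n%:R * (d / 2)); first exact: IH.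
  have v0 : 0 <= n%:R * (d / 2) by rewrite mulr_ge0 // ltW.
  apply: (inside_near e0 e1 e2 e3 (v := n%:R * (d / 2))).
    apply: inside_strong => [|w /andP [w0 wn]].
      by rewrite v0 (lt_trans un') // (le_lt_trans ut).
    by apply: IH (ltW wn) => //; rewrite (le_trans (ltW wn)) // (le_trans (ltW un')).
  move=> i; apply: (hP i).2 => //; first exact: ltW.
  by have := dh i; move: un; rewrite -natr1; lra.
have [n _ tn] : exists2 n, True & t <= n%:R * (d / 2).
  exists (Num.truncn (t / (d / 2))).+1 => //.
  by rewrite -ler_pdivrMr // ltW // truncnS_gt.
exact: step tn.
Qed.

Let rateE t i : 0 <= t < T -> rate i t = N%:R.
Proof.
move=> tT; have [t0 tT'] := andP tT.
have st : strong t.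
  apply: inside_strong => // u /andP [u0 ut].
  by apply: always_inside; rewrite u0 (lt_trans ut).
have /andP [h1 h2] := st i; have l0 : 0 < ell i t by have := L0z i; have := z0; lra.
apply: floor_rateE => //.
  have : (L0 i - zeta / 2) * N.+1%:R <= ell i t * N.+1%:R by rewrite ler_pM2r.
  have : 0 < zeta * N.+1%:R by rewrite mulr_gt0.
  by have := L0_ge i; rewrite -/A; lra.
by apply: le_trans (L0_le i); rewrite ler_wpM2r.
Qed.

Let f_affine t i : 0 <= t < T -> f i t = f i 0 - speed gamma N * t.
Proof.
move=> tT; have [t0 tT'] := andP tT.
have der : {ae mu, forall u, 0 <= u < t -> is_derive u (1 : R) (f i) (- speed gamma N)}.
  move: f_der; apply: ae_imp => u h /andP [u0 ut].
  have uT : 0 <= u < T by rewrite u0 (lt_trans ut).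
  have := h uT i; rewrite rateE //.
  by have -> : - (r / 2) * (1 / gamma * N%:R) = - speed gamma N by rewrite /speed; ring.
have up := ac_le (K := - speed gamma N) t0 (@f_ac i t tT) der (fun _ _ => lexx _).
have lo : -1 * f i t - -1 * f i 0 <= speed gamma N * t.
  apply: (ac_le (f := fun u => -1 * f i u) (g := fun=> speed gamma N) t0).
  - by apply: abs_continuousZ; exact: f_ac.
  - move: der; apply: ae_imp => u h ut; have := is_deriveN (h ut); rewrite opprK.
    by have -> : - f i = (fun t => -1 * f i t) by apply/funext => v; rewrite mulN1r.
  - by [].
by lra.
Qed.

(* By symmetry the support number of a side is half of the sum of the two
consecutive lengths of the sides preceding it. *)
Let f0 i : f i 0 = s0 i.
Proof.
have T0' : 0 <= (0 : R) < T by rewrite lexx T0.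
have [E0 nd] := EHex T0'; have [/(_ 0 T0') [_ sym] _ _ _] := solE.
have fs k : f (rt 3 k) 0 = f k 0.
  by apply: (@Hex_symmetric _ (fun i => f i 0) k nd); rewrite -E0.
have lenE k : hlen (fun i => f i 0) k = hlen s0 k.
  have r20 : 2 / r != 0 by rewrite mulf_neq0 ?invr_eq0 // gt_eqF // r3_gt0.
  by apply: (mulfI r20); exact: ell0.
have key k : f (rt 2 k) 0 = s0 (rt 2 k).
  have [l0 l1 _ _ _] := hlens s0 k; have [m0 m1 _ _ _] := hlens (fun i => f i 0) k.
  have := lenE k; have := lenE (rt 1 k); rewrite l0 l1 m0 m1 /=.
  have := fs (rt 2 k); have := s0s (rt 2 k); rewrite !rtD !addnE /=; lra.
by have := key (rt 4 i); rewrite rtD rt60.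
Qed.

(** All the rates are constantly [N], so both [f i] and its opposite have a
derivative bounded by the expected constant almost everywhere. *)
Lemma solution_unique t : 0 <= t < T -> E t = Hex (shrink gamma N s0 t).
Proof.
move=> tT; have [-> _] := EHex tT; congr Hex; apply/funext => i.
by rewrite f_affine // f0.
Qed.

End Uniqueness.

(** * The evolution theorem *)

(** The two cases enter only through this integer and its margins: [zeta] is the
margin of the lengths above [A / (N + 1)], and [xi] the one below [A] for
[N = 1], where a rate [N - 1] would mean a side at rest. *)
Lemma integer_window (R : realType) (A : R) (L : 'I_6 -> R) : 0 < A -> (forall i, 0 < L i) ->
  (forall i, A < L i) \/ (exists2 l, l < A & forall i, L i = l) ->
  exists N : nat, exists zeta xi : R,
    [/\ 0 < zeta /\ 0 < xi, forall k, A + zeta * N.+1%:R <= L k * N.+1%:R,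
        forall k, L k * N%:R <= A & N = 1%N -> forall k, L k + xi <= A].
Proof.
move=> A0 Lpos LA.
have [N [xi [xi0 gap le lt]]] : exists N : nat, exists xi : R,
    [/\ 0 < xi, forall i, A < L i * N.+1%:R, forall i, L i * N%:R <= A &
        N = 1%N -> forall i, L i + xi <= A].
  case: LA => [LA|[l lA Ll]].
    by exists 0%N, 1; split=> // i; rewrite ?mulr1 // mulr0 ltW.
  have l0 : 0 < l by rewrite -(Ll ord0).
  exists (Num.truncn (A / l)), (A - l); split=> [|i|i|_ i]; rewrite ?Ll.
  - by rewrite subr_gt0.
  - by rewrite mulrC -ltr_pdivrMr // truncnS_gt.
  - by rewrite mulrC -ler_pdivlMr // truncn_le // divr_ge0 // ltW.
  - by rewrite addrC subrK.
have N1 : 0 < N.+1%:R :> R by rewrite ltr0n.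
have [|zeta z0 hz] := @finite_min R (fun i => L i - A / N.+1%:R).
  by move=> i; rewrite subr_gt0 ltr_pdivrMr.
exists N, zeta, xi; split=> // k.
have : (zeta + A / N.+1%:R) * N.+1%:R <= L k * N.+1%:R.
  by rewrite ler_pM2r // -lerBrDr.
by rewrite mulrDl divfK ?gt_eqF // addrC.
Qed.

Theorem theorem3p6 (R : realType) (gamma : R) (gamma_gt0 : 0 < gamma)
    (E0 : set (plane R)) (L0 : 'I_6 -> R)
    (E0_hexagon : convex_hexagon E0) (E0_sym : origin_symmetric E0)
    (L0E : forall i, L0 i = side_length E0 i)
    (Eeps : R -> nat -> set (plane R))
    (Eeps0 : forall eps, 0 < eps ->
      [/\ discrete_hexagon eps (Eeps eps 0%N), origin_symmetric (Eeps eps 0%N) &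
          (hausdorff_dist (envelope (Eeps eps 0%N)) E0 < eps%:E)%E])
    (EepsS : forall eps k, 0 < eps ->
      is_minimizer (gamma * eps) eps (Eeps eps k) (Eeps eps k.+1))
    (cases : (forall i, alpha_hex * gamma < L0 i) \/
             (exists2 L : R, L < alpha_hex * gamma & forall i, L0 i = L)) :
  exists2 T : R, 0 < T & exists E : R -> set (plane R),
    [/\ is_solution gamma L0 T E,
        (forall E', is_solution gamma L0 T E' ->
           forall t, 0 <= t < T -> E' t = E t),
        (forall b delta, 0 <= b < T -> 0 < delta ->
           \forall eps \near (0 : R)^'+, forall t, 0 <= t <= b ->
             (hausdorff_dist
                (envelope (Eeps eps (Num.truncn (t / (gamma * eps))))) (E t)
              < delta%:E)%E) &
        side_length_law gamma T E].
Proof.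
have [s0 s0n E0E] := convex_hexagonP E0_hexagon.
have s0s k : s0 (rt 3 k) = s0 k by apply: Hex_symmetric => //; rewrite -E0E.
have {}L0E : L0 = fun k => 2 / Num.sqrt 3 * hlen s0 k.
  by apply/funext => k; rewrite L0E E0E side_length_Hex.
have A0 : 0 < alpha_hex * gamma by rewrite /alpha_hex mulr_gt0 // divr_gt0.
have Lpos i : 0 < L0 i by rewrite L0E mulr_gt0 // divr_gt0 // sqrtr_gt0.
have [N [zeta [xi [[z0 x0] Lge Lle Llt]]]] := integer_window A0 Lpos cases.
exists (gamma * zeta / (2 * N.+1%:R)); first by rewrite divr_gt0 ?mulr_gt0.
exists (fun t => Hex (shrink gamma N s0 t)); subst L0; split.
- exact: is_solution_flow.
- by move=> E' sol t tT; exact: (solution_unique gamma_gt0 z0 x0 s0s Lge Lle Llt sol tT).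
- move=> b delta /andP [b0 bT] d0.
  set C : R := (coarse N)%:R; have C0 : 0 < C by rewrite ltr0n.
  set M := \sum_k `|s0 k| + zeta.
  have M0 : 0 <= M by rewrite addr_ge0 ?sumr_ge0 // ltW.
  near=> eps => t /andP [t0 tb].
  have e0 : 0 < eps by near: eps; exact: nbhs_right_gt.
  have [disc _ close] := Eeps0 eps e0.
  have hz : eps * C < zeta / 8.
    by rewrite -ltr_pdivlMr //; near: eps; apply: nbhs_right_lt; rewrite !divr_gt0.
  have hx : eps * C < xi.
    by rewrite -ltr_pdivlMr //; near: eps; apply: nbhs_right_lt; rewrite !divr_gt0.
  have hA : eps * C < alpha_hex * gamma / 4.
    by rewrite -ltr_pdivlMr //; near: eps; apply: nbhs_right_lt; rewrite !divr_gt0.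
  have hd : eps * C < delta * (zeta / 8) / (2 * M + 1).
    rewrite -ltr_pdivlMr //; near: eps; apply: nbhs_right_lt.
    by rewrite !divr_gt0 ?mulr_gt0 ?divr_gt0 // ltr_wpDl // mulr_ge0.
  apply: le_lt_trans.
    apply: (scale_convergence gamma_gt0 z0 s0n s0s Lge Lle Llt e0 _ _ _ disc).
    + by rewrite mulrC -ler_pdivlMr // ltW.
    + exact: ltW.
    + by rewrite mulrC -ler_pdivlMr // ltW.
    + by rewrite -E0E.
    + by move=> j; exact: EepsS.
    + by rewrite t0 (le_lt_trans tb).
  rewrite lte_fin ltr_pdivrMr ?divr_gt0 // -/M -/C.
  move: hd; rewrite ltr_pdivlMr ?ltr_wpDl ?mulr_ge0 //.
  have : 0 < eps * C by rewrite mulr_gt0.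
  by move: (eps * C) (delta * _) => X Y; clear; lra.
- exact: side_length_law_flow.
Unshelve. all: by end_near. Qed.
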